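(* Assume (IC), (A0), (A1), (A2) (see context), and let $\Delta t<\lambda^{-4}(F(h))^2$, with $F(h)$ as defined in the context. Consider Problem $P^h$ (see context) with $\Psi$ either the regular or the singular potential. Then for any $n=1,\dots,N$ there exists a unique solution $(\phi_h^n,\mu_h^n)\in S^h\times S^h$ of Problem $P^h$, which satisfies the stability estimate $$\frac{1}{2\sqrt{\Delta t}}\|\phi_h^n-\phi_h^{n-1}\|^2+\frac{\Delta t}{2}\|\nabla\mu_h^n\|^2+(\Psi(\phi_h^n),1)^h+\frac12\Big(1-\sqrt{\Delta t}\,\frac{\lambda^2}{F(h)}\Big)\|\nabla\phi_h^n\|^2\le\frac12\|\nabla\phi_h^{n-1}\|^2+(\Psi(\phi_h^{n-1}),1)^h .$$ Besides, in the case of the singular potential, $-1<\phi_h^n<1$. In addition, in the case of the singular potential, assuming (IC), (A0), (A1), (A2) and the smallness condition $|\lambda|<(\sqrt2\,C_g^2)^{-1}$, the following estimate holds with a constant $C$ independent of $\Delta t$ and $h$: $$\sup_{n\in\{1,\dots,N\}}\|\phi_h^n\|^2+\Delta t\sum_{n=1}^N\|\Delta_h\phi_h^n\|^2\le C .$$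
   Context: **Domain, meshes.** $T>0$, $N\in\mathbb N^*$, $\Delta t=T/N$, $\lambda\in\mathbb R$. $\{\mathcal T_h\}_{h>0}$ is a family of conforming partitions of $\Omega\subset\mathbb R^d$ into $d$-simplices $K$, $h_K=\mathrm{diam}(K)$, $h=\max_Kh_K$. (A0) $\Omega\subset\mathbb R^d$, $d=1,2,3$, is a bounded convex domain, polygonal if $d=2$, polyhedral if $d=3$ (an interval if $d=1$). (A1) $\mathcal T_h$ is shape-regular: $\sup_{K}h_K\rho_K^{-1}\le C$ ($\rho_K$ the diameter of the largest ball inscribed in $K$), and quasi-uniform: $h_K\ge Ch$ for all $K$, with constants independent of $h$. (A2) $\mathcal T_h$ is an acute partitioning: for $d=2$ all angles of triangles are $\le\pi/2$; for $d=3$ the angle between any two faces of any tetrahedron is $\le\pi/2$. $S^h=\{\chi\in C(\overline\Omega):\chi|_K\in\mathbb P_1(K)\ \forall K\in\mathcal T_h\}$. $\pi^h:C(\overline\Omega)\to S^h$ is the nodal Lagrange interpolation, $(\eta_1,\eta_2)^h=\int_\Omega\pi^h(\eta_1\eta_2)\,dx$ is the lumped product; $(\cdot,\cdot)$, $\|\cdot\|$ are the $L^2(\Omega)$ product and norm; $\overline f=|\Omega|^{-1}(f,1)$. $\hat P_h:L^2(\Omega)\to S^h$ is defined by $(\hat P_hv,\chi)^h=(v,\chi)$ for all $\chi\in S^h$. The discrete Laplacian $\Delta_h:S^h\to\{v\in S^h:(v,1)=0\}$ is defined by $-(\Delta_hv,\chi)^h=(\nabla v,\nabla\chi)$ for all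 $\chi\in S^h$. **Potentials.** Regular: $\Psi=\Psi_1+\Psi_2$ with $\Psi_1(s)=s^4/4$, $\Psi_2(s)=-s^2/2$. Singular: $\Psi=\Psi_1+\Psi_2$ with $\Psi_1(s)=\frac\theta2((1+s)\log(1+s)+(1-s)\log(1-s))$, $\Psi_2(s)=-\frac{\theta_0}2s^2$, $0<\theta<\theta_0$. (IC) $\phi_0\in H^1(\Omega)$ and, in the singular case, $|\phi_0|\le1$ a.e. in $\Omega$ and $\overline{\phi}_0\in(-1,1)$. Set $\phi_h^0=\hat P_h\phi_0$. **Problem $P^h$.** For $n=1,\dots,N$, given $\phi_h^{n-1}\in S^h$ with $\|\phi_h^{n-1}\|_{H^1(\Omega)}\le C_{n-1}$ (and, in the singular case, $-1\le\phi_h^{n-1}\le1$, $\overline{\phi}_h^{n-1}\in(-1,1)$), find $(\phi_h^n,\mu_h^n)\in S^h\times S^h$ such that for all $(\chi,\xi)\in S^h\times S^h$ $$\Big(\frac{\phi_h^n-\phi_h^{n-1}}{\Delta t},\chi\Big)^h+(\nabla\mu_h^n,\nabla\chi)=0,$$ $$(\mu_h^n,\xi)^h=(\nabla\phi_h^n,\nabla\xi)+(\Psi_1'(\phi_h^n)+\Psi_2'(\phi_h^{n-1}),\xi)^h+\lambda(\nabla\phi_h^n\cdot\nabla\phi_h^{n-1},\xi).$$ Here $C_0,\dots,C_{N-1}$ are positive constants bounding the $H^1$ norms of the successive iterates. **Constants.** $C_p$ is the Poincaré–Wirtinger constant of $\Omega$. $\bar C$ is the constant (independent of $h$) of the inverse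 inequality $|\chi|_{W^{m,p}(\Omega)}\le\bar Ch^{s-m+\frac dp-\frac dq}|\chi|_{W^{s,q}(\Omega)}$ for $\chi\in S^h$, $s,m\in\{0,1\}$, $s\le m$, $1\le q\le p\le\infty$. Then $$F(h):=\min\Big(\frac{4\sqrt4}{3\sqrt3\sqrt{C_p^2+1}},1\Big)\min_{n=1,\dots,N}\frac{h^d}{\bar C^2C_{n-1}^2}\quad\text{(regular potential)},$$ $$F(h):=\min\Big(\frac{4\sqrt4}{3\sqrt3\sqrt{C_p^2+1}},1\Big)\frac{h^2}{\bar C^2}\quad\text{(singular potential)}.$$ $C_g$ is the ($h$-independent) constant in the discrete Gagliardo–Nirenberg inequality $\|\nabla\chi\|_{L^4(\Omega)}\le C_g\|\Delta_h\chi\|^{1/2}\|\chi\|_{L^\infty(\Omega)}^{1/2}$ for all $\chi\in S^h$. If $\lambda=0$, the condition on $\Delta t$ and the smallness condition on $\lambda$ are void. *)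

(* Defs.v *)
From HB Require Import structures.
From mathcomp Require Import all_boot all_order all_algebra.
From mathcomp Require Import all_classical all_reals all_analysis.
Set Implicit Arguments. Unset Strict Implicit. Unset Printing Implicit Defensive.
Import Order.TTheory GRing.Theory Num.Theory.
Import numFieldNormedType.Exports.
Local Open Scope classical_set_scope.
Local Open Scope ring_scope.

Definition tcons (R : realType) n (p : measurableTypeR R * n.-tuple (measurableTypeR R)) :
  n.+1.-tuple (measurableTypeR R) := [tuple of p.1 :: p.2].
Definition tsplit (R : realType) n (t : n.+1.-tuple (measurableTypeR R)) :
  measurableTypeR R * n.-tuple (measurableTypeR R) := (thead t, [tuple of behead t]).

Lemma tconsK (R : realType) n : cancel (@tcons R n) (@tsplit R n).
Proof. by case=> x t; rewrite /tsplit /tcons theadE; congr pair; apply/val_inj. Qed.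

Lemma measurable_tcons (R : realType) n : measurable_fun [set: _] (@tcons R n).
Proof. exact: measurable_cons measurable_fst measurable_snd. Qed.

Lemma measurable_tsplit (R : realType) n : measurable_fun [set: _] (@tsplit R n).
Proof.
apply/measurable_fun_pairP; split => /=.
  exact: measurable_tnth.
exact: measurable_behead.
Qed.

Section leb_succ.
Context (R : realType) (n : nat).
Variable m : {sigma_finite_measure set (n.-tuple (measurableTypeR R)) -> \bar R}.

Definition leb_succ : set (n.+1.-tuple (measurableTypeR R)) -> \bar R :=
  pushforward (@lebesgue_measure R \x m)%E (@tcons R n).

Let mp : {measure set (n.+1.-tuple (measurableTypeR R)) -> \bar R} :=
  measure_function_pushforward__canonical__measure_function_Measure
   (@lebesgue_measure R \x m)%E (@measurable_tcons R n).

Let leb_succ0 : leb_succ set0 = 0%E. Proof. exact: (measure0 mp). Qed.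
Let leb_succ_ge0 A : (0 <= leb_succ A)%E. Proof. exact: (measure_ge0 mp). Qed.
Let leb_succ_sigma_additive : semi_sigma_additive leb_succ.
Proof. exact: (@measure_semi_sigma_additive _ _ _ mp). Qed.

HB.instance Definition _ := isMeasure.Build _ _ _ leb_succ
  leb_succ0 leb_succ_ge0 leb_succ_sigma_additive.

Let leb_succ_sigma_finite : sigma_finite setT leb_succ.
Proof.
have /sigma_finiteP[F [TF ndF Foo]] := sigma_finiteT (@lebesgue_measure R).
have /sigma_finiteP[G [TG ndG Goo]] := sigma_finiteT m.
exists (fun k => @tsplit R n @^-1` (F k `*` G k)).
  rewrite -preimage_bigcup (_ : \bigcup_k _ = setT) ?preimage_setT//.
  rewrite -setXTT TF TG predeqE => -[x y]; split.
    by move=> [k _ []/= ? ?]; split; exists k.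
  move=> [/= [k _ Fkx] [l _ Gly]]; exists (maxn k l) => //; split.
  - by move: x Fkx; exact/subsetPset/ndF/leq_maxl.
  - by move: y Gly; exact/subsetPset/ndG/leq_maxr.
move=> k; have [mF Fk] := Foo k; have [mG Gk] := Goo k; split.
  rewrite -[X in measurable X]setTI; apply: measurable_tsplit => //.
  exact: measurableX.
rewrite /leb_succ /pushforward -comp_preimage.
rewrite (_ : _ \o _ = id); last by apply/funext => x /=; rewrite tconsK.
by rewrite preimage_id product_measure1E// lte_mul_pinfty// ge0_fin_numE.
Qed.

HB.instance Definition _ := Measure_isSigmaFinite.Build _ _ _ leb_succ
  leb_succ_sigma_finite.
End leb_succ.

(* Lebesgue measure on R^n, as the n-fold product of the one-dimensional one *)
Fixpoint leb_tuple (R : realType) (n : nat) :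
    {sigma_finite_measure set (n.-tuple (measurableTypeR R)) -> \bar R} :=
  match n with
  | 0 => dirac [tuple]
  | n'.+1 => leb_succ (leb_tuple R n')
  end.

(* 'rV[R]_d carries its topology; borel R d is the same type with the Borel
   sigma-algebra as measurable structure. *)
Definition borel (R : realType) (d : nat) : Type :=
  g_sigma_algebraType (@open 'rV[R]_d).
HB.instance Definition _ (R : realType) (d : nat) := Measurable.on (borel R d).

Definition rv_of_tuple (R : realType) d (t : d.-tuple (measurableTypeR R)) :
  borel R d := \row_i tnth t i.

Lemma measurable_rv_of_tuple (R : realType) d :
  measurable_fun [set: _] (@rv_of_tuple R d).
Proof.
apply: (@measurability _ _ _ (borel R d) setT (@rv_of_tuple R d) (@open 'rV[R]_d : set (set (borel R d)))) => //.
move=> _ [U oU <-]; rewrite setTI.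
pose B (c : 'rV[rat]_d) (k : nat) : set (d.-tuple (measurableTypeR R)) :=
  \bigcap_(i : 'I_d) (@tnth _ _ ^~ i) @^-1` ball (ratr (c ord0 i) : R) k.+1%:R^-1.
pose G (p : 'rV[rat]_d * nat) := if `[< B p.1 p.2 `<=` @rv_of_tuple R d @^-1` U >]
  then B p.1 p.2 else set0.
have -> : @rv_of_tuple R d @^-1` U = \bigcup_p G p.
  apply/seteqP; split=> [t Ut|t [p _]]; last first.
    by rewrite /G; case: asboolP => // + ?; exact.
  have /nbhs_ballP[e /= e0 eU] : nbhs (rv_of_tuple t : 'rV[R]_d) U.
    exact: open_nbhs_nbhs.
  have [k ke] : exists k : nat, k.+1%:R^-1 < e / 2.
    have := near_infty_natSinv_lt (PosNum (divr_gt0 e0 (ltr0n R 2))).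
    by case=> k _ /(_ k (leqnn _)); exists k.
  have k0 : (0 : R) < k.+1%:R^-1 by rewrite invr_gt0.
  have /choice[c cP] : forall i : 'I_d, exists q : rat,
      ball (tnth t i : R) k.+1%:R^-1 (ratr q).
    move=> i; have := @dense_rat R (ball (tnth t i : R) k.+1%:R^-1).
    case=> [||x [xb [q _ qx]]]; last by exists q; rewrite qx.
      by exists (tnth t i); exact: ballxx.
    exact: ball_open.
  exists (\row_i c i, k) => //=; rewrite /G /=; case: asboolP => [_|[]].
    by move=> i _ /=; rewrite mxE; apply: ball_sym.
  move=> s sB; apply: eU; split => // i j; rewrite !mxE.
  have := sB j I; rewrite /= mxE => sj.
  apply: (@le_ball _ _ _ (k.+1%:R^-1 + k.+1%:R^-1)).
    by rewrite [leRHS]splitr lerD // ltW.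
  exact: ball_triangle (cP j) sj.
apply: countable_bigcupT_measurable => [|p]; first exact: countableP.
rewrite /G; case: ifPn => // _.
rewrite /B; apply: fin_bigcap_measurable => // i _.
rewrite -[X in measurable X]setTI; apply: measurable_tnth => //.
by rewrite ball_itv; apply: measurable_itv.
Qed.

Section leb.
Context (R : realType) (d : nat).
Definition leb : set (borel R d) -> \bar R := pushforward (leb_tuple R d) (@rv_of_tuple R d).
Let mp : {measure set (borel R d) -> \bar R} :=
  measure_function_pushforward__canonical__measure_function_Measure
   (leb_tuple R d) (@measurable_rv_of_tuple R d).
Let leb0 : leb set0 = 0%E. Proof. exact: (measure0 mp). Qed.
Let leb_ge0 A : (0 <= leb A)%E. Proof. exact: (measure_ge0 mp). Qed.
Let leb_sigma_additive : semi_sigma_additive leb.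
Proof. exact: (@measure_semi_sigma_additive _ _ _ mp). Qed.
HB.instance Definition _ := isMeasure.Build _ _ _ leb
  leb0 leb_ge0 leb_sigma_additive.
End leb.

Section geometry.
Context {R : realType} {d : nat}.
Local Notation pt := 'rV[R]_d.

(* The library's norm on 'rV[R]_d is the sup norm, hence the Euclidean one here. *)
Definition dot (u v : pt) : R := \sum_i u 0 i * v 0 i.
Definition enorm (u : pt) : R := Num.sqrt (dot u u).
Definition angle (u v : pt) : R := acos (dot u v / (enorm u * enorm v)).
Definition orth (e u : pt) : pt := u - (dot u e / dot e e) *: e.

Definition polyhedral_domain (Om : set pt) :=
  [/\ Om !=set0, open Om, bounded_set Om,
      convex_set (Om : set (convex_lmodType pt)) &
      exists s : seq (pt * R),
        Om = [set x | forall p, p \in s -> dot p.1 x < p.2]].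

(* A d-simplex is given by the (d+1) x d matrix whose rows are its vertices. *)
Definition vtx (K : 'M[R]_(d.+1, d)) (i : 'I_d.+1) : pt := row i K.

Definition face (J : {pred 'I_d.+1}) (K : 'M[R]_(d.+1, d)) : set pt :=
  [set x | exists w : 'rV[R]_d.+1,
     [/\ forall i, 0 <= w 0 i, forall i, i \notin J -> w 0 i = 0,
         \sum_i w 0 i = 1 & x = w *m K]].
Definition simplex (K : 'M[R]_(d.+1, d)) : set pt := face predT K.

Definition edges (K : 'M[R]_(d.+1, d)) : 'M[R]_d :=
  \matrix_(i < d) (vtx K (lift ord0 i) - vtx K ord0).

Definition diam (K : 'M[R]_(d.+1, d)) : R :=
  sup [set enorm (z.1 - z.2) | z in simplex K `*` simplex K].
Definition indiam (K : 'M[R]_(d.+1, d)) : R :=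
  sup [set 2 * r | r in [set r : R | 0 <= r /\
    exists c, [set x | enorm (x - c) <= r] `<=` simplex K]].

Definition mesh := seq 'M[R]_(d.+1, d).
Definition hmax (Th : mesh) : R := \big[Num.max/0]_(K <- Th) diam K.

Definition conforming (Om : set pt) (Th : mesh) :=
  [/\ forall K, K \in Th -> edges K \in unitmx,
      closure Om = \bigcup_(K in [set K | K \in Th]) simplex K &
      forall K L, K \in Th -> L \in Th -> K != L ->
        interior (simplex K) `&` interior (simplex L) = set0 /\
        simplex K `&` simplex L =
          face [pred i | [exists j, vtx K i == vtx L j]] K].

Definition shape_regular (I : Type) (Th : I -> mesh) :=
  exists C : R, forall i K, K \in Th i -> diam K / indiam K <= C.
Definition quasi_uniform (I : Type) (Th : I -> mesh) :=
  exists2 C : R, 0 < C & forall i K, K \in Th i -> C * hmax (Th i) <= diam K.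

(* For d = 3 the angle between the two faces of K that meet along the edge ab is
   the angle between the components orthogonal to ab of the edges that join a to
   the two other vertices. For d = 1 there is no condition. *)
Definition acute (Th : mesh) := forall K, K \in Th ->
  (d = 2%N -> forall i j k : 'I_d.+1, uniq [:: i; j; k] ->
     angle (vtx K j - vtx K i) (vtx K k - vtx K i) <= pi / 2) /\
  (d = 3%N -> forall a b i j : 'I_d.+1, uniq [:: a; b; i; j] ->
     let e := vtx K b - vtx K a in
     angle (orth e (vtx K i - vtx K a)) (orth e (vtx K j - vtx K a)) <= pi / 2).

End geometry.
Arguments mesh : clear implicits.

Section function_spaces.
Context {R : realType} {d : nat} (Om : set 'rV[R]_d).
Local Notation pt := 'rV[R]_d.
Local Notation mu := (@leb R d).

Definition intg (f : pt -> R) : R := \int[mu]_(x in Om) f x.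
Definition mean (f : pt -> R) : R := (fine (mu Om))^-1 * intg f.
Definition l2norm (f : pt -> R) : R := Num.sqrt (intg (fun x => f x ^+ 2)).
Definition l2vnorm (g : pt -> pt) : R :=
  Num.sqrt (intg (fun x => dot (g x) (g x))).
(* real-valued; used only for functions of finite norm *)
Definition lpnorm (p : \bar R) (f : pt -> R) : R :=
  fine ('N[mu]_p [EFin \o (f \_ Om)])%E.

Definition in_L2 (f : pt -> R) :=
  measurable_fun (Om : set (borel R d)) f /\
  mu.-integrable Om (fun x => (f x ^+ 2)%:E).

Definition partial (i : 'I_d) (f : pt -> R) : pt -> R :=
  fun x => 'D_(delta_mx 0 i) f x.
Definition smooth (f : pt -> R) := forall s : seq 'I_d,
  continuous (foldr partial f s) /\
  forall i x, derivable (foldr partial f s) x (delta_mx 0 i).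
Definition test_function (f : pt -> R) :=
  [/\ smooth f, compact (closure [set x | f x != 0]) &
      closure [set x | f x != 0] `<=` Om].

Definition weak_gradient (v : pt -> R) (g : pt -> pt) :=
  forall i, in_L2 (fun x => g x 0 i) /\
    forall f, test_function f ->
      intg (fun x => v x * partial i f x) = - intg (fun x => g x 0 i * f x).
Definition in_H1 (v : pt -> R) := in_L2 v /\ exists g, weak_gradient v g.

Definition poincare_wirtinger (Cp : R) := forall v g,
  in_L2 v -> weak_gradient v g -> l2norm (fun x => v x - mean v) <= Cp * l2vnorm g.

End function_spaces.

Section finite_elements.
Context {R : realType} {d : nat} (Om : set 'rV[R]_d) (Th : mesh R d).
Local Notation pt := 'rV[R]_d.

(* Elements of S^h are functions on closure Om: values elsewhere are irrelevant. *)
Definition in_Sh (chi : pt -> R) :=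
  {within closure Om, continuous chi} /\
  forall K, K \in Th -> exists (a : R) (g : pt),
    forall x, simplex K x -> chi x = a + dot g x.

(* gradient of the affine function that agrees with f at the vertices of K *)
Definition vgrad (K : 'M[R]_(d.+1, d)) (f : pt -> R) : pt :=
  (invmx (edges K) *m \col_i (f (vtx K (lift ord0 i)) - f (vtx K ord0)))^T.

(* an element that contains x; the choice matters only on element boundaries,
   and, for the gradient below, only on a null set *)
Definition elt (x : pt) : 'M[R]_(d.+1, d) :=
  nth 0 Th (find (fun K => x \in simplex K) Th).

Definition pih (f : pt -> R) : pt -> R := fun x =>
  f (vtx (elt x) ord0) + dot (vgrad (elt x) f) (x - vtx (elt x) ord0).
Definition grad (chi : pt -> R) : pt -> pt := fun x => vgrad (elt x) chi.

Definition lump (f g : pt -> R) : R := intg Om (pih (fun x => f x * g x)).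
Definition gradip (f g : pt -> R) : R :=
  intg Om (fun x => dot (grad f x) (grad g x)).
Definition gradnorm (f : pt -> R) : R := l2vnorm Om (grad f).
Definition h1norm (f : pt -> R) : R :=
  Num.sqrt (l2norm Om f ^+ 2 + gradnorm f ^+ 2).

(* For m = 1, the L^p norm of the Euclidean norm of the gradient. *)
Definition seminorm (m : nat) (p : \bar R) (chi : pt -> R) : R :=
  if m is 0%N then lpnorm Om p chi else lpnorm Om p (fun x => enorm (grad chi x)).

Definition Phat (v : pt -> R) : pt -> R :=
  xget (cst 0) [set p | in_Sh p /\
    forall chi, in_Sh chi -> lump p chi = intg Om (fun x => v x * chi x)].

Definition dlap (f : pt -> R) : pt -> R :=
  xget (cst 0) [set w | [/\ in_Sh w, intg Om w = 0 &
    forall chi, in_Sh chi -> - lump w chi = gradip f chi]].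

Definition inverse_inequality (Cbar : R) :=
  forall (s m : nat) (p q : \bar R), (s <= m <= 1)%N -> (1 <= q)%E -> (q <= p)%E ->
  forall chi, in_Sh chi ->
    seminorm m p chi <= Cbar *
      hmax Th `^ (s%:R - m%:R + d%:R * fine (inve p) - d%:R * fine (inve q)) *
      seminorm s q chi.

Definition gagliardo_nirenberg (Cg : R) := forall chi, in_Sh chi ->
  lpnorm Om 4%:E (fun x => enorm (grad chi x)) <=
    Cg * Num.sqrt (l2norm Om (dlap chi)) * Num.sqrt (lpnorm Om +oo%E chi).

End finite_elements.

Variant potential (R : Type) := Regular | Singular of R & R.
Arguments Regular {R}.

Section potentials.
Context {R : realType} (pot : potential R).

Definition singular : bool := if pot is Singular _ _ then true else false.
Definition valid_potential :=
  if pot is Singular theta theta0 then 0 < theta < theta0 else true.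

(* In the singular case Psi is meant on [-1, 1] only, with 0 log 0 = 0. *)
Definition Psi1 (s : R) : R :=
  match pot with
  | Regular => s ^+ 4 / 4
  | Singular theta _ =>
      theta / 2 * ((1 + s) * ln (1 + s) + (1 - s) * ln (1 - s))
  end.
Definition Psi2 (s : R) : R :=
  match pot with
  | Regular => - (s ^+ 2 / 2)
  | Singular _ theta0 => - (theta0 / 2 * s ^+ 2)
  end.
Definition Psi (s : R) : R := Psi1 s + Psi2 s.
Definition dom_Psi : set R := if singular then [set s | -1 <= s <= 1] else setT.

End potentials.

Section scheme.
Context {R : realType} {d : nat} (pot : potential R) (Om : set 'rV[R]_d).
Local Notation pt := 'rV[R]_d.

Definition initial_condition (phi0 : pt -> R) :=
  in_H1 Om phi0 /\
  (singular pot -> {ae @leb R d, forall x, Om x -> `|phi0 x| <= 1} /\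
                   -1 < mean Om phi0 < 1).

Context (Th : mesh R d) (lam Dt : R) (phi0 : pt -> R) (C : nat -> R).

(* Here and below C n bounds the H^1 norm of the n-th iterate, 0 <= n < N. *)
Definition step_data (n : nat) (prev : pt -> R) :=
  [/\ in_Sh Om Th prev,
      n = 1%N -> {in closure Om, prev =1 Phat Om Th phi0},
      h1norm Om Th prev <= C n.-1 &
      singular pot -> (forall x, closure Om x -> -1 <= prev x <= 1) /\
                      -1 < mean Om prev < 1].

(* For Psi_1'(phi) to make sense at the nodes, which is all that the lumped product
   uses, phi must take there values in the domain of Psi at which Psi_1 is
   differentiable; the library's derivative is total. *)
Definition step_solution (prev phi mu : pt -> R) :=
  [/\ in_Sh Om Th phi, in_Sh Om Th mu,
      forall K i, K \in Th ->
        dom_Psi pot (phi (vtx K i)) /\ derivable (Psi1 pot) (phi (vtx K i)) 1 &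
      forall chi xi, in_Sh Om Th chi -> in_Sh Om Th xi ->
        lump Om Th (fun x => (phi x - prev x) / Dt) chi + gradip Om Th mu chi = 0 /\
        lump Om Th mu xi =
          gradip Om Th phi xi +
          lump Om Th
            (fun x => derive1 (Psi1 pot) (phi x) + derive1 (Psi2 pot) (prev x)) xi +
          lam * intg Om (fun x => dot (grad Th phi x) (grad Th prev x) * xi x)].

Definition trajectory (N : nat) (phi mu : nat -> pt -> R) :=
  forall n, (1 <= n <= N)%N ->
    step_data n (phi n.-1) /\ step_solution (phi n.-1) (phi n) (mu n).

Definition Fh (N : nat) (Cp Cbar : R) : R :=
  Num.min (4 * Num.sqrt 4 / (3 * Num.sqrt 3 * Num.sqrt (Cp ^+ 2 + 1))) 1 *
  (if singular pot then hmax Th ^+ 2 / Cbar ^+ 2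
   else \big[Num.min/hmax Th ^+ d / (Cbar ^+ 2 * C 0%N ^+ 2)]_(1 <= n < N.+1)
          (hmax Th ^+ d / (Cbar ^+ 2 * C n.-1 ^+ 2))).

Definition stability_estimate (F : R) (prev phi mu : pt -> R) :=
  (2 * Num.sqrt Dt)^-1 * l2norm Om (fun x => phi x - prev x) ^+ 2 +
  Dt / 2 * gradnorm Om Th mu ^+ 2 +
  lump Om Th (fun x => Psi pot (phi x)) (cst 1) +
  2^-1 * (1 - Num.sqrt Dt * (lam ^+ 2 / F)) * gradnorm Om Th phi ^+ 2
  <= 2^-1 * gradnorm Om Th prev ^+ 2 +
     lump Om Th (fun x => Psi pot (prev x)) (cst 1).

End scheme.

(* Main.v *)
(** A function of S^h is a nodal vector, and the scheme becomes
    w (phi - prev) + Dt A mu = 0,  w mu = A phi + w Psi_1'(phi) + k + lam B phi,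
    where w > 0 holds the lumped masses, A is the stiffness matrix and B the matrix
    of (grad phi . grad prev, xi). If L bounds |grad prev|, then
    (B x, y)^2 <= L^2 (A x, x) (w y, y). Testing the difference (e, m) of two
    solutions with m and e gives |e|^2 <= Dt |grad m| |grad e|, so that the lambda
    term is at most |lam| L Dt^(1/4) a^(3/2) b^(1/2) with a = |grad e| and
    b = Dt^(1/2) |grad m|; as L^2 <= 1/F by the inverse inequality, the assumption
    on Dt makes the scheme strongly monotone. This yields uniqueness, and existence
    follows because the minimum of the squared residual of a strongly monotone
    locally Lipschitz map is a zero. In the singular case Psi_1' is truncated first;
    comparison with the constant solution mean(prev) in (-1,1) bounds Psi_1' at the
    nodes independently of the truncation. Stability is the test with mu and
    phi - prev. The second estimate is the test with the discrete Laplacian: by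
    acuteness the Psi_1' term has a sign, Gagliardo-Nirenberg with |phi| <= 1 absorbs
    the lambda term, and for the first step the inverse inequality together with
    Dt < lam^-4 F^2 bounds Dt |Delta_h phi^0|^2.

    The only property of the measures used is that nonempty open sets have positive
    measure: the exact lumped masses are never needed. *)
Require Import Defs.
From mathcomp Require Import all_boot all_order all_algebra.
From mathcomp Require Import all_classical all_reals all_analysis.
From mathcomp Require Import measurable_realfun ess_sup_inf ring lra zify.
Set Implicit Arguments. Unset Strict Implicit. Unset Printing Implicit Defensive.
Import Order.TTheory GRing.Theory Num.Theory.
Import numFieldNormedType.Exports.
Local Open Scope classical_set_scope.
Local Open Scope ring_scope.

(** * Strongly monotone maps of R^n *)

(** Constants shape the existence proof: [A] annihilates them, so the first equation fixes the mass
    of phi and leaves mu free up to a constant. Hence mu is eliminated by inverting [A] on data of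
    mean zero, the unknown becomes the deviation of phi from the mean of prev, and a rank-one term
    built from [w] makes the reduced map strongly monotone on all of R^n. The additive constant of
    mu returns at the end as a multiplier. The matrix [B] is in general not symmetric, so the
    reduced equation is not the Euler equation of a convex functional; this is why a residual is
    minimised rather than an energy.

    In the estimate of the Laplacian, the lambda term contains the Laplacians of both the new and
    the old iterate, with weights 3/4 and 1/4 after Young's inequality. The share of the old iterate
    is arranged to telescope over the steps; only the one of phi^0 survives, which is why it has to
    be bounded separately. *)

Section dot.
Context {R : realType} {n : nat}.
Implicit Types (u v x y : 'rV[R]_n) (a : R).

Lemma dotE u v : dot u v = (u *m v^T) 0 0.
Proof. by rewrite mxE; apply: eq_bigr => i _; rewrite mxE. Qed.

Lemma dotC u v : dot u v = dot v u.
Proof. by apply: eq_bigr => i _; rewrite mulrC. Qed.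

Lemma dotDl u v x : dot (u + v) x = dot u x + dot v x.
Proof. by rewrite !dotE mulmxDl mxE. Qed.

Lemma dotZl a u x : dot (a *: u) x = a * dot u x.
Proof. by rewrite !dotE -scalemxAl mxE. Qed.

Lemma dotNl u x : dot (- u) x = - dot u x.
Proof. by rewrite -scaleN1r dotZl mulN1r. Qed.

Lemma dotBl u v x : dot (u - v) x = dot u x - dot v x.
Proof. by rewrite dotDl dotNl. Qed.

Lemma dotDr u v x : dot x (u + v) = dot x u + dot x v.
Proof. by rewrite dotC dotDl !(dotC x). Qed.

Lemma dotZr a u x : dot x (a *: u) = a * dot x u.
Proof. by rewrite dotC dotZl (dotC x). Qed.

Lemma dotNr u x : dot x (- u) = - dot x u.
Proof. by rewrite dotC dotNl (dotC x). Qed.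

Lemma dotBr u v x : dot x (u - v) = dot x u - dot x v.
Proof. by rewrite dotDr dotNr. Qed.

Lemma dot0l x : dot 0 x = 0.
Proof. by rewrite -(scale0r 0) dotZl mul0r. Qed.

Lemma dot0r x : dot x 0 = 0.
Proof. by rewrite dotC dot0l. Qed.

Lemma dot_mulmx (A : 'M[R]_n) u v : dot (u *m A) v = dot u (v *m A^T).
Proof. by rewrite !dotE trmx_mul trmxK mulmxA. Qed.

Lemma dot_ge0 u : 0 <= dot u u.
Proof. by apply: sumr_ge0 => i _; rewrite -expr2 sqr_ge0. Qed.

Lemma dot_eq0 u : dot u u = 0 -> u = 0.
Proof.
move=> /eqP; rewrite psumr_eq0 => [/allP u0|i _]; last by rewrite -expr2 sqr_ge0.
apply/rowP => i; rewrite mxE; apply/eqP.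
by have := u0 i (mem_index_enum i); rewrite /= -expr2 sqrf_eq0.
Qed.

Lemma dot_nondeg u : (forall v, dot u v = 0) -> u = 0.
Proof. by move=> u0; apply: dot_eq0. Qed.

Definition dotDZ := (dotDl, dotDr, dotBl, dotBr, dotZl, dotZr, dotNl, dotNr, dot0l, dot0r).

End dot.

Lemma normr_le_sqr {R : realDomainType} (a b : R) :
  0 <= b -> a ^+ 2 <= b ^+ 2 -> `|a| <= b.
Proof. by move=> b0 h; rewrite -(@ler_pXn2r _ 2)// ?nnegrE// real_normK ?num_real. Qed.

(** Common source of the Cauchy-Schwarz inequalities for semidefinite matrices and for integrals;
    [c = 0] is allowed because these forms may degenerate. *)
Lemma discriminant_le {R : realFieldType} (a b c : R) :
  0 <= c -> (forall t, 0 <= a + 2 * t * b + t ^+ 2 * c) -> b ^+ 2 <= a * c.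
Proof.
move=> c0 H; have [c_eq0|cn0] := eqVneq c 0.
  have [->|bn0] := eqVneq b 0; first by rewrite c_eq0 mulr0 expr0n.
  (* The polynomial is now affine in t, and this value of t makes it -1. *)
  have := H (- (a + 1) / (2 * b)).
  rewrite c_eq0 mulr0 addr0 (_ : 2 * _ * b = - (a + 1)); last by field.
  lra.
have cp : 0 < c by rewrite lt_neqAle eq_sym cn0.
have := H (- b / c).
rewrite (_ : a + _ + _ = (a * c - b ^+ 2) / c); last by field.
by rewrite pmulr_lge0 ?invr_gt0// subr_ge0.
Qed.

Section psd.
Context {R : realType} {n : nat} (A : 'M[R]_n).
Hypotheses (Asym : A^T = A) (A0 : forall x : 'rV_n, 0 <= dot (x *m A) x).

Lemma dot_sym x y : dot (x *m A) y = dot (y *m A) x.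
Proof. by rewrite dot_mulmx Asym dotC. Qed.

Lemma psd_cauchy_schwarz x y :
  dot (x *m A) y ^+ 2 <= dot (x *m A) x * dot (y *m A) y.
Proof.
apply: discriminant_le => // t; have := A0 (x + t *: y).
rewrite mulmxDl -scalemxAl !dotDZ (dot_sym y x).
by congr (_ <= _); ring.
Qed.

End psd.

Lemma cauchy_schwarz_dot {R : realType} {n} (x y : 'rV[R]_n) :
  dot x y ^+ 2 <= dot x x * dot y y.
Proof.
have := @psd_cauchy_schwarz R n 1%:M (trmx1 _ _) _ x y.
by rewrite !mulmx1; apply => z; rewrite mulmx1 dot_ge0.
Qed.

(** * Pointwise Lipschitz maps and zeros of strongly monotone maps *)

Section loclip.
Context {R : realType}.

(** One end of the comparison is always the centre [x]: this is pointwise Lipschitz continuity,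
    weaker than the usual local notion. It suffices for a descent step from a minimiser and is
    stable under composition. *)
Definition loclip (V W : normedModType R) (f : V -> W) := forall x, exists L e : R,
  [/\ 0 < e, 0 <= L & forall y, `|y - x| <= e -> `|f y - f x| <= L * `|y - x|].

Lemma loclip_continuous (V W : normedModType R) (f : V -> W) :
  loclip f -> continuous f.
Proof.
move=> lf x; have [L [e [e0 L0 He]]] := lf x.
apply/cvgrPdist_le => /= eps eps0.
near=> y; rewrite distrC; apply: (le_trans (He _ _)).
  by rewrite distrC; near: y; apply: cvgr_dist_le.
apply: (@le_trans _ _ (L * (eps / (L + 1)))).
  apply: ler_wpM2l => //; rewrite distrC; near: y.
  by apply: cvgr_dist_le => //; rewrite divr_gt0// ltr_wpDl.
rewrite mulrCA ger_pMr// ler_pdivrMr ?ltr_wpDl//; lra.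
Unshelve. all: by end_near. Qed.

Lemma loclip_cst (V W : normedModType R) (a : W) : loclip (fun _ : V => a).
Proof. by move=> x; exists 0, 1; split=> // y _; rewrite subrr normr0 mul0r. Qed.

Lemma loclipD (V W : normedModType R) (f g : V -> W) :
  loclip f -> loclip g -> loclip (fun x => f x + g x).
Proof.
move=> lf lg x; have [L [e [e0 L0 He]]] := lf x; have [M [d [d0 M0 Hd]]] := lg x.
exists (L + M), (Num.min e d); split; [by rewrite lt_min e0|exact: addr_ge0|].
move=> y; rewrite le_min => /andP[ye yd]; rewrite mulrDl.
rewrite (_ : _ - _ = (f y - f x) + (g y - g x)); last by rewrite opprD addrACA.
by rewrite (le_trans (ler_normD _ _))// lerD ?He ?Hd.
Qed.

Lemma loclipZ (V W : normedModType R) (a : R) (f : V -> W) :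
  loclip f -> loclip (fun x => a *: f x).
Proof.
move=> lf x; have [L [e [e0 L0 He]]] := lf x.
exists (`|a| * L), e; split => //; first by rewrite mulr_ge0.
by move=> y ye; rewrite -scalerBr normrZ -mulrA ler_wpM2l// He.
Qed.

Lemma loclip_sum (V W : normedModType R) (I : Type) (s : seq I) (f : I -> V -> W) :
  (forall i, loclip (f i)) -> loclip (fun x => \sum_(i <- s) f i x).
Proof.
move=> lf; elim: s => [|i s IHs].
  rewrite (_ : (fun _ => _) = fun=> 0); first exact: loclip_cst.
  by apply/funext => x; rewrite big_nil.
rewrite (_ : (fun _ => _) = fun x => f i x + \sum_(i <- s) f i x).
  exact: loclipD.
by apply/funext => x; rewrite big_cons.
Qed.

Lemma loclip_comp (U V W : normedModType R) (f : U -> V) (g : V -> W) :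
  loclip f -> loclip g -> loclip (g \o f).
Proof.
move=> lf lg x; have [L [e [e0 L0 He]]] := lf x; have [M [d [d0 M0 Hd]]] := lg (f x).
(* The second radius keeps [f y] in the ball where the bound on [g] holds; [L + 1] avoids a division
   by zero. *)
exists (M * L), (Num.min e (d / (L + 1))); split; last 2 first.
- exact: mulr_ge0.
- move=> y; rewrite le_min => /andP[ye yd] /=.
  rewrite (le_trans (Hd _ _)) -?mulrA ?ler_wpM2l ?He// (le_trans (He _ ye))//.
  rewrite (le_trans (ler_wpM2l L0 yd))// mulrCA ger_pMr// ler_pdivrMr ?ltr_wpDl//; lra.
- by rewrite lt_min e0 divr_gt0// ltr_wpDl.
Qed.

Lemma rV_entry_le n (x : 'rV[R]_n) i : `|x 0 i| <= `|x|.
Proof. by rewrite [leRHS]/Num.Def.normr/= mx_normrE;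
  exact: (le_bigmax _ (fun ij => `|x ij.1 ij.2|) (0, i)). Qed.

Lemma rV_norm_le n (x : 'rV[R]_n) (M : R) :
  0 <= M -> (forall i, `|x 0 i| <= M) -> `|x| <= M.
Proof.
move=> M0 H; rewrite [leLHS]/Num.Def.normr/= mx_normrE; apply/bigmax_leP; split => // -[i j] _ /=.
by rewrite ord1.
Qed.

Lemma loclip_entry n i : loclip (fun x : 'rV[R]_n => x 0 i).
Proof.
move=> x; exists 1, 1; split => // y _; rewrite mul1r.
by rewrite (le_trans _ (rV_entry_le _ i))// !mxE.
Qed.

Lemma loclip_rV (V : normedModType R) n (f : V -> 'rV[R]_n) :
  (forall i, loclip (fun x => f x 0 i)) -> loclip f.
Proof.
move=> lf x; have /choice[L] := fun i => lf i x.
move=> /choice[e H].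
have e0 i : 0 < e i by have [] := H i.
have L0 i : 0 <= L i by have [] := H i.
exists (\sum_i L i), (\big[Num.min/1]_i e i); split.
- by apply/bigmin_gtP; split.
- exact: sumr_ge0.
- move=> y ye; apply: rV_norm_le => [|i]; first by rewrite mulr_ge0// sumr_ge0.
  have [_ _ Hi] := H i; rewrite !mxE (le_trans (Hi _ _))//.
    by rewrite (le_trans ye)//; exact: bigmin_le_cond.
  by rewrite ler_wpM2r// (bigD1 i)//= lerDl sumr_ge0.
Qed.

Lemma loclip_mulmx (V : normedModType R) m n (A : 'M[R]_(m, n)) (f : V -> 'rV[R]_m) :
  loclip f -> loclip (fun x => f x *m A).
Proof.
move=> lf; apply: loclip_rV => i.
rewrite (_ : (fun _ => _) = fun x => \sum_j A j i *: f x 0 j).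
  by apply: loclip_sum => j; apply: loclipZ; exact: (loclip_comp lf (loclip_entry j)).
by apply/funext => x; rewrite mxE; apply: eq_bigr => j _; rewrite mulrC.
Qed.

(** With [norm_dot_le], this links the sup norm, in which compactness and [loclip] are phrased, to
    the Euclidean form, in which monotonicity is phrased. *)
Lemma dot_norm_le n (x : 'rV[R]_n) : dot x x <= n%:R * `|x| ^+ 2.
Proof.
have <- : \sum_(i < n) `|x| ^+ 2 = n%:R * `|x| ^+ 2.
  by rewrite sumr_const card_ord mulr_natl.
apply: ler_sum => i _; rewrite -expr2 -[x 0 i ^+ 2]real_normK ?num_real//.
by rewrite ler_pXn2r ?nnegrE// rV_entry_le.
Qed.

Lemma norm_dot_le n (x : 'rV[R]_n) : `|x| ^+ 2 <= dot x x.
Proof.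
suff : `|x| <= Num.sqrt (dot x x).
  by rewrite -(ler_pXn2r (_ : 0 < 2)%N)// ?nnegrE ?sqrtr_ge0// sqr_sqrtr ?dot_ge0.
apply: rV_norm_le => [|i]; first exact: sqrtr_ge0.
rewrite -sqrtr_sqr ler_wsqrtr// /dot (bigD1 i)//= -expr2 lerDl.
by apply: sumr_ge0 => j _; rewrite -expr2 sqr_ge0.
Qed.

Lemma dot_continuous n (V : topologicalType) (f g : V -> 'rV[R]_n) :
  continuous f -> continuous g -> continuous (fun x => dot (f x) (g x)).
Proof.
move=> cf cg; apply: continuous_big => [|i _ x]; first exact: add_continuous.
apply: cvgM.
  exact: (@continuous_comp _ _ _ f (fun v : 'rV_n => v 0 i) x (cf x) (@coord_continuous R 1 n 0
    i _)).
exact: (@continuous_comp _ _ _ g (fun v : 'rV_n => v 0 i) x (cg x) (@coord_continuous R 1 n 0 i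
  _)).
Qed.

(* The squared residual attains its minimum, and at a nonzero residual r the
   point x - t r has a smaller one, for t small. *)
Lemma strongly_monotone_zero n (S : 'rV[R]_n -> 'rV[R]_n) (a : R) :
  0 < a -> (forall x y, a * dot (x - y) (x - y) <= dot (S x - S y) (x - y)) ->
  loclip S -> exists x, S x = 0.
Proof.
move=> a0 mS lS; have cS := loclip_continuous lS.
pose q x := dot (S x) (S x).
have cq : continuous q by exact: dot_continuous.
(* Monotonicity between [x] and 0 with Cauchy-Schwarz gives a^2 |x|^2 <= |S x - S 0|^2, and the
   parallelogram law does the rest. *)
have coer x : a ^+ 2 * dot x x <= 2 * (q x + q 0).
  have [->|x0] := eqVneq x 0.
    by rewrite dot0l mulr0 mulr_ge0// addr_ge0// dot_ge0.
  have xx : 0 < dot x x.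
    by rewrite lt_neqAle dot_ge0 andbT eq_sym; apply: contra_neq x0; exact: dot_eq0.
  have := mS x 0; rewrite !subr0 => H.
  have := cauchy_schwarz_dot (S x - S 0) x.
  have : (a * dot x x) ^+ 2 <= dot (S x - S 0) x ^+ 2.
    by rewrite ler_pXn2r// ?nnegrE ?mulr_ge0// ?(ltW a0) ?(ltW xx)// (le_trans _ H)//
      mulr_ge0// ltW.
  move=> /le_trans/[apply].
  rewrite exprMn (expr2 (dot x x)) mulrA ler_pM2r// => /le_trans; apply.
  have := dot_ge0 (S x + S 0); rewrite /q !dotDZ (dotC (S 0) (S x)); lra.
(* Outside [D], coercivity forces [q x > q 0]; as 0 lies in [D], a minimum over this compact set is
   global. *)
pose D := [set x : 'rV[R]_n | a ^+ 2 * dot x x <= 4 * q 0].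
have D0 : D 0 by rewrite /D/= dot0l mulr0 mulr_ge0// dot_ge0.
have bD : bounded_set D.
  exists (4 * q 0 / a ^+ 2 + 1); split => //; first by rewrite num_real.
  move=> M HM x; rewrite /D/= => Dx.
  have x2 : `|x| ^+ 2 <= 4 * q 0 / a ^+ 2.
    by rewrite ler_pdivlMr ?exprn_gt0// mulrC (le_trans _ Dx)// ler_wpM2l ?sqr_ge0 ?norm_dot_le.
  have x1 := normr_ge0 x; have : `|x| <= `|x| ^+ 2 + 1 by nra.
  lra.
have cd : continuous (fun x : 'rV[R]_n => dot x x).
  by apply: dot_continuous => y; exact: cvg_id.
have cD : closed D.
  rewrite (_ : D = (fun x => a ^+ 2 * dot x x) @^-1` [set t | t <= 4 * q 0])//.
  apply: closed_comp => [x _|]; last exact: closed_le.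
  by apply: (@continuousM _ _ (fun=> a ^+ 2) (fun y => dot y y));
    [exact: cst_continuous|exact: cd].
have [c cinD minc] : exists2 c, c \in D & forall t, t \in D -> q c <= q t.
  apply: EVT_min_rV; first by exists 0.
    exact: bounded_closed_compact.
  exact: continuous_subspaceT.
have {}minc t : q c <= q t.
  have [tD|tD] := boolP (t \in D); first exact: minc.
  rewrite (le_trans (minc 0 _)) ?inE//.
  move: tD; rewrite notin_setE /D/= => /negP; rewrite -ltNge => Ht.
  have := coer t; lra.
exists c; apply: dot_eq0; apply/eqP; apply: contraT => r0.
have rp : 0 < q c by rewrite lt_neqAle dot_ge0 eq_sym r0.
have [L [e [e0 L0 He]]] := lS c.
pose K := n%:R * L ^+ 2.
have K0 : 0 <= K by rewrite mulr_ge0// sqr_ge0.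
(* The first bound keeps the new point in the Lipschitz ball; the second gives [K * t < a], so that
   the decrease 2 a t q(c) beats the quadratic term K t^2 q(c). *)
pose t := Num.min (e / (`|S c| + 1)) (a / (K + 1)).
have t0 : 0 < t by rewrite lt_min !divr_gt0// ltr_wpDl.
have te : `|c - t *: S c - c| <= e.
  rewrite addrAC subrr add0r normrN normrZ gtr0_norm//.
  apply: (@le_trans _ _ (e / (`|S c| + 1) * `|S c|)).
    by rewrite ler_wpM2r// ge_min lexx.
  rewrite mulrAC ler_pdivrMr ?ltr_wpDl// ler_pM2l// lerDl//.
suff : q (c - t *: S c) < q c by rewrite ltNge minc.
set y := c - t *: S c in te *.
have yc : y - c = - (t *: S c) by rewrite /y addrAC subrr add0r.
have H1 : a * t * q c <= - dot (S y - S c) (S c).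
  have := mS y c; rewrite yc !dotNr dotNl opprK !dotZl !dotZr -/(q c).
  move=> h; rewrite -(ler_pM2l t0); lra.
have H2 : dot (S y - S c) (S y - S c) <= K * t ^+ 2 * q c.
  apply: (le_trans (dot_norm_le _)).
  have -> : K * t ^+ 2 * q c = n%:R * (L ^+ 2 * (t ^+ 2 * q c)) by rewrite /K; ring.
  rewrite ler_wpM2l//.
  have h : `|S y - S c| ^+ 2 <= (L * `|y - c|) ^+ 2.
    by rewrite ler_pXn2r ?nnegrE ?mulr_ge0// He.
  apply: (le_trans h); rewrite exprMn ler_wpM2l ?sqr_ge0//.
  by apply: (le_trans (norm_dot_le _)); rewrite yc !dotDZ /q; lra.
have -> : q y = q c + 2 * dot (S y - S c) (S c) + dot (S y - S c) (S y - S c).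
  by rewrite /q !dotDZ (dotC (S c) (S y)); ring.
have tK : K * t < a.
  apply: (@le_lt_trans _ _ (K * (a / (K + 1)))).
    by rewrite ler_wpM2l// ge_min lexx orbT.
  by rewrite mulrA ltr_pdivrMr ?ltr_wpDl//; lra.
have : K * t ^+ 2 * q c < a * t * q c.
  by rewrite ltr_pM2r// expr2 mulrA ltr_pM2r.
have : 0 < a * t * q c by rewrite !mulr_gt0.
lra.
Qed.

End loclip.

(** * The discrete scheme in nodal coordinates *)

(** Young's inequality with a hypothesis on squares, so that Cauchy-Schwarz bounds can be fed in
    directly and the weights are chosen through [b] and [c]. *)
Lemma amgm_le {R : realType} (a b c : R) :
  0 <= b -> 0 <= c -> a ^+ 2 <= 4 * b * c -> `|a| <= b + c.
Proof.
move=> b0 c0 h; rewrite -(@ler_pXn2r _ 2)// ?nnegrE ?addr_ge0//.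
rewrite real_normK ?num_real// (le_trans h)//.
by have := sqr_ge0 (b - c); rewrite !expr2; nra.
Qed.

Lemma dot_mulmxB {R : realType} n (A : 'M[R]_n) (u v : 'rV_n) : A^T = A ->
  dot ((u - v) *m A) (u - v) = dot (u *m A) u - 2 * dot (u *m A) v + dot (v *m A) v.
Proof. by move=> As; rewrite mulmxBl !dotDZ (dot_sym As v u); ring. Qed.

(** * Uniqueness and stability for the nodal system *)

Section discrete_scheme.
Context {R : realType} {n : nat}.
Variables (w : 'rV[R]_n) (A B : 'M[R]_n) (Dt lam L2 : R).
Hypotheses (w0 : forall i, 0 < w 0 i)
  (Asym : A^T = A) (A0 : forall x : 'rV_n, 0 <= dot (x *m A) x).

Definition wd (x : 'rV[R]_n) : 'rV_n := x *m diag_mx w.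

Lemma wdE x i : wd x 0 i = x 0 i * w 0 i.
Proof. by rewrite /wd mul_mx_diag mxE. Qed.

Lemma dot_wdE x y : dot (wd x) y = \sum_i w 0 i * (x 0 i * y 0 i).
Proof. by apply: eq_bigr => i _; rewrite wdE; ring. Qed.

Lemma dot_wdC x y : dot (wd x) y = dot (wd y) x.
Proof. by rewrite !dot_wdE; apply: eq_bigr => i _; ring. Qed.

Lemma wdD x y : wd (x + y) = wd x + wd y. Proof. exact: mulmxDl. Qed.
Lemma wdB x y : wd (x - y) = wd x - wd y. Proof. exact: mulmxBl. Qed.
Lemma wdZ a x : wd (a *: x) = a *: wd x. Proof. by rewrite /wd scalemxAl. Qed.

Lemma dot_wd_ge0 x : 0 <= dot (wd x) x.
Proof.
by rewrite dot_wdE sumr_ge0// => i _; rewrite mulr_ge0 ?(ltW (w0 i))// -expr2 sqr_ge0.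
Qed.

(** The constant is crude and depends on the mesh; it serves definiteness and existence only. *)
Lemma dot_le_wd x : dot x x <= (\sum_i (w 0 i)^-1) * dot (wd x) x.
Proof.
rewrite mulr_suml; apply: ler_sum => i _.
rewrite [leRHS]mulrC ler_pdivlMr// dot_wdE (bigD1 i)//= -expr2 mulrC lerDl.
by rewrite sumr_ge0// => j _; rewrite mulr_ge0 ?(ltW (w0 j))// -expr2 sqr_ge0.
Qed.

Lemma dot_wd_eq0 x : dot (wd x) x <= 0 -> x = 0.
Proof.
move=> x0; apply: dot_eq0; apply/eqP; rewrite eq_le dot_ge0 andbT.
apply: (le_trans (dot_le_wd x)); apply: mulr_ge0_le0 => //.
by apply: sumr_ge0 => i _; rewrite invr_ge0 ltW.
Qed.

Hypotheses (Dt0 : 0 < Dt) (L20 : 0 <= L2) (small : lam ^+ 4 * L2 ^+ 2 * Dt < 1).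

(** A fourth root, because it is the fourth power of the lambda term that is bounded by a polynomial
    in the two gradient norms. *)
Definition absorb_coef : R := Num.sqrt (Num.sqrt (lam ^+ 4 * L2 ^+ 2 * Dt)).

Lemma absorb_coef_lt1 : absorb_coef < 1.
Proof.
by rewrite /absorb_coef -[ltRHS]sqrtr1 ltr_sqrt// -[ltRHS]sqrtr1 ltr_sqrt.
Qed.

Lemma absorb_coef_exp4 : absorb_coef ^+ 4 = lam ^+ 4 * L2 ^+ 2 * Dt.
Proof.
rewrite (_ : 4 = 2 * 2)%N// exprM /absorb_coef !sqr_sqrtr ?sqrtr_ge0//.
by rewrite mulr_ge0 ?(ltW Dt0)// mulr_ge0 ?sqr_ge0// exprn_even_ge0.
Qed.

(** Here [X] and [Z] stand for |grad e|^2 and Dt |grad m|^2, [E] for the lumped square norm of e.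
    The two hypotheses give (lam t)^4 <= [absorb_coef]^4 X^3 Z, and X^3 Z is one of the terms of (X
    + Z)^4. *)
Lemma absorb X Z E t : 0 <= X -> 0 <= Z -> E ^+ 2 <= Dt * (X * Z) ->
  t ^+ 2 <= L2 * X * E -> (1 - absorb_coef) * (X + Z) <= X + Z + lam * t.
Proof.
move=> X0 Z0 hE ht; suff : `|lam * t| <= absorb_coef * (X + Z).
  by rewrite ler_norml => /andP[]; lra.
have c0 : 0 <= absorb_coef by exact: sqrtr_ge0.
have XZ : 0 <= X + Z by exact: addr_ge0.
rewrite -(@ler_pXn2r _ 4)// ?nnegrE ?mulr_ge0//.
have -> : `|lam * t| ^+ 4 = lam ^+ 4 * t ^+ 4.
  by rewrite -normrX ger0_norm ?exprMn// -exprMn exprn_even_ge0.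
rewrite exprMn absorb_coef_exp4.
have l4 : 0 <= lam ^+ 4 by rewrite exprn_even_ge0.
have h1 : t ^+ 4 <= L2 ^+ 2 * X ^+ 2 * (Dt * (X * Z)).
  apply: (@le_trans _ _ ((L2 * X * E) ^+ 2)).
    rewrite (_ : t ^+ 4 = (t ^+ 2) ^+ 2); last by rewrite -exprM.
    by rewrite ler_pXn2r// ?nnegrE ?sqr_ge0// (le_trans _ ht)// sqr_ge0.
  rewrite !exprMn ler_wpM2l// mulr_ge0 ?sqr_ge0//.
have h2 : X ^+ 3 * Z <= (X + Z) ^+ 4.
  rewrite (_ : (X + Z) ^+ 4 = X ^+ 3 * Z + (X ^+ 4 + 3 * X ^+ 3 * Z +
    6 * X ^+ 2 * Z ^+ 2 + 4 * X * Z ^+ 3 + Z ^+ 4)); last by ring.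
  by rewrite lerDl !addr_ge0 ?mulr_ge0 ?exprn_ge0.
apply: (@le_trans _ _ (lam ^+ 4 * L2 ^+ 2 * Dt * (X ^+ 3 * Z))).
  have -> : lam ^+ 4 * L2 ^+ 2 * Dt * (X ^+ 3 * Z) =
    lam ^+ 4 * (L2 ^+ 2 * X ^+ 2 * (Dt * (X * Z))) by ring.
  exact: ler_wpM2l.
by rewrite ler_wpM2l// mulr_ge0 ?(ltW Dt0)// mulr_ge0 ?sqr_ge0.
Qed.

Hypothesis AB : forall x y : 'rV_n,
  dot (x *m B) y ^+ 2 <= L2 * dot (x *m A) x * dot (wd y) y.
Variables (prev k : 'rV[R]_n).

(** The nonlinearity enters as a free vector [gam] of nodal values, so that one notion covers the
    cubic, the logarithmic derivative and its truncations; [k] carries the explicit term. *)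
Definition solves (gam phi mu : 'rV[R]_n) :=
  wd (phi - prev) + Dt *: (mu *m A) = 0 /\
  wd mu = phi *m A + wd gam + k + lam *: (phi *m B).

Lemma solves_inj gam gam' phi phi' mu mu' :
  solves gam phi mu -> solves gam' phi' mu' ->
  (forall i, 0 <= (gam 0 i - gam' 0 i) * (phi 0 i - phi' 0 i)) -> phi = phi'.
Proof.
move=> [a1 a2] [b1 b2] mono; pose e := phi - phi'; pose m := mu - mu'.
have e1 : wd e = - (Dt *: (m *m A)).
  have -> : wd e = wd (phi - prev) - wd (phi' - prev) by rewrite -wdB /e; congr wd;
    rewrite opprB addrA subrK.
  move/eqP: a1; rewrite addr_eq0 => /eqP ->; move/eqP: b1; rewrite addr_eq0 => /eqP ->.
  by rewrite /m mulmxBl scalerBr opprK opprB addrC.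
have e2 : wd m = e *m A + wd (gam - gam') + lam *: (e *m B).
  rewrite /m wdB a2 b2 /e !mulmxBl scalerBr wdB.
  by apply/rowP => i; rewrite !mxE; ring.
pose X := dot (e *m A) e; pose M := dot (m *m A) m; pose E := dot (wd e) e.
have X0 : 0 <= X by exact: A0. have M0 : 0 <= M by exact: A0.
have EE : E ^+ 2 <= Dt * (X * (Dt * M)).
  have -> : E = - (Dt * dot (m *m A) e) by rewrite /E e1 dotNl dotZl.
  rewrite sqrrN exprMn (_ : Dt * _ = Dt ^+ 2 * (M * X)); last by ring.
  by rewrite ler_wpM2l ?sqr_ge0// psd_cauchy_schwarz.
have G0 : 0 <= dot (wd (gam - gam')) e.
  rewrite dot_wdE sumr_ge0// => i _; rewrite mulr_ge0 ?(ltW (w0 i))//.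
  by rewrite !mxE mono.
have H : X + Dt * M + dot (wd (gam - gam')) e + lam * dot (e *m B) e = 0.
  have : dot (wd m) e = - (Dt * M) by rewrite dot_wdC e1 dotNl dotZl.
  by rewrite e2 !dotDl dotZl -/X => h; rewrite -[LHS]addrA addrAC; lra.
have DM : 0 <= Dt * M by rewrite mulr_ge0// ltW.
have := absorb X0 DM EE (AB e e).
have c1 := absorb_coef_lt1 => h.
have XM : X + Dt * M <= 0.
  rewrite -(@pmulr_rle0 _ (1 - absorb_coef)) ?subr_gt0//; lra.
(* A vanishing gradient alone would only make e constant; it is the first equation, through [EE],
   that makes its lumped norm vanish too. *)
have E0 : E ^+ 2 <= 0.
  have -> : 0 = Dt * (X * (Dt * M)) by rewrite (_ : X = 0) ?mul0r ?mulr0//; lra.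
  exact: EE.
have /eqP : E = 0 by apply/eqP; rewrite -sqrf_eq0 eq_le E0 sqr_ge0.
rewrite eq_le => /andP[/dot_wd_eq0 e0 _].
by apply/eqP; rewrite -subr_eq0; apply/eqP.
Qed.

Lemma solves_inj_mu gam phi mu mu' :
  solves gam phi mu -> solves gam phi mu' -> mu = mu'.
Proof.
move=> [_ a] [_ b]; apply/rowP => i; apply: (mulIf (lt0r_neq0 (w0 i))).
by rewrite -!wdE a b.
Qed.

(** The terms Dt/2 |grad mu|^2 and |grad(phi - prev)|^2 / 2 together dominate E / sqrt Dt, with [E]
    the lumped square norm of phi - prev. Half of this absorbs the lambda term, at the cost of the
    factor 1 - sqrt Dt lam^2 L2; the other half is the first term of the estimate. *)
Lemma solves_stable gam phi mu : solves gam phi mu ->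
  (2 * Num.sqrt Dt)^-1 * dot (wd (phi - prev)) (phi - prev) +
  Dt / 2 * dot (mu *m A) mu +
  (dot (wd gam) (phi - prev) + dot k (phi - prev)) +
  2^-1 * (1 - Num.sqrt Dt * (lam ^+ 2 * L2)) * dot (phi *m A) phi
  <= 2^-1 * dot (prev *m A) prev.
Proof.
move=> [a1 a2]; set dl := phi - prev; set s := Num.sqrt Dt.
have s0 : 0 < s by rewrite sqrtr_gt0.
have ss : s ^+ 2 = Dt by rewrite sqr_sqrtr// ltW.
pose E := dot (wd dl) dl; pose M := dot (mu *m A) mu; pose X := dot (phi *m A) phi.
pose D := dot (dl *m A) dl; pose t := dot (phi *m B) dl.
have e1 : wd dl = - (Dt *: (mu *m A)) by apply/eqP; rewrite -addr_eq0 a1.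
have M0 : 0 <= M by exact: A0. have D0 : 0 <= D by exact: A0.
have X0 : 0 <= X by exact: A0. have E0 : 0 <= E by exact: dot_wd_ge0.
have EE : E ^+ 2 <= Dt ^+ 2 * (M * D).
  have -> : E = - (Dt * dot (mu *m A) dl) by rewrite /E e1 dotNl dotZl.
  by rewrite sqrrN exprMn ler_wpM2l ?sqr_ge0// psd_cauchy_schwarz.
have HE : `|E / s| <= Dt / 2 * M + D / 2.
  apply: amgm_le; rewrite ?mulr_ge0 ?invr_ge0 ?(ltW Dt0)//.
  rewrite expr_div_n ss ler_pdivrMr// (le_trans EE)// le_eqVlt; apply/orP; left.
  by apply/eqP; field.
have ht : t ^+ 2 <= L2 * X * E by exact: AB.
have LXE : 0 <= L2 * X * E by rewrite (le_trans _ ht)// sqr_ge0.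
have Ht : - (lam * t) <= E / (2 * s) + s / 2 * (lam ^+ 2 * (L2 * X)).
  have LX : 0 <= L2 * X by exact: mulr_ge0.
  apply: (le_trans (ler_norm _)); rewrite normrN; apply: amgm_le.
  - by rewrite divr_ge0// mulr_ge0// ltW.
  - by rewrite mulr_ge0 ?divr_ge0 ?(ltW s0)// mulr_ge0 ?sqr_ge0.
  rewrite exprMn (_ : 4 * _ * _ = lam ^+ 2 * (L2 * X * E)).
    by rewrite ler_wpM2l ?sqr_ge0.
  by field; rewrite gt_eqF.
have HP : dot (prev *m A) prev = X - 2 * dot (phi *m A) dl + D.
  have -> : prev = phi - dl by rewrite /dl opprB addrC subrK.
  exact: dot_mulmxB.
have H : - (Dt * M) = dot (phi *m A) dl + dot (wd gam) dl + dot k dl + lam * t.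
  have : dot (wd mu) dl = - (Dt * M) by rewrite dot_wdC e1 dotNl dotZl.
  by rewrite a2 !dotDl dotZl.
have := le_trans (ler_norm _) HE.
rewrite HP -/E -/M -/X.
have -> : (2 * s)^-1 * E = E / (2 * s) by rewrite mulrC.
have -> : E / s = 2 * (E / (2 * s)) by field; rewrite gt_eqF.
lra.
Qed.

End discrete_scheme.

(** * Existence for the nodal system with a monotone nonlinearity defined on all of R *)

Section discrete_existence.
Context {R : realType} {n : nat}.
Variables (w : 'rV[R]_n) (A B : 'M[R]_n) (Dt lam L2 : R).
Hypotheses (n0 : (0 < n)%N) (w0 : forall i, 0 < w 0 i)
  (Asym : A^T = A) (A0 : forall x : 'rV_n, 0 <= dot (x *m A) x)
  (Aker : forall x : 'rV_n, dot (x *m A) x = 0 -> exists c, x = const_mx c)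
  (A1 : (const_mx 1 : 'rV_n) *m A = 0).
Hypotheses (Dt0 : 0 < Dt) (L20 : 0 <= L2) (small : lam ^+ 4 * L2 ^+ 2 * Dt < 1).
Hypothesis AB : forall x y : 'rV_n,
  dot (x *m B) y ^+ 2 <= L2 * dot (x *m A) x * dot (wd w y) y.
Variables (prev k : 'rV[R]_n).

Local Notation wd := (wd w).
Local Notation one := (const_mx 1 : 'rV[R]_n).
Local Notation c := (absorb_coef Dt lam L2).

Definition mass : R := dot w one.

Lemma dot_one x : dot x one = \sum_i x 0 i.
Proof. by apply: eq_bigr => i _; rewrite mxE mulr1. Qed.

Lemma mass_gt0 : 0 < mass.
Proof.
rewrite /mass dot_one (bigD1 (Ordinal n0))//= ltr_pwDl// sumr_ge0// => i _.
exact: ltW.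
Qed.

Lemma wd_one : wd one = w.
Proof. by apply/rowP => i; rewrite wdE mxE mul1r. Qed.

Lemma dot_wd_one x : dot (wd x) one = dot w x.
Proof. by rewrite dot_wdC wd_one. Qed.

Lemma mul_rank1 (x u v : 'rV[R]_n) : x *m (u^T *m v) = dot x u *: v.
Proof.
by rewrite mulmxA [x *m _]mx11_scalar mul_scalar_mx dotE.
Qed.

Lemma one_mulB : one *m B = 0.
Proof.
apply: dot_nondeg => v; apply/eqP; rewrite -sqrf_eq0 eq_le sqr_ge0 andbT.
by rewrite (le_trans (AB _ _))// A1 dot0l mulr0 mul0r.
Qed.

(* Adding the rank-one form of the mean to the stiffness form makes it definite;
   on data of mean zero the inverse solves the pure Neumann problem. *)
Definition neumann : 'M[R]_n := invmx (A + w^T *m w).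

(** A row vector of the kernel, paired with itself, has zero energy and zero mean: it is a constant,
    and the constant is 0. *)
Lemma neumann_unit : A + w^T *m w \in unitmx.
Proof.
rewrite -row_free_unit -kermx_eq0; apply/eqP/row_matrixP => i; rewrite row0.
set x := row i _.
have : x *m (A + w^T *m w) = 0 by rewrite -row_mul mulmx_ker row0.
rewrite mulmxDr mul_rank1 => h.
have : dot (x *m A + dot x w *: w) x = 0 by rewrite h dot0l.
rewrite dotDl dotZl (dotC w) => h2.
have := A0 x; have := sqr_ge0 (dot x w); rewrite expr2 => h3 h4.
have /Aker[a xa] : dot (x *m A) x = 0 by lra.
have : dot x w = 0 by apply/eqP; rewrite -sqrf_eq0 expr2; apply/eqP; lra.
rewrite xa (_ : const_mx a = a *: one); last by apply/rowP => j; rewrite !mxE mulr1.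
rewrite dotZl dotC -/mass => /eqP; rewrite mulf_eq0 (gt_eqF mass_gt0) orbF.
by move=> /eqP ->; rewrite scale0r.
Qed.

Lemma dotA_one x : dot (x *m A) one = 0.
Proof. by rewrite dot_mulmx Asym A1 dot0r. Qed.

(** Pairing with constants kills the stiffness part, so data of mean zero force the rank-one part to
    vanish. *)
Lemma neumannP x : dot x one = 0 -> x *m neumann *m A = x.
Proof.
move=> x1; set z := x *m neumann.
have zE : z *m A + dot z w *: w = x.
  by rewrite -mul_rank1 -mulmxDr /z mulmxKV ?neumann_unit.
have : dot (z *m A + dot z w *: w) one = 0 by rewrite zE.
rewrite dotDl dotA_one add0r dotZl -/mass => /eqP.
rewrite mulf_eq0 (gt_eqF mass_gt0) orbF => /eqP z0.
by rewrite -[RHS]zE z0 scale0r addr0.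
Qed.

(** Eliminating mu leaves - [z] / Dt, up to a constant, so the energy of [z] divided by Dt is the
    [Z] of [absorb]. The second bound interpolates the lumped L^2 norm between the H^1 seminorm and
    its dual. *)
Lemma coercive (e z : 'rV[R]_n) : z *m A = wd e ->
  (1 - c) * (dot (e *m A) e + dot (z *m A) z / Dt) <=
    dot (e *m A) e + dot (z *m A) z / Dt + lam * dot (e *m B) e /\
  dot (wd e) e <= Num.sqrt Dt / 2 * (dot (e *m A) e + dot (z *m A) z / Dt).
Proof.
move=> ze; set X := dot (e *m A) e; set Z := _ / Dt.
have X0 : 0 <= X by exact: A0.
have Z0 : 0 <= Z by rewrite divr_ge0 ?(ltW Dt0).
have EE : dot (wd e) e ^+ 2 <= Dt * (X * Z).
  rewrite -ze (le_trans (psd_cauchy_schwarz Asym A0 z e))// -/X.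
  rewrite le_eqVlt; apply/orP; left; apply/eqP; rewrite /Z; field.
  by rewrite gt_eqF.
split; first exact: (absorb lam Dt0 X0 Z0 EE (AB e e)).
rewrite mulrDr; apply: (le_trans (ler_norm _)); apply: amgm_le.
- by rewrite mulr_ge0// divr_ge0// sqrtr_ge0.
- by rewrite mulr_ge0// divr_ge0// sqrtr_ge0.
- have sD : Num.sqrt Dt * Num.sqrt Dt = Dt by rewrite -expr2 sqr_sqrtr ?ltW.
  rewrite (le_trans EE)// -[in leLHS]sD le_eqVlt; apply/orP; left; by apply/eqP; field.
Qed.

Lemma c_lt1 : c < 1. Proof. exact: absorb_coef_lt1. Qed.

Let beta : R := (1 - c) / Num.sqrt Dt.
Let kappa : R := \sum_i (w 0 i)^-1.

Lemma beta_gt0 : 0 < beta.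
Proof. by rewrite divr_gt0 ?sqrtr_gt0// subr_gt0 c_lt1. Qed.

Lemma kappa_gt0 : 0 < kappa.
Proof.
rewrite /kappa (bigD1 (Ordinal n0))//= ltr_pwDl ?invr_gt0// sumr_ge0// => i _.
by rewrite invr_ge0 ltW.
Qed.

(** Only half of the coercivity is spent on the L^2 norm; the a priori bound uses the other half for
    the data. *)
Lemma coercive_beta (e z : 'rV[R]_n) : z *m A = wd e ->
  beta * dot (wd e) e <= (1 - c) / 2 * (dot (e *m A) e + dot (z *m A) z / Dt).
Proof.
move=> ze; have [_ h] := coercive ze.
apply: (le_trans (ler_wpM2l (ltW beta_gt0) h)).
have sn : Num.sqrt Dt != 0 by rewrite gt_eqF// sqrtr_gt0.
rewrite le_eqVlt; apply/orP; left; apply/eqP; rewrite /beta; field.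
by rewrite sn gt_eqF.
Qed.

Section operator.
Variables (g : R -> R) (mono : forall s t, s <= t -> g s <= g t) (lg : loclip (g : R -> R)).

Let gv (x : 'rV[R]_n) : 'rV_n := \row_i g (x 0 i).
Let m : R := dot w prev / mass.
(** [P] projects onto vectors of mean zero along the constants, and [phi_] thereby builds
    conservation of mass into the unknown. [H] is the second equation with mu eliminated. [S]
    compresses [H] by [P] on both sides and adds the rank-one form of the mean, since the
    compression alone ignores constants. *)
Let P : 'M[R]_n := 1%:M - mass^-1 *: (w^T *m one).
Let H (phi : 'rV[R]_n) := Dt^-1 *: wd (wd (phi - prev) *m neumann) + phi *m A +
  wd (gv phi) + k + lam *: (phi *m B).
Let phi_ (x : 'rV[R]_n) := m *: one + x *m P.
Let S (x : 'rV[R]_n) := H (phi_ x) *m P^T + x *m (w^T *m w).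

Let mulP x : x *m P = x - (dot x w / mass) *: one.
Proof. by rewrite /P mulmxBr mulmx1 -scalemxAr mul_rank1 scalerA mulrC. Qed.

Let dotwP x : dot w (x *m P) = 0.
Proof.
rewrite mulP dotBr dotZr -/mass mulfVK ?gt_eqF ?mass_gt0//.
by rewrite (dotC w) subrr.
Qed.

Let gv_mono x y : 0 <= dot (wd (gv x - gv y)) (x - y).
Proof.
rewrite dot_wdE sumr_ge0// => i _; rewrite mulr_ge0 ?(ltW (w0 i))// !mxE.
have [h|h] := leP (x 0 i) (y 0 i).
  by rewrite -mulrNN mulr_ge0// opprB subr_ge0// mono.
by rewrite mulr_ge0// subr_ge0 ?mono// ltW.
Qed.

Let loclipS : loclip S.
Proof.
have lid : loclip (fun x : 'rV[R]_n => x) by apply: loclip_rV => i; exact: loclip_entry.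
apply: loclipD; last exact: loclip_mulmx.
apply: loclip_mulmx.
have lphi : loclip phi_.
  apply: loclipD; first exact: loclip_cst.
  exact: loclip_mulmx.
apply: (@loclip_comp _ _ _ _ _ H lphi).
apply: loclipD; last by apply/loclipZ/loclip_mulmx.
apply: loclipD; last exact: loclip_cst.
apply: loclipD; last first.
  apply: loclip_mulmx; apply: loclip_rV => i.
  rewrite (_ : (fun _ => _) = g \o (fun x : 'rV[R]_n => x 0 i)).
    exact: loclip_comp (loclip_entry i) lg.
  by apply/funext => x; rewrite mxE.
apply: loclipD; last exact: loclip_mulmx.
apply: loclipZ; do 3!apply: loclip_mulmx.
by apply: loclipD => //; exact: loclip_cst.
Qed.

(** The compression controls the component [e] of mean zero and the rank-one term controls the mean
    [s]; the constant comes from |u|^2 <= 2 |e|^2 + 2 n (s / mass)^2 and the comparison of |e|^2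
    with its lumped form. *)
Let S_mono x y :
  beta / (2 * kappa + 2 * beta * (n%:R / mass ^+ 2)) * dot (x - y) (x - y) <=
    dot (S x - S y) (x - y).
Proof.
set u := x - y; pose e := u *m P; pose s := dot u w.
have uE : u = e + (s / mass) *: one by rewrite /e mulP subrK.
have eE : phi_ x - phi_ y = e by rewrite /phi_ opprD addrACA subrr add0r -mulmxBl.
pose z := wd e *m neumann.
have ze : z *m A = wd e by rewrite neumannP// dot_wd_one dotwP.
have HH : H (phi_ x) - H (phi_ y) =
    Dt^-1 *: wd z + e *m A + wd (gv (phi_ x) - gv (phi_ y)) + lam *: (e *m B).
  have -> : wd z = wd (wd (phi_ x - prev) *m neumann) - wd (wd (phi_ y - prev) *m neumann).
    by rewrite -wdB -mulmxBl -wdB opprB addrA subrK eE.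
  rewrite -eE !mulmxBl (wdB _ (gv _)) /H; apply/rowP => i; rewrite !mxE; ring.
have SS : dot (S x - S y) u = dot (H (phi_ x) - H (phi_ y)) e + s ^+ 2.
  rewrite /S opprD addrACA -!mulmxBl dotDl dot_mulmx trmxK -/e -/u mul_rank1.
  by rewrite dotZl (dotC w).
have [h1 _] := coercive ze; have h2 := coercive_beta ze.
have G0 := gv_mono (phi_ x) (phi_ y); rewrite eE in G0.
set X := dot (e *m A) e in h1 h2; set Z := _ / Dt in h1 h2.
have XZ : 0 <= X + Z by rewrite addr_ge0 ?divr_ge0 ?(ltW Dt0) ?A0.
have c1 := c_lt1.
have lower : beta * dot (wd e) e + s ^+ 2 <= dot (S x - S y) u.
  rewrite SS lerD2r HH !dotDl !dotZl -/X.
  have -> : Dt^-1 * dot (wd z) e = Z.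
    by rewrite dot_wdC -ze /Z mulrC.
  have : (1 - c) / 2 * (X + Z) <= (1 - c) * (X + Z).
    by rewrite ler_wpM2r//; lra.
  lra.
have b0 := beta_gt0; have k0 := kappa_gt0; have m0 := mass_gt0.
have nm0 : 0 <= n%:R / mass ^+ 2 :> R by rewrite divr_ge0// sqr_ge0.
have upper : dot u u <= 2 * kappa * dot (wd e) e + 2 * (n%:R / mass ^+ 2) * s ^+ 2.
  have one1 : dot one one = n%:R :> R.
    by rewrite dot_one (eq_bigr (fun=> 1)) ?sumr_const ?card_ord// => i _; rewrite mxE.
  have := dot_ge0 (e - (s / mass) *: one).
  have := dot_le_wd w0 e.
  rewrite uE !dotDZ one1 (dotC one e) -/kappa.
  have -> : 2 * (n%:R / mass ^+ 2) * s ^+ 2 = 2 * (s / mass * (s / mass * n%:R)).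
    by field; rewrite gt_eqF.
  lra.
apply: (le_trans _ lower).
have den : 0 < 2 * kappa + 2 * beta * (n%:R / mass ^+ 2).
  by rewrite ltr_pwDl ?mulr_gt0// mulr_ge0// mulr_ge0// ltW.
rewrite mulrAC ler_pdivrMr//.
apply: (le_trans (ler_wpM2l (ltW b0) upper)).
have E0 : 0 <= dot (wd e) e by exact: dot_wd_ge0.
set nm := _ / mass ^+ 2 in nm0 *; set E := dot _ e in E0 *.
have s20 := sqr_ge0 s.
have t1 : 0 <= beta * (beta * nm * E).
  exact: (mulr_ge0 (ltW b0) (mulr_ge0 (mulr_ge0 (ltW b0) nm0) E0)).
have t2 : 0 <= kappa * s ^+ 2 by exact: (mulr_ge0 (ltW k0) s20).
lra.
Qed.

(** At a zero of [S], pairing with constants shows that [x] has mean zero. What remains says that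
    [H phi] is killed by the transposed projection, hence is a multiple [ka] of [w]; this multiplier
    is the additive constant of mu. *)
Lemma solves_exists : exists phi mu, solves w A B Dt lam prev k (gv phi) phi mu.
Proof.
have b0 := beta_gt0; have k0 := kappa_gt0; have m0 := mass_gt0.
have den : 0 < 2 * kappa + 2 * beta * (n%:R / mass ^+ 2).
  by rewrite ltr_pwDl ?mulr_gt0// mulr_ge0 ?divr_ge0 ?sqr_ge0// mulr_ge0 ?(ltW b0).
have [x Sx] := strongly_monotone_zero (divr_gt0 b0 den) S_mono loclipS.
have xw : dot x w = 0.
  have : dot (S x) one = 0 by rewrite Sx dot0l.
  rewrite /S dotDl (dot_mulmx P^T) trmxK mulP dotC -/mass mul_rank1 dotZl -/mass.
  rewrite (dotC one) divff ?gt_eqF// scale1r subrr dot0l add0r.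
  by move=> /eqP; rewrite mulf_eq0 (gt_eqF m0) orbF => /eqP.
pose phi := phi_ x; pose ka := dot (H phi) one / mass.
have Hk : H phi = ka *: w.
  move: Sx; rewrite /S mul_rank1 xw scale0r addr0 -/phi.
  rewrite /P linearB/= trmx1 linearZ/= trmx_mul trmxK mulmxBr mulmx1 -scalemxAr.
  rewrite mul_rank1 scalerA -/ka mulrC => /eqP.
  by rewrite subr_eq0 => /eqP.
have pw : dot w (phi - prev) = 0.
  rewrite /phi /phi_ dotBr dotDr dotwP addr0 dotZr -/mass /m mulfVK ?gt_eqF//.
  by rewrite subrr.
pose z := wd (phi - prev) *m neumann.
have zA : z *m A = wd (phi - prev) by rewrite neumannP// dot_wd_one.
exists phi, (ka *: one - Dt^-1 *: z); split.
  rewrite mulmxBl -!scalemxAl A1 scaler0 sub0r zA scalerN scalerA divff ?gt_eqF//.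
  by rewrite scale1r subrr.
rewrite wdB !wdZ wd_one -Hk /H -/z; apply/rowP => i; rewrite !mxE; ring.
Qed.

End operator.

(* Uniformity in g matters: the bound is applied to all truncations of a singular
   nonlinearity at once. *)
Lemma solves_apriori : exists K : R, forall (g : R -> R) (phi mu : 'rV[R]_n),
  solves w A B Dt lam prev k (\row_i g (phi 0 i)) phi mu ->
  \sum_i w 0 i * ((g (phi 0 i) - g (dot w prev / mass)) * (phi 0 i - dot w prev / mass))
    <= K.
Proof.
have b0 := beta_gt0; have k0 := kappa_gt0; have m0 := mass_gt0.
set m := dot w prev / mass.
pose z0 := wd (prev - m *: one) *m neumann.
have m1 : dot w (prev - m *: one) = 0.
  by rewrite dotBr dotZr -/mass /m mulfVK ?gt_eqF// subrr.
have z0A : z0 *m A = wd (prev - m *: one) by rewrite neumannP// dot_wd_one.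
pose Q := dot (z0 *m A) z0.
(* The remainders of two Young inequalities: the term with [z0] is paid by half of the energy of
   [y], the term with [k] by [coercive_beta]. Neither involves [g]. *)
exists (Q / (2 * (1 - c) * Dt) + dot k k * kappa / (4 * beta)).
move=> g phi mu [a1 a2]; set gam := \row_i _ in a2.
pose e := phi - m *: one.
have e1 : wd (phi - prev) = - (Dt *: (mu *m A)) by apply/eqP; rewrite -addr_eq0 a1.
pose y := z0 - Dt *: mu.
have ye : y *m A = wd e.
  rewrite /y mulmxBl z0A -scalemxAl.
  have -> : wd e = wd (phi - prev) + wd (prev - m *: one).
    by rewrite -wdD /e addrA subrK.
  by rewrite e1 addrC.
have eA : e *m A = phi *m A by rewrite /e mulmxBl -scalemxAl A1 scaler0 subr0.
have eB : e *m B = phi *m B by rewrite /e mulmxBl -scalemxAl one_mulB scaler0 subr0.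
have we : dot w e = 0 by rewrite -dot_wd_one -ye dotA_one.
set G := \sum_i _.
(* As [e] has total mass zero, the constant [g m] can be subtracted for free. *)
have HG : dot (wd gam) e = G.
  have -> : dot (wd gam) e = dot (wd (gam - g m *: one)) e.
    by rewrite wdB dotBl wdZ wd_one dotZl we mulr0 subr0.
  by rewrite dot_wdE /G; apply: eq_bigr => i _; rewrite !mxE !mulr1.
have [h1 _] := coercive ye; have h2 := coercive_beta ye.
have kE : dot k e ^+ 2 <= dot k k * (kappa * dot (wd e) e).
  by rewrite (le_trans (cauchy_schwarz_dot _ _))// ler_wpM2l ?dot_ge0// dot_le_wd.
have E0 : 0 <= dot (wd e) e by exact: dot_wd_ge0.
have key : dot (e *m A) e + dot (y *m A) y / Dt + G + dot k e + lam * dot (e *m B) e =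
    dot (y *m A) z0 / Dt.
  have -> : dot (y *m A) z0 / Dt = dot (y *m A) y / Dt + dot (wd mu) e.
    have -> : z0 = y + Dt *: mu by rewrite /y subrK.
    by rewrite dotDr dotZr mulrDl mulrAC divff ?gt_eqF// mul1r ye (dot_wdC w mu).
  by rewrite a2 !dotDl dotZl -eA -eB HG; ring.
have yz : dot (y *m A) z0 ^+ 2 <= dot (y *m A) y * Q by exact: psd_cauchy_schwarz.
set X := dot (e *m A) e in h1 h2 key; set Y := dot (y *m A) y in h1 h2 key yz.
have X0 : 0 <= X by exact: A0. have Y0 : 0 <= Y by exact: A0.
have Q0 : 0 <= Q by exact: A0.
have c1 := c_lt1.
have oc : 0 < 1 - c by rewrite subr_gt0.
have b1 : dot (y *m A) z0 / Dt <= (1 - c) / 2 * (Y / Dt) + Q / (2 * (1 - c) * Dt).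
  apply: (le_trans (ler_norm _)); apply: amgm_le.
  - by rewrite mulr_ge0 ?divr_ge0 ?(ltW oc) ?(ltW Dt0).
  - by rewrite divr_ge0// !mulr_ge0 ?(ltW oc) ?(ltW Dt0).
  - rewrite expr_div_n ler_pdivrMr ?exprn_gt0// (le_trans yz)// le_eqVlt.
    by apply/orP; left; apply/eqP; field; rewrite !gt_eqF.
have b2 : - dot k e <= beta * dot (wd e) e + dot k k * kappa / (4 * beta).
  apply: (le_trans (ler_norm _)); rewrite normrN; apply: amgm_le.
  - by rewrite mulr_ge0// ltW.
  - by rewrite divr_ge0 ?mulr_ge0 ?dot_ge0// ?(ltW k0)// ltW.
  - rewrite (le_trans kE)// le_eqVlt; apply/orP; left; apply/eqP; field.
    by rewrite gt_eqF.
have t1 : 0 <= (1 - c) / 2 * X by rewrite mulr_ge0// divr_ge0// ltW.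
lra.
Qed.

End discrete_existence.

(** * The potentials *)

Section potentials.
Context {R : realType}.
Implicit Types (s t x y h theta M : R).

Lemma not_derivable (f : R -> R) x :
  (forall M e, 0 < e -> exists h, [/\ h != 0, `|h| < e & M * `|h| < `|f (h + x) - f x|]) ->
  ~ derivable f x 1.
Proof.
move=> H; rewrite /derivable => /cvg_ex[l /cvgrPdist_le/(_ 1 ltr01)].
rewrite near_withinE => /nbhs_ballP[e /= e0 He].
have [h [h0 he Mh]] := H (`|l| + 1) e e0.
have := He h; rewrite /ball/= sub0r normrN => /(_ he h0).
rewrite (_ : h *: 1 = h); last by rewrite /GRing.scale/= mulr1.
move=> hl; have : `|h^-1 *: (f (h + x) - f x)| <= `|l| + 1.
  have := ler_normB l (l - h^-1 *: (f (h + x) - f x)).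
  by rewrite opprB addrC subrK => /le_trans; apply; rewrite lerD2l.
rewrite normrZ normfV ler_pdivrMl ?normr_gt0// leNgt => /negP; apply.
by rewrite mulrC.
Qed.

(** The derivative of the logarithmic [Psi1] inside (-1, 1), that is theta artanh s. *)
Definition ell theta s : R := theta / 2 * (ln (1 + s) - ln (1 - s)).

Lemma ellN theta s : ell theta (- s) = - ell theta s.
Proof. by rewrite /ell opprK -mulrN opprB. Qed.

Lemma Psi1N theta theta0 s :
  Psi1 (Singular theta theta0) (- s) = Psi1 (Singular theta theta0) s.
Proof. by rewrite /Psi1/= opprK [X in _ * X = _]addrC. Qed.

Lemma is_derive_Psi1_singular theta theta0 s : -1 < s < 1 ->
  is_derive s 1 (Psi1 (Singular theta theta0)) (ell theta s).
Proof.
move=> /andP[s1 s2].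
have p1 : 0 < 1 + s by lra. have p2 : 0 < 1 - s by lra.
have d1 : is_derive s 1 (fun s => 1 + s) 1.
  have d : is_derive s (1 : R) ((cst 1 : R -> R) + id) (0 + 1) by exact: is_deriveD.
  by rewrite add0r in d.
have d2 : is_derive s 1 (fun s => 1 - s) (- 1).
  have d : is_derive s (1 : R) ((cst 1 : R -> R) - id) (0 - 1) by exact: is_deriveB.
  by rewrite add0r in d.
have l1 : is_derive s 1 (fun s => ln (1 + s)) ((1 + s)^-1 * 1).
  by apply: (@is_derive1_comp _ _ (fun s => 1 + s)); exact: is_derive1_ln.
have l2 : is_derive s 1 (fun s => ln (1 - s)) ((1 - s)^-1 * -1).
  by apply: (@is_derive1_comp _ _ (fun s => 1 - s)); exact: is_derive1_ln.
have m1 := is_deriveM d1 l1; have m2 := is_deriveM d2 l2.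
have d := is_deriveZ (theta / 2) (is_deriveD m1 m2).
rewrite (_ : Psi1 (Singular theta theta0) = (theta / 2) \*:
    ((fun x => 1 + x) * (fun x => ln (1 + x)) + (fun x => 1 - x) * (fun x => ln (1 - x)))%R);
      last first.
  by apply/funext => x; rewrite /Psi1.
apply: (is_derive_eq d); rewrite /ell /GRing.scale/=; field.
by rewrite !gt_eqF.
Qed.

Lemma derive1_Psi1_singular theta theta0 s : -1 < s < 1 ->
  derive1 (Psi1 (Singular theta theta0)) s = ell theta s.
Proof. by move=> /(is_derive_Psi1_singular theta theta0) d; rewrite derive1E derive_val. Qed.

Lemma is_derive_Psi1_regular s : is_derive s 1 (Psi1 Regular) (s ^+ 3).
Proof.
have d := is_deriveZ 4^-1 (is_deriveX 4 (is_derive_id s (1 : R))).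
rewrite (_ : Psi1 Regular = 4^-1 \*: (@id R) ^+ 4); last first.
  by apply/funext => x; rewrite /Psi1/= /GRing.scale/= mulrC.
by apply: (is_derive_eq d); rewrite /GRing.scale/=; field.
Qed.

Lemma derive1_Psi1_regular s : derive1 (Psi1 Regular) s = s ^+ 3.
Proof. by have d := is_derive_Psi1_regular s; rewrite derive1E derive_val. Qed.

Lemma derive1_Psi2 (pot : potential R) s :
  derive1 (Psi2 pot) s = - ((if pot is Singular _ theta0 then theta0 else 1) * s).
Proof.
have H c : derive1 (fun x : R => - (c / 2 * x ^+ 2)) s = - (c * s).
  have d := is_deriveZ (- (c / 2)) (is_deriveX 2 (is_derive_id s (1 : R))).
  rewrite derive1E (_ : (fun _ => _) = (- (c / 2)) \*: (@id R) ^+ 2).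
    by rewrite derive_val /GRing.scale/= expr1; field.
  by apply/funext => x; rewrite -mulNr.
case: pot => [|theta theta0].
  rewrite -(H 1) (_ : Psi2 Regular = (fun x => - (1 / 2 * x ^+ 2)))//.
  by apply/funext => x; rewrite /Psi2 mul1r mulrC.
by rewrite -(H theta0).
Qed.

Lemma ln_le_subr1 x : 0 < x -> ln x <= x - 1.
Proof.
by move=> x0; rewrite -[x in ln x](subrK 1) addrC le_ln1Dx// ltrBDr addrC subrr.
Qed.

(** Tangent inequality for the convex function x ln x, from ln z <= z - 1 at z = x / y. It is
    extended to [y = 0], so that the second argument of convexity may be an end point of [-1, 1]. *)
Lemma mul_ln_diff x y : 0 < x -> 0 <= y ->
  x * ln x - y * ln y <= (ln x + 1) * (x - y).
Proof.
move=> x0; rewrite le_eqVlt => /orP[/eqP <-|y0].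
  by rewrite mul0r !subr0 mulrDl mul1r mulrC lerDl ltW.
have := ln_le_subr1 (divr_gt0 x0 y0).
rewrite ln_div ?posrE// -(ler_pM2r y0) mulrBl mulrBl divfK ?gt_eqF//; lra.
Qed.

Lemma Psi1_singular_convex theta theta0 t s : 0 <= theta -> -1 < t < 1 -> -1 <= s <= 1 ->
  Psi1 (Singular theta theta0) t - Psi1 (Singular theta theta0) s <= ell theta t * (t - s).
Proof.
move=> th /andP[t1 t2] /andP[s1 s2]; rewrite /Psi1/= /ell -mulrBr -mulrA.
apply: ler_wpM2l; first by rewrite divr_ge0.
have a : 0 < 1 + t by lra. have b : 0 <= 1 + s by lra.
have c : 0 < 1 - t by lra. have d : 0 <= 1 - s by lra.
have := mul_ln_diff a b; have := mul_ln_diff c d; lra.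
Qed.

(** This is what makes the nodal condition of [step_solution] exclude -1 and 1: at distance h from
    an end point the term h ln h has unbounded slope. The sign treats both ends at once, as [Psi1]
    is even. *)
Lemma Psi1_singular_not_derivable theta theta0 (b : bool) : 0 < theta ->
  ~ derivable (Psi1 (Singular theta theta0)) ((-1) ^+ b) 1.
Proof.
move=> th; apply: not_derivable => M e e0.
(* The exponential makes theta / 2 * - ln h at least |M| + 1; the other two bounds keep h below e
   and at most 1. *)
pose h := Num.min (Num.min (e / 2) 1) (expR (- (2 * (`|M| + 1) / theta))).
have h0 : 0 < h by rewrite !lt_min divr_gt0//= ltr01 expR_gt0.
have he : h < e by rewrite /h !gt_min ltr_pdivrMr// ltr_pMr// ltr1n.
have h1 : h <= 1 by rewrite /h !ge_min lexx orbT.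
have lnh : ln h <= - (2 * (`|M| + 1) / theta).
  by rewrite -[leRHS]expRK ler_ln ?posrE ?expR_gt0// ge_min lexx orbT.
exists (- ((-1) ^+ b * h)); split.
- by rewrite oppr_eq0 mulf_neq0 ?signr_eq0// gt_eqF.
- by rewrite normrN normrM normr_sign mul1r gtr0_norm.
have PN x : Psi1 (Singular theta theta0) ((-1) ^+ b * x) = Psi1 (Singular theta theta0) x.
  by case: b; rewrite ?expr1 ?expr0 ?mulN1r ?mul1r ?Psi1N.
rewrite normrN normrM normr_sign mul1r (gtr0_norm h0).
rewrite (_ : - ((-1) ^+ b * h) + (-1) ^+ b = (-1) ^+ b * (1 - h)); last by ring.
rewrite PN -[(-1) ^+ b]mulr1 PN distrC (lt_le_trans _ (ler_norm _))//.
rewrite /Psi1/= subrr mul0r addr0 (_ : 1 - (1 - h) = h); last by ring.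
rewrite (_ : 1 + (1 - h) = 2 - h); last by ring.
have h2 : 0 < 2 - h by lra.
have hh : (2 - h) * ln (2 - h) <= 2 * ln 2.
  have l2 : ln (2 - h) <= ln 2 by rewrite ler_ln ?posrE//; lra.
  apply: (@le_trans _ _ ((2 - h) * ln 2)); first by rewrite ler_pM2l.
  by rewrite ler_wpM2r ?ln_ge0// ?ler1n//; lra.
rewrite -mulrBr (_ : 1 + 1 = 2)//.
apply: (@lt_le_trans _ _ (theta / 2 * - (h * ln h))); last first.
  by rewrite ler_wpM2l ?divr_ge0 ?(ltW th)//; lra.
apply: (@lt_le_trans _ _ ((`|M| + 1) * h)).
  by rewrite ltr_pM2r// (le_lt_trans (ler_norm _))// ltrDl.
rewrite (_ : theta / 2 * _ = theta / 2 * - ln h * h); last by ring.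
rewrite ler_pM2r//.
have : theta / 2 * (2 * (`|M| + 1) / theta) <= theta / 2 * - ln h.
  by rewrite ler_wpM2l ?divr_ge0 ?(ltW th)//; lra.
by rewrite (_ : theta / 2 * _ = `|M| + 1)//; field; rewrite gt_eqF.
Qed.

Definition admissible (pot : potential R) s := dom_Psi pot s /\ derivable (Psi1 pot) s 1.

Lemma admissible_singular theta theta0 s : 0 < theta ->
  admissible (Singular theta theta0) s <-> -1 < s < 1.
Proof.
move=> th; split.
  rewrite /admissible /dom_Psi/= => -[/andP[s1 s2] ds].
  rewrite !lt_neqAle s1 s2 !andbT; apply/andP; split; apply/eqP => sE.
    have := @Psi1_singular_not_derivable theta theta0 true th.
    by rewrite expr1 sE => /(_ ds).
  have := @Psi1_singular_not_derivable theta theta0 false th.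
  by rewrite expr0; apply; move: ds; rewrite sE.
move=> s1; split; first by move: s1; rewrite /dom_Psi/= => /andP[/ltW-> /ltW->].
by have := is_derive_Psi1_singular theta theta0 s1.
Qed.

Lemma admissible_regular s : admissible Regular s.
Proof. by split => //; have := is_derive_Psi1_regular s. Qed.

Lemma ell_lt theta s t : 0 < theta -> -1 < s -> t < 1 -> s <= t -> ell theta s <= ell theta t.
Proof.
move=> th s1 t1 st; rewrite ler_pM2l ?divr_gt0//.
by rewrite lerB// ler_ln ?posrE; lra.
Qed.

Lemma Psi1_convex (pot : potential R) t s : valid_potential pot -> admissible pot t ->
  dom_Psi pot s -> Psi1 pot t - Psi1 pot s <= derive1 (Psi1 pot) t * (t - s).
Proof.
case: pot => [_ _ _|theta theta0 /andP[th _]].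
  rewrite derive1_Psi1_regular /Psi1/=.
  (* The gap in the inequality is (t^2 - s^2)^2 / 4 + (t (t - s))^2 / 2. *)
  have := sqr_ge0 (t * (t - s)); have := sqr_ge0 (t ^+ 2 - s ^+ 2).
  have -> : (t ^+ 2 - s ^+ 2) ^+ 2 = t ^+ 4 - 2 * t ^+ 2 * s ^+ 2 + s ^+ 4 by ring.
  have -> : (t * (t - s)) ^+ 2 = t ^+ 4 - 2 * t ^+ 3 * s + t ^+ 2 * s ^+ 2 by ring.
  have -> : t ^+ 3 * (t - s) = t ^+ 4 - t ^+ 3 * s by ring.
  lra.
move=> /(admissible_singular _ _ th) t1 s1; rewrite derive1_Psi1_singular//.
exact: Psi1_singular_convex (ltW th) t1 s1.
Qed.

(** The convex-concave splitting behind the scheme: the convex part is implicit and the concave part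
    explicit, so both tangent inequalities point the right way. *)
Lemma Psi_diff_le (pot : potential R) t s : valid_potential pot -> admissible pot t ->
  dom_Psi pot s -> Psi pot t - Psi pot s <= (derive1 (Psi1 pot) t + derive1 (Psi2 pot) s) * (t
    - s).
Proof.
move=> vp at_ ds; have := Psi1_convex vp at_ ds.
suff : Psi2 pot t - Psi2 pot s <= derive1 (Psi2 pot) s * (t - s) by rewrite /Psi; lra.
rewrite derive1_Psi2 /Psi2; case: (pot) vp => [_|theta theta0 /andP[th0 th]].
  by have := sqr_ge0 (t - s); nra.
have th1 : 0 < theta0 by exact: lt_trans th0 th.
have := mulr_ge0 (ltW th1) (sqr_ge0 (t - s)); nra.
Qed.

Lemma derive1_Psi1_mono (pot : potential R) s t : valid_potential pot ->
  admissible pot s -> admissible pot t ->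
  0 <= (derive1 (Psi1 pot) s - derive1 (Psi1 pot) t) * (s - t).
Proof.
move=> vp as_ at_.
have := Psi1_convex vp as_ at_.1; have := Psi1_convex vp at_ as_.1; lra.
Qed.

Definition clamp r s : R := Num.max (- r) (Num.min s r).

Lemma clamp_bound r s : 0 <= r -> - r <= clamp r s <= r.
Proof. by move=> r0; rewrite /clamp le_max lexx/= ge_max ge_min lexx orbT andbT; lra. Qed.

Lemma clamp_id r s : - r <= s <= r -> clamp r s = s.
Proof. by move=> /andP[s1 s2]; rewrite /clamp (min_idPl s2) (max_idPr s1). Qed.

Lemma clamp_ge r s : 0 <= r -> r <= s -> clamp r s = r.
Proof. by move=> r0 rs; rewrite /clamp (min_idPr rs) (max_idPr _)//; lra. Qed.

Lemma clamp_le r s : 0 <= r -> s <= - r -> clamp r s = - r.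
Proof.
move=> r0 rs; rewrite /clamp (min_idPl _); last lra.
by apply/max_idPl.
Qed.

Lemma clamp_mono r s t : s <= t -> clamp r s <= clamp r t.
Proof.
move=> st; rewrite /clamp ge_max !le_max lexx/=; apply/orP; right.
by rewrite le_min !ge_min st lexx orbT.
Qed.

Lemma clamp_lip r s t : s <= t -> clamp r t - clamp r s <= t - s.
Proof.
move=> st; rewrite /clamp.
case: (leP t r) => h1; case: (leP s r) => h2.
- by case: (leP (- r) t) => h3; case: (leP (- r) s) => h4; lra.
- by lra.
- by case: (leP (- r) r) => h3; case: (leP (- r) s) => h4; lra.
- by rewrite subrr subr_ge0.
Qed.

(** On [-r, r] the arguments of both logarithms are at least 1 - r, so each logarithm contributes
    theta / 2 / (1 - r) to the Lipschitz constant. *)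
Lemma loclip_ell_clamp theta r : 0 < theta -> 0 <= r -> r < 1 ->
  loclip ((fun s => ell theta (clamp r s)) : R -> R).
Proof.
move=> th r0 r1 x; exists (theta / (1 - r)), 1; split => // [|y _].
  by rewrite divr_ge0 ?(ltW th)//; lra.
have d0 : 0 < 1 - r by lra.
have key s t : s <= t ->
    0 <= ell theta (clamp r t) - ell theta (clamp r s) <= theta / (1 - r) * (t - s).
  move=> st; have cst := clamp_mono r st; have cl := clamp_lip r st.
  have /andP[a1 a2] := clamp_bound s r0; have /andP[b1 b2] := clamp_bound t r0.
  set u := clamp r s in cst cl a1 a2 *; set v := clamp r t in cst cl b1 b2 *.
  apply/andP; split; first by rewrite subr_ge0 ell_lt//; lra.
  have lnd p q : 1 - r <= p -> p <= q -> ln q - ln p <= (q - p) / (1 - r).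
    move=> hp pq; have p0 : 0 < p by lra. have q0 : 0 < q by lra.
    rewrite -ln_div ?posrE//.
    apply: (le_trans (ln_le_subr1 (divr_gt0 q0 p0))).
    rewrite (_ : q / p - 1 = (q - p) / p); last by field; rewrite gt_eqF.
    by rewrite ler_wpM2l ?subr_ge0// lef_pV2 ?posrE.
  have h1 := @lnd (1 + u) (1 + v); have h2 := @lnd (1 - v) (1 - u).
  rewrite /ell -mulrBr.
  apply: (@le_trans _ _ (theta / 2 * (2 * ((t - s) / (1 - r))))).
    rewrite ler_wpM2l ?divr_ge0 ?(ltW th)//.
    have k : (v - u) / (1 - r) <= (t - s) / (1 - r).
      by rewrite ler_wpM2r ?invr_ge0 ?(ltW d0).
    have {}h1 : ln (1 + v) - ln (1 + u) <= (v - u) / (1 - r).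
      by rewrite (le_trans (h1 _ _))//; [lra|lra|rewrite opprD addrACA subrr add0r].
    have {}h2 : ln (1 - u) - ln (1 - v) <= (v - u) / (1 - r).
      by rewrite (le_trans (h2 _ _))//; [lra|lra|rewrite (_ : 1 - u - (1 - v) = v - u)//; ring].
    lra.
  by rewrite le_eqVlt; apply/orP; left; apply/eqP; field; rewrite gt_eqF.
have [xy|yx] := leP x y.
  by have /andP[h1 h2] := key _ _ xy; rewrite !ger0_norm// subr_ge0.
have /andP[h1 h2] := key _ _ (ltW yx).
by rewrite distrC (distrC y) !ger0_norm// subr_ge0 ltW.
Qed.

Lemma ell_unbounded theta M : 0 < theta -> exists2 r0, r0 < 1 &
  forall r, 0 <= r -> r0 <= r -> r < 1 -> M < ell theta r.
Proof.
move=> th; exists (1 - expR (- (2 * (`|M| + 1) / theta))).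
  by rewrite ltrBlDl ltrDr expR_gt0.
move=> r r0 rr r1.
have l1 : 0 <= ln (1 + r) by rewrite ln_ge0// lerDl.
have l2 : ln (1 - r) <= - (2 * (`|M| + 1) / theta).
  by rewrite -[leRHS]expRK ler_ln ?posrE ?expR_gt0//; lra.
apply: (@lt_le_trans _ _ (`|M| + 1)); first by rewrite (le_lt_trans (ler_norm _))// ltrDl.
rewrite (_ : `|M| + 1 = theta / 2 * (2 * (`|M| + 1) / theta)); last by field; rewrite gt_eqF.
by rewrite ler_wpM2l ?divr_ge0 ?(ltW th)//; lra.
Qed.

Lemma loclip_cube : loclip ((fun s => s ^+ 3) : R -> R).
Proof.
move=> x; exists (3 * (`|x| + 1) ^+ 2), 1; split => [//||y yx].
  by rewrite mulr_ge0// sqr_ge0.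
have -> : y ^+ 3 - x ^+ 3 = (y ^+ 2 + y * x + x ^+ 2) * (y - x) by ring.
rewrite normrM ler_wpM2r//.
have yb : `|y| <= `|x| + 1.
  by rewrite -[y](subrK x) (le_trans (ler_normD _ _))// addrC lerD2l.
have xb : `|x| <= `|x| + 1 by rewrite lerDl.
apply: (le_trans (ler_normD _ _)); apply: (le_trans (lerD (ler_normD _ _) (lexx _))).
rewrite !normrX normrM.
have h1 : `|y| ^+ 2 <= (`|x| + 1) ^+ 2 by rewrite ler_pXn2r ?nnegrE ?addr_ge0.
have h2 : `|x| ^+ 2 <= (`|x| + 1) ^+ 2 by rewrite ler_pXn2r ?nnegrE ?addr_ge0.
have h3 : `|y| * `|x| <= (`|x| + 1) ^+ 2 by rewrite expr2 ler_pM.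
lra.
Qed.

End potentials.

(** * Existence for the nodal system with the logarithmic potential *)

Section singular_existence.
Context {R : realType} {n : nat}.
Variables (w : 'rV[R]_n) (A B : 'M[R]_n) (Dt lam L2 : R).
Hypotheses (n0 : (0 < n)%N) (w0 : forall i, 0 < w 0 i)
  (Asym : A^T = A) (A0 : forall x : 'rV_n, 0 <= dot (x *m A) x)
  (Aker : forall x : 'rV_n, dot (x *m A) x = 0 -> exists c, x = const_mx c)
  (A1 : (const_mx 1 : 'rV_n) *m A = 0).
Hypotheses (Dt0 : 0 < Dt) (L20 : 0 <= L2) (small : lam ^+ 4 * L2 ^+ 2 * Dt < 1).
Hypothesis AB : forall x y : 'rV_n,
  dot (x *m B) y ^+ 2 <= L2 * dot (x *m A) x * dot (wd w y) y.
Variables (prev k : 'rV[R]_n) (theta : R).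
Hypotheses (th : 0 < theta) (mb : -1 < dot w prev / mass w < 1).

(* Solve with ell truncated at a level r < 1; the a priori bound keeps the nodal
   values away from -1 and 1 uniformly in r, so the truncation is inactive for r
   close to 1. *)
Lemma solves_exists_singular : exists phi mu : 'rV[R]_n,
  (forall i, -1 < phi 0 i < 1) /\
  solves w A B Dt lam prev k (\row_i ell theta (phi 0 i)) phi mu.
Proof.
have [C HC] := solves_apriori n0 w0 Asym A0 Aker A1 Dt0 small AB prev k.
set m := dot w prev / mass w in HC.
have m1 : `|m| < 1 by rewrite ltr_norml.
(* Half the distance of the mean to the ends: a nodal value beyond the truncation level differs from
   the mean by at least [eta]. *)
pose eta := (1 - `|m|) / 2.
have eta0 : 0 < eta by rewrite divr_gt0// subr_gt0.
pose kap := \sum_i (w 0 i)^-1.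
have kap0 : 0 <= kap by apply: sumr_ge0 => i _; rewrite invr_ge0 ltW.
have [r0 r01 Hr0] := ell_unbounded (`|ell theta m| + `|C| * kap / eta) th.
pose r := Num.max ((1 + `|m|) / 2) r0.
have rm : `|m| + eta <= r.
  by rewrite le_max; apply/orP; left; rewrite /eta; lra.
have r1 : r < 1 by rewrite gt_max r01 andbT; lra.
have rp : 0 <= r by have := normr_ge0 m; lra.
have lr : `|ell theta m| + `|C| * kap / eta < ell theta r.
  by apply: Hr0 => //; rewrite le_max lexx orbT.
pose g s := ell theta (clamp r s).
have gmono s t : s <= t -> g s <= g t.
  move=> st; rewrite /g; have := clamp_mono r st.
  have /andP[a1 a2] := clamp_bound s rp; have /andP[b1 b2] := clamp_bound t rp.
  by move=> h; apply: ell_lt => //; lra.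
have [phi [mu sol]] := solves_exists n0 w0 Asym A0 Aker A1 Dt0 small AB prev k
  gmono (loclip_ell_clamp th rp r1).
have mr : - r <= m <= r.
  by rewrite -ler_norml; lra.
have gm : g m = ell theta m by rewrite /g clamp_id.
have /= := HC g phi mu sol; rewrite -/m gm => HG.
have term i : w 0 i * ((g (phi 0 i) - ell theta m) * (phi 0 i - m)) <= C.
  apply: (le_trans _ HG); rewrite (bigD1 i)//= lerDl sumr_ge0// => j _.
  rewrite mulr_ge0 ?(ltW (w0 j))// -gm.
  have [h|h] := leP (phi 0 j) m; last by rewrite mulr_ge0// subr_ge0 ?gmono// ltW.
  by rewrite -mulrNN mulr_ge0// opprB subr_ge0// gmono.
(* Since [w 0 i * kap >= 1] at every node, a factor above [|C| * kap / eta] violates the a priori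
   bound even at the node of least mass. *)
have big i (a b : R) : `|C| * kap / eta < a -> eta <= b -> C < w 0 i * (a * b).
  move=> ha hb.
  have Ck : 0 <= `|C| * kap / eta by rewrite divr_ge0 ?(ltW eta0)// mulr_ge0.
  have a0 : 0 < a by exact: le_lt_trans Ck ha.
  apply: (le_lt_trans (ler_norm C)).
  apply: (@lt_le_trans _ _ (w 0 i * (a * eta))); last first.
    by rewrite ler_pM2l// ler_pM2l.
  apply: (@le_lt_trans _ _ (w 0 i * (`|C| * kap / eta * eta))); last first.
    by rewrite ltr_pM2l// ltr_pM2r.
  rewrite divfK ?gt_eqF// mulrCA ler_peMr//.
  rewrite -[leLHS](divff (lt0r_neq0 (w0 i))) ler_pM2l// /kap (bigD1 i)//= lerDl.
  by apply: sumr_ge0 => j _; rewrite invr_ge0 ltW.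
have bnd i : - r < phi 0 i < r.
  rewrite !ltNge; apply/andP; split; apply/negP => h.
    have := term i; rewrite leNgt => /negP; apply.
    rewrite /g clamp_le// ellN -[X in w 0 i * X]mulrNN; apply: big.
      by have := ler_norm (- ell theta m); rewrite normrN; lra.
    by have := ler_norm (- m); rewrite normrN; lra.
  have := term i; rewrite leNgt => /negP; apply.
  rewrite /g clamp_ge//; apply: big.
    by have := ler_norm (ell theta m); lra.
  by have := ler_norm m; lra.
exists phi, mu; split => [i|].
  by have /andP[a1 a2] := bnd i; apply/andP; split; lra.
suff -> : \row_i ell theta (phi 0 i) = \row_i g (phi 0 i) by [].
apply/rowP => i; rewrite !mxE /g clamp_id//.
by have /andP[/ltW-> /ltW->] := bnd i.
Qed.

End singular_existence.

(** * Lebesgue measure and integration of bounded functions *)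

Section boxes.
Context {R : realType}.

(** The bounds are indexed by all naturals, so that induction on the dimension can drop the first
    ones by a shift. *)
Definition tbox n (lo hi : nat -> R) : set (n.-tuple (measurableTypeR R)) :=
  [set t | forall i : 'I_n, lo i < tnth t i < hi i].

Lemma measurable_tbox n lo hi : measurable (tbox (n := n) lo hi).
Proof.
rewrite (_ : tbox lo hi = \bigcap_(i : 'I_n) (@tnth _ _ ^~ i) @^-1` `]lo i, hi i[).
  apply: fin_bigcap_measurable => // i _.
  by rewrite -[X in measurable X]setTI; apply: measurable_tnth.
apply/seteqP; split=> [t h i _ /=|t h i]; first by rewrite in_itv/= h.
by have := h i I; rewrite /= in_itv.
Qed.

Lemma leb_tuple_tbox n lo hi : (forall i, lo i <= hi i) ->
  leb_tuple R n (tbox lo hi) = (\prod_(i < n) (hi i - lo i))%:E.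
Proof.
elim: n lo hi => [|n IHn] lo hi lohi.
  by rewrite big_ord0/= diracE mem_set// => -[].
transitivity ((@lebesgue_measure R \x leb_tuple R n)%E
    (`]lo 0%N, hi 0%N[ `*` tbox (fun i => lo i.+1) (fun i => hi i.+1))).
  rewrite /=/leb_succ/pushforward; congr (_ _).
  apply/seteqP; split=> -[x t] /= h.
    split; first by have := h ord0; rewrite in_itv.
    by move=> i; have := h (lift ord0 i); rewrite tnthS.
  case: h; rewrite in_itv/= => h1 h2 i.
  by case: (unliftP ord0 i) => [j|] -> //; rewrite tnthS; exact: h2.
rewrite product_measure1E//; last exact: measurable_tbox.
rewrite IHn// big_ord_recl EFinM; congr (_ * _)%E.
transitivity (@lebesgue_measure R `]lo 0%N, hi 0%N[%classic) => //.
rewrite lebesgue_measure_itv/= lte_fin lt_neqAle lohi andbT.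
by case: eqVneq => //= ->; rewrite subrr.
Qed.

End boxes.

Section leb_facts.
Context {R : realType} {d : nat}.
Local Notation mu := (@leb R d).
Implicit Types (A U : set (borel R d)).

Lemma open_measurable_borel (U : set 'rV[R]_d) : open U -> measurable (U : set (borel R d)).
Proof. by move=> oU; apply: sub_sigma_algebra. Qed.

Lemma closed_measurable_borel (U : set 'rV[R]_d) : closed U -> measurable (U : set (borel R d)).
Proof.
move=> cU; rewrite -[U]setCK; apply: measurableC; apply: open_measurable_borel.
exact: closed_openC.
Qed.

Lemma continuous_measurable_borel (f : 'rV[R]_d -> R) : continuous f ->
  measurable_fun [set: borel R d] f.
Proof.
move=> cf; apply: (measurability _ (RGenOInfty.measurableE R)).
move=> _ [_ [a ->] <-]; rewrite setTI; apply: open_measurable_borel.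
by apply: open_comp => [x _|]; [exact: cf|exact: interval_open].
Qed.

(** A ball of the sup norm is an open cube, so the preimage of the open set contains a box whose
    volume is a product of positive lengths. *)
Lemma leb_open_gt0 (U : set 'rV[R]_d) : open U -> U !=set0 -> (0 < mu U)%E.
Proof.
move=> oU [x Ux].
have /nbhs_ballP[e /= e0 eU] : nbhs x U by exact: open_nbhs_nbhs.
pose lo k : R := (if insub k is Some i then x 0 i else 0) - e.
pose hi k : R := (if insub k is Some i then x 0 i else 0) + e.
have lohi i : lo i <= hi i by rewrite /lo /hi; lra.
apply: (@lt_le_trans _ _ (leb_tuple R d (tbox lo hi))).
  rewrite leb_tuple_tbox// lte_fin prodr_gt0// => i _.
  by rewrite /lo /hi; lra.
apply: le_measure; rewrite ?inE.
- exact: measurable_tbox.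
- rewrite -[X in measurable X]setTI; apply: measurable_rv_of_tuple => //.
  exact: open_measurable_borel.
- move=> t tb; apply: eU; split => // i j; rewrite ord1 mxE.
  have := tb j; rewrite /lo /hi valK /ball/= => /andP[h1 h2].
  by rewrite distrC ltr_norml; lra.
Qed.

Lemma leb_bounded_lty A M : measurable A -> (forall x : 'rV[R]_d,
  A x -> `|x| <= M) -> (mu A < +oo)%E.
Proof.
move=> mA AM; pose lo (k : nat) : R := - (`|M| + 1); pose hi (k : nat) : R := `|M| + 1.
have M0 := normr_ge0 M.
have lohi i : lo i <= hi i by rewrite /lo /hi; lra.
apply: (@le_lt_trans _ _ (leb_tuple R d (tbox lo hi))); last first.
  by rewrite leb_tuple_tbox// ltry.
apply: (@le_measure _ _ _ (leb_tuple R d) (@rv_of_tuple R d @^-1` A) (tbox lo hi)); rewrite ?inE.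
- by rewrite -[X in measurable X]setTI; apply: measurable_rv_of_tuple.
- exact: measurable_tbox.
- move=> t /AM h i; rewrite /lo /hi -ltr_norml.
  have := le_trans (rV_entry_le _ i) h; rewrite mxE => h2.
  by rewrite (le_lt_trans h2)// (le_lt_trans (ler_norm _))// ltrDl.
Qed.

End leb_facts.

Section bounded_measurable.
Context {R : realType} {d : nat}.
Local Notation mu := (@leb R d).
Variable Om : set 'rV[R]_d.
Hypotheses (oOm : open Om) (Omfin : (mu Om < +oo)%E).
Implicit Types f g : 'rV[R]_d -> R.
Local Notation BOm := (Om : set (borel R d)).
Local Notation intg := (intg Om).

Let mOm : measurable BOm. Proof. exact: open_measurable_borel. Qed.

(** An algebra of functions that are integrable because [Om] has finite measure; the integrals of
    the scheme are computed within it. *)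
Definition bmf f := measurable_fun BOm f /\ exists M, forall x, Om x -> `|f x| <= M.

Lemma bmf_integrable f : bmf f -> mu.-integrable BOm (EFin \o f).
Proof.
move=> [mf [M HM]]; apply: measurable_bounded_integrable => //.
exists M; split; first exact: num_real.
by move=> N MN x Omx; exact: (le_trans (HM x Omx) (ltW MN)).
Qed.

Lemma bmf_cst c : bmf (fun=> c).
Proof. by split; [exact: measurable_cst|exists `|c|]. Qed.

Lemma bmfD f g : bmf f -> bmf g -> bmf (fun x => f x + g x).
Proof.
move=> [mf [M HM]] [mg [N HN]]; split; first exact: measurable_funD.
by exists (M + N) => x Ox; rewrite (le_trans (ler_normD _ _))// lerD ?HM ?HN.
Qed.

Lemma bmfM f g : bmf f -> bmf g -> bmf (fun x => f x * g x).
Proof.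
move=> [mf [M HM]] [mg [N HN]]; split; first exact: measurable_funM.
by exists (M * N) => x Ox; rewrite normrM ler_pM// ?HM ?HN.
Qed.

Lemma bmfZ c f : bmf f -> bmf (fun x => c * f x).
Proof. by move=> bf; apply: bmfM => //; exact: bmf_cst. Qed.

Lemma bmf_sum (I : Type) (s : seq I) (F : I -> 'rV[R]_d -> R) :
  (forall i, bmf (F i)) -> bmf (fun x => \sum_(i <- s) F i x).
Proof.
move=> bF; elim: s => [|i s IHs].
  rewrite (_ : (fun _ => _) = fun=> 0); first exact: bmf_cst.
  by apply/funext => x; rewrite big_nil.
rewrite (_ : (fun _ => _) = fun x => F i x + \sum_(i <- s) F i x).
  exact: bmfD.
by apply/funext => x; rewrite big_cons.
Qed.

Lemma bmfX f n : bmf f -> bmf (fun x => f x ^+ n).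
Proof.
move=> bf; elim: n => [|n IHn].
  by rewrite (_ : (fun _ => _) = fun=> 1); [exact: bmf_cst|apply/funext => x; rewrite expr0].
rewrite (_ : (fun _ => _) = fun x => f x * f x ^+ n); first exact: bmfM.
by apply/funext => x; rewrite exprS.
Qed.

Lemma bmf_norm f : bmf f -> bmf (fun x => `|f x|).
Proof.
move=> [mf [M HM]]; split; first exact: measurableT_comp.
by exists M => x Ox; rewrite normr_id HM.
Qed.

Lemma bmf_sqrt f : bmf f -> bmf (fun x => Num.sqrt (f x)).
Proof.
move=> [mf [M HM]]; split.
  have ms : measurable_fun setT (@Num.sqrt R).
    exact: continuous_measurable_fun (@sqrt_continuous R).
  exact: (measurableT_comp ms mf).
exists (Num.sqrt M) => x Ox; rewrite ger0_norm ?sqrtr_ge0// ler_wsqrtr//.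
by rewrite (le_trans (ler_norm _))// HM.
Qed.

Lemma eq_bmf f g : (forall x, Om x -> f x = g x) -> bmf f -> bmf g.
Proof.
move=> fg [mf [M HM]]; split.
  by apply: eq_measurable_fun mf => x; rewrite inE => /fg.
by exists M => x Ox; rewrite -fg// HM.
Qed.

Lemma eq_intg f g : (forall x, Om x -> f x = g x) -> intg f = intg g.
Proof. by move=> fg; apply: eq_Rintegral => x; rewrite inE; exact: fg. Qed.

Lemma intgD f g : bmf f -> bmf g -> intg (fun x => f x + g x) = intg f + intg g.
Proof. by move=> bf bg; apply: RintegralD => //; exact: bmf_integrable. Qed.

Lemma intgZ c f : bmf f -> intg (fun x => c * f x) = c * intg f.
Proof. by move=> bf; apply: RintegralZl => //; exact: bmf_integrable. Qed.

Lemma intg0 : intg (fun=> 0) = 0.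
Proof. by rewrite /Defs.intg Rintegral_cst// mul0r. Qed.

Lemma intg_sum (I : Type) (s : seq I) (F : I -> 'rV[R]_d -> R) :
  (forall i, bmf (F i)) -> intg (fun x => \sum_(i <- s) F i x) = \sum_(i <- s) intg (F i).
Proof.
move=> bF; elim: s => [|i s IHs].
  by rewrite big_nil -[RHS]intg0; apply: eq_intg => x _; rewrite big_nil.
rewrite big_cons -IHs -intgD//; last exact: bmf_sum.
by apply: eq_intg => x _; rewrite big_cons.
Qed.

Lemma le_intg f g : bmf f -> bmf g -> (forall x, Om x -> f x <= g x) -> intg f <= intg g.
Proof. by move=> bf bg fg; apply: le_Rintegral => //; exact: bmf_integrable. Qed.

Lemma intg_ge0 f : (forall x, Om x -> 0 <= f x) -> 0 <= intg f.
Proof. by move=> f0; apply: Rintegral_ge0. Qed.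

Lemma intg_cauchy_schwarz f g : bmf f -> bmf g ->
  intg (fun x => f x * g x) ^+ 2 <= intg (fun x => f x ^+ 2) * intg (fun x => g x ^+ 2).
Proof.
move=> bf bg; apply: discriminant_le => [|t].
  by apply: intg_ge0 => x _; exact: sqr_ge0.
have bfg := bmfM bf bg; have bff := bmfX 2 bf; have bgg := bmfX 2 bg.
rewrite -[2 * t * _]intgZ// -[t ^+ 2 * _]intgZ// -intgD//; last exact: bmfZ.
rewrite -intgD; [|by apply: bmfD => //; exact: bmfZ|exact: bmfZ].
apply: intg_ge0 => x _; have := sqr_ge0 (f x + t * g x).
by congr (_ <= _); ring.
Qed.

(** Bridge from almost everywhere statements to points: an open set that missed [P] would be a null
    set. Applied to open simplices, it recovers information on each element. *)
Lemma ae_meets_open (P : 'rV[R]_d -> Prop) (U : set 'rV[R]_d) :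
  open U -> U !=set0 -> {ae mu, forall x, P x} -> exists2 x, U x & P x.
Proof.
move=> oU U0 aeP; apply: contrapT => H.
have : mu.-negligible (U : set (borel R d)).
  by apply: negligibleS aeP => x Ux /= Px; apply: H; exists x.
move=> /(measure_negligible (open_measurable_borel oU)) U00.
by have := leb_open_gt0 oU U0; rewrite U00 ltxx.
Qed.

Lemma intg_eq0 f (U : set 'rV[R]_d) : bmf f -> (forall x, Om x -> 0 <= f x) ->
  open U -> (U `&` Om) !=set0 -> intg f = 0 -> exists2 x, (U `&` Om) x & f x = 0.
Proof.
move=> bf f0 oU UO0 if0.
have : {ae mu, forall x, Om x -> (f x)%:E = 0%E}.
  apply/(ae_eq_integral_abs mu mOm (f := EFin \o f)).
    by apply/measurable_EFinP; exact: bf.1.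
  transitivity ((intg f)%:E); last by rewrite if0.
  rewrite /Defs.intg /Rintegral fineK; last exact: integrable_fin_num (bmf_integrable bf).
  by apply: eq_integral => x; rewrite inE => Ox /=; rewrite ger0_norm// f0.
move=> /(ae_meets_open (openI oU oOm) UO0)[x Ux Px].
by exists x => //; apply: EFin_inj; apply: Px; case: Ux.
Qed.

Lemma lpnorm_ge0 p f : 0 <= lpnorm Om p f.
Proof. by rewrite /lpnorm fine_ge0// Lnorm_ge0. Qed.

Lemma lpnorm_exp (n : nat) f : bmf f -> (0 < n)%N ->
  lpnorm Om n%:R%:E f ^+ n = intg (fun x => `|f x| ^+ n).
Proof.
move=> bf n0; have nn0 : n%:R != 0 :> R by rewrite pnatr_eq0 -lt0n.
have H : ('N[mu]_(n%:R%:E) [EFin \o (f \_ Om)] `^ n%:R)%E = (intg (fun x => `|f x| ^+ n))%:E.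
  rewrite poweR_Lnorm// /Defs.intg /Rintegral fineK; last first.
    by apply: integrable_fin_num => //; apply: bmf_integrable; exact/bmfX/bmf_norm.
  rewrite [RHS]integral_mkcond; apply: eq_integral => x _ /=.
  rewrite /patch/=; case: ifPn => _ /=; first by rewrite powR_mulrn.
  by rewrite normr0 powR0.
(* [lpnorm] passes through [fine], so finiteness has to be known: an infinite norm would have an
   infinite n-th power, against [H]. *)
have Nfin : ('N[mu]_(n%:R%:E) [EFin \o (f \_ Om)])%E \is a fin_num.
  have : ('N[mu]_(n%:R%:E) [EFin \o (f \_ Om)] != +oo)%E.
    apply/eqP => N; move: H; by rewrite N /= (negbTE nn0).
  rewrite fin_numE => ->; rewrite andbT gt_eqF//.
  by rewrite (lt_le_trans _ (Lnorm_ge0 _ _ _)).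
apply: EFin_inj; rewrite -H /lpnorm -[in RHS](fineK Nfin) poweR_EFin powR_mulrn//.
by rewrite fine_ge0// Lnorm_ge0.
Qed.

Lemma lpnorm2 f : bmf f -> lpnorm Om 2%:E f = l2norm Om f.
Proof.
move=> bf; rewrite /l2norm.
have -> : intg (fun x => f x ^+ 2) = lpnorm Om 2%:R%:E f ^+ 2.
  rewrite lpnorm_exp//; apply: eq_intg => x _.
  by rewrite real_normK ?num_real.
by rewrite sqrtr_sqr ger0_norm// lpnorm_ge0.
Qed.

(** The norm with exponent +oo is an essential supremum only on a space of positive measure. *)
Let muT : (0 < mu [set: borel R d])%E.
Proof. by apply: leb_open_gt0; [exact: openT|exists 0]. Qed.

Let LnormyE f : ('N[mu]_+oo [EFin \o (f \_ Om)])%E = ess_sup mu (abse \o (EFin \o (f \_ Om))).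
Proof. by rewrite unlock /Lnorm muT. Qed.

Lemma lpnormy_le f M : 0 <= M -> (forall x, Om x -> `|f x| <= M) -> lpnorm Om +oo%E f <= M.
Proof.
move=> M0 fM; rewrite /lpnorm.
have le : ('N[mu]_+oo [EFin \o (f \_ Om)] <= M%:E)%E.
  rewrite LnormyE; apply/ess_supP; apply: aeW => x /=.
  rewrite lee_fin patchE; case: ifPn => [|_]; last by rewrite normr0.
  by rewrite inE; exact: fM.
rewrite -lee_fin fineK// ge0_fin_numE ?Lnorm_ge0//.
by rewrite (le_lt_trans le)// ltry.
Qed.

Lemma lpnormy_ge f (U : set 'rV[R]_d) c : bmf f -> open U -> (U `&` Om) !=set0 ->
  (forall x, U x -> Om x -> c <= `|f x|) -> c <= lpnorm Om +oo%E f.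
Proof.
move=> [_ [M HM]] oU UO0 fc.
have [x0 [_ Ox0]] := UO0.
have M0 : 0 <= M by rewrite (le_trans _ (HM _ Ox0)).
have le : ('N[mu]_+oo [EFin \o (f \_ Om)] <= M%:E)%E.
  rewrite LnormyE; apply/ess_supP; apply: aeW => x /=.
  rewrite lee_fin patchE; case: ifPn => [|_]; last by rewrite normr0.
  by rewrite inE; exact: HM.
have fin : ('N[mu]_+oo [EFin \o (f \_ Om)])%E \is a fin_num.
  by rewrite ge0_fin_numE ?Lnorm_ge0// (le_lt_trans le)// ltry.
rewrite /lpnorm -lee_fin fineK// LnormyE.
have := ess_sup_ge mu (abse \o (EFin \o (f \_ Om))).
move=> /(ae_meets_open (openI oU oOm) UO0)[x [Ux Ox]] /=; apply: le_trans.
by rewrite lee_fin patchE mem_set// fc.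
Qed.

End bounded_measurable.

(** * Barycentric coordinates and piecewise affine functions *)

Section barycentric.
Context {R : realType} {d : nat}.
Implicit Types (K : 'M[R]_(d.+1, d)) (x y : 'rV[R]_d) (f : 'rV[R]_d -> R).

Definition bary K x (i : 'I_d.+1) : R :=
  if unlift ord0 i is Some j then ((x - vtx K ord0) *m invmx (edges K)) 0 j
  else 1 - \sum_j ((x - vtx K ord0) *m invmx (edges K)) 0 j.

Lemma bary_lift K x j : bary K x (lift ord0 j) = ((x - vtx K ord0) *m invmx (edges K)) 0 j.
Proof. by rewrite /bary liftK. Qed.

Lemma bary_sum K x : \sum_i bary K x i = 1.
Proof.
rewrite big_ord_recl {1}/bary unlift_none.
rewrite [X in _ + X](eq_bigr (fun j => ((x - vtx K ord0) *m invmx (edges K)) 0 j)) ?subrK//.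
by move=> j _; rewrite bary_lift.
Qed.

Lemma sum_vtx K (w : 'I_d.+1 -> R) : \sum_i w i = 1 ->
  \sum_i w i *: vtx K i = vtx K ord0 + (\row_j w (lift ord0 j)) *m edges K.
Proof.
move=> w1; have w0 : w ord0 = 1 - \sum_(j < d) w (lift ord0 j).
  by rewrite -w1 big_ord_recl addrK.
rewrite big_ord_recl w0 scalerBl scale1r -addrA; congr (_ + _).
rewrite mulmx_sum_row scaler_suml -sumrN -big_split; apply: eq_bigr => j _ /=.
by rewrite mxE rowK scalerBr addrC.
Qed.

Lemma bary_uniq K x (w : 'I_d.+1 -> R) : edges K \in unitmx ->
  \sum_i w i = 1 -> \sum_i w i *: vtx K i = x -> forall i, w i = bary K x i.
Proof.
move=> uK w1; rewrite sum_vtx// => xE.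
have wl j : w (lift ord0 j) = bary K x (lift ord0 j).
  by rewrite bary_lift -xE addrC addKr mulmxK// mxE.
move=> i; case: (unliftP ord0 i) => [j|] ->//.
have := w1; rewrite -(bary_sum K x) !big_ord_recl.
by rewrite (eq_bigr _ (fun j _ => wl j)) => /addIr.
Qed.

Lemma bary_comb K x : edges K \in unitmx -> \sum_i bary K x i *: vtx K i = x.
Proof.
move=> uK; rewrite sum_vtx ?bary_sum//.
rewrite (_ : \row_j _ = (x - vtx K ord0) *m invmx (edges K)); last first.
  by apply/rowP => j; rewrite mxE bary_lift.
by rewrite mulmxKV// addrC subrK.
Qed.

Lemma bary_vtx K i j : edges K \in unitmx -> bary K (vtx K i) j = (j == i)%:R.
Proof.
move=> uK; symmetry; apply: (bary_uniq (w := fun j => (j == i)%:R)) => //.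
  by rewrite (bigD1 i)//= eqxx big1 ?addr0// => k /negbTE ->.
rewrite (bigD1 i)//= eqxx scale1r big1 ?addr0// => k /negbTE ->.
by rewrite scale0r.
Qed.

Lemma bary_conv K x y t i :
  bary K ((1 - t) *: x + t *: y) i = (1 - t) * bary K x i + t * bary K y i.
Proof.
have E : (1 - t) *: x + t *: y - vtx K ord0 = (1 - t) *: (x - vtx K ord0) + t *: (y - vtx K ord0).
  by apply/rowP => j; rewrite !mxE; ring.
rewrite /bary; case: (unlift _ _) => [j|]; rewrite E mulmxDl -!scalemxAl.
  by rewrite !mxE.
rewrite (eq_bigr (fun j => (1 - t) * ((x - vtx K ord0) *m invmx (edges K)) 0 j +
  t * ((y - vtx K ord0) *m invmx (edges K)) 0 j)); last by move=> j _; rewrite !mxE.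
by rewrite big_split/= -!mulr_sumr; ring.
Qed.

Lemma bary_continuous K i : continuous (fun x => bary K x i).
Proof.
apply: (@loclip_continuous _ _ R); rewrite /bary.
have lj (j : 'I_d) : loclip (fun x : 'rV[R]_d => ((x - vtx K ord0) *m invmx (edges K)) 0 j : R).
  apply: (loclip_comp (f := fun x => (x - vtx K ord0) *m invmx (edges K)) _ (loclip_entry j)).
  apply: loclip_mulmx; apply: loclipD; last exact: loclip_cst.
  by apply: loclip_rV => k; exact: loclip_entry.
case: (unlift _ _) => [j|]; first exact: lj.
apply: loclipD; first exact: loclip_cst.
have H := loclipZ (-1) (loclip_sum (index_enum 'I_d) lj).
rewrite (_ : (fun _ => _) = fun x => -1 *: \sum_j ((x - vtx K ord0) *m invmx (edges K)) 0 j)//.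
by apply/funext => x; rewrite scaleN1r.
Qed.

Lemma simplexP K x : edges K \in unitmx -> simplex K x <-> forall i, 0 <= bary K x i.
Proof.
move=> uK; split.
  move=> [w [w0 _ w1 xE]] i; rewrite -(@bary_uniq K x (fun i => w 0 i))//.
  by rewrite xE mulmx_sum_row.
move=> h; exists (\row_i bary K x i); split => [i|i|//|].
- by rewrite mxE.
- by rewrite inE.
- by rewrite -(bary_sum K x); apply: eq_bigr => i _; rewrite mxE.
- rewrite mulmx_sum_row -[LHS](bary_comb x uK).
  by apply: eq_bigr => i _; rewrite mxE.
Qed.

Lemma simplex_vtx K i : edges K \in unitmx -> simplex K (vtx K i).
Proof. by move=> uK; apply/simplexP => // j; rewrite bary_vtx. Qed.

Definition isimplex K : set 'rV[R]_d := [set x | forall i, 0 < bary K x i].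

Lemma isimplex_sub K x : edges K \in unitmx -> isimplex K x -> simplex K x.
Proof. by move=> uK h; apply/simplexP => // i; exact: ltW. Qed.

Lemma closed_simplex K : edges K \in unitmx -> closed (simplex K).
Proof.
move=> uK; rewrite (_ : simplex K = \bigcap_(i : 'I_d.+1) ((fun x => bary K x i) @^-1` [set t |
  0 <= t])).
  apply: closed_bigI => i _; apply: preimage_closed => [x _|]; last exact: closed_ge.
  exact: bary_continuous.
by apply/seteqP; split => [x /simplexP h i _ |x h]; [exact: h|apply/simplexP => // i; exact: h].
Qed.

Lemma open_isimplex K : open (isimplex K).
Proof.
rewrite (_ : isimplex K = \bigcap_(i in [set` index_enum 'I_d.+1]) ((fun x => bary K x i) @^-1`
  [set t | 0 < t])).
  rewrite bigcap_seq; elim/big_ind : _ => [|A B oA oB|i _]; first exact: openT.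
    exact: openI.
  by apply: open_comp => [x _|]; [exact: bary_continuous|exact: open_gt].
by apply/seteqP; split => [x h i _ |x h i]; [exact: h|apply: h; rewrite /= mem_index_enum].
Qed.

Definition barycenter K : 'rV[R]_d := \sum_i d.+1%:R^-1 *: vtx K i.

Lemma isimplex_barycenter K : edges K \in unitmx -> isimplex K (barycenter K).
Proof.
move=> uK i; rewrite -(@bary_uniq K (barycenter K) (fun=> d.+1%:R^-1)) ?invr_gt0//.
by rewrite sumr_const card_ord -[_ *+ _]mulr_natl divff// pnatr_eq0.
Qed.

(** Chosen so that [pih Th f x] unfolds to [aff (elt Th x) f x]. *)
Definition aff K f x : R := f (vtx K ord0) + dot (vgrad K f) (x - vtx K ord0).

Lemma affE K f x : aff K f x = \sum_i bary K x i * f (vtx K i).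
Proof.
rewrite /aff dotC dotE /vgrad trmxK mulmxA [in RHS]big_ord_recl /bary unlift_none.
rewrite mulrBl mul1r -addrA; congr (_ + _); rewrite mxE mulr_suml -sumrN -big_split/=.
by apply: eq_bigr => j _; rewrite liftK mxE mulrBr addrC.
Qed.

Lemma dot_vgradB K f x y : dot (vgrad K f) (y - x) = aff K f y - aff K f x.
Proof. by rewrite /aff opprD addrACA subrr add0r -dotBr opprB addrA subrK. Qed.

Lemma vgrad_lin K (a : R) f g :
  vgrad K (fun x => a * f x + g x) = a *: vgrad K f + vgrad K g.
Proof.
rewrite /vgrad -linearZ/= -linearD/= scalemxAr -mulmxDr; congr (_ *m _)^T.
by apply/matrixP => i j; rewrite !mxE; ring.
Qed.

Lemma eq_vgrad K f g : (forall i, f (vtx K i) = g (vtx K i)) -> vgrad K f = vgrad K g.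
Proof.
by move=> fg; rewrite /vgrad; congr (_ *m _)^T; apply/matrixP => i j; rewrite !mxE !fg.
Qed.

Lemma eq_aff K f g x : (forall i, f (vtx K i) = g (vtx K i)) -> aff K f x = aff K g x.
Proof. by move=> fg; rewrite !affE; apply: eq_bigr => i _; rewrite fg. Qed.

Lemma aff_continuous K f : continuous (aff K f).
Proof.
rewrite (_ : aff K f = fun x => \sum_i bary K x i * f (vtx K i)); last first.
  by apply/funext => x; rewrite affE.
apply: continuous_big => [|i _ x]; first exact: add_continuous.
by apply: (@continuousM _ _ (fun x => bary K x i) (cst _));
  [exact: bary_continuous|exact: cst_continuous].
Qed.

Lemma vgrad_cst K c : vgrad K (fun=> c) = 0.
Proof.
rewrite /vgrad (_ : \col_i _ = 0) ?mulmx0 ?trmx0//.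
by apply/matrixP => i j; rewrite !mxE subrr.
Qed.

End barycentric.

Lemma avoid_seq {R : realType} (a b : R) (s : seq R) : a < b ->
  exists2 v, a < v < b & v \notin s.
Proof.
move=> ab; pose e := \big[Num.min/(b - a)]_(c <- s | a < c) (c - a).
have e0 : 0 < e.
  by rewrite /e; elim/big_ind : _ => [|x y x0 y0|c ac]; rewrite ?lt_min ?x0 ?subr_gt0.
have eb : e <= b - a by exact: bigmin_le_id.
exists (a + e / 2); first by apply/andP; split; lra.
apply/negP => vs; have : e <= a + e / 2 - a.
  by apply: ge_bigmin_seq => //; rewrite ltrDl divr_gt0.
lra.
Qed.

(** * Conforming meshes: interpolants and their gradients as piecewise functions *)

Section mesh.
Context {R : realType} {d : nat} (Om : set 'rV[R]_d) (Th : mesh R d).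
Hypotheses (Hp : polyhedral_domain Om) (Hc : conforming Om Th).
Implicit Types (K L : 'M[R]_(d.+1, d)) (x y : 'rV[R]_d) (f g : 'rV[R]_d -> R).

Lemma Om_neq0 : Om !=set0. Proof. by case: Hp. Qed.
Lemma Om_open : open Om. Proof. by case: Hp. Qed.

Lemma Om_convex x y t : Om x -> Om y -> 0 <= t <= 1 -> Om ((1 - t) *: x + t *: y).
Proof.
case: Hp => _ _ _ _ [s ->] /= Ox Oy /andP[t0 t1] p ps.
rewrite dotDr !dotZr; have := Ox p ps; have := Oy p ps => hy hx.
have [->|tn] := eqVneq t 0; first by rewrite subr0 mul1r mul0r addr0.
have tp : 0 < t by rewrite lt_neqAle eq_sym tn.
have h1 : t * dot p.1 y < t * p.2 by rewrite ltr_pM2l.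
have h2 : (1 - t) * dot p.1 x <= (1 - t) * p.2 by apply: ler_wpM2l; [lra|exact: ltW].
lra.
Qed.

Lemma Om_bounded : exists M, forall x, closure Om x -> `|x| <= M.
Proof.
case: Hp => _ _ [M [_ HM]] _ _; exists (M + 1) => x.
have cl : closed [set y : 'rV[R]_d | `|y| <= M + 1].
  rewrite (_ : [set y | _] = (fun y : 'rV[R]_d => `|y|) @^-1` [set t | t <= M + 1])//.
  apply: preimage_closed => [y _|]; last exact: closed_le.
  exact: norm_continuous.
have sub : Om `<=` [set y : 'rV[R]_d | `|y| <= M + 1].
  by move=> y; apply: HM; rewrite ltrDl.
by move=> /(closure_subset sub); rewrite -(closure_id _).1.
Qed.

Lemma Om_fin : (@leb R d Om < +oo)%E.
Proof.
have [M HM] := Om_bounded; apply: (leb_bounded_lty (M := M)).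
  exact: open_measurable_borel Om_open.
by move=> x Ox; apply: HM; exact: subset_closure.
Qed.

Lemma meshU K : K \in Th -> edges K \in unitmx. Proof. by case: Hc => h _ _; exact: h. Qed.

Lemma mesh_cover x : closure Om x <-> exists2 K, K \in Th & simplex K x.
Proof. by case: Hc => _ -> _; split => -[K KT Kx]; exists K. Qed.

Lemma simplex_closure K x : K \in Th -> simplex K x -> closure Om x.
Proof. by move=> KT Kx; apply/mesh_cover; exists K. Qed.

Lemma elt_mem x : closure Om x -> elt Th x \in Th /\ simplex (elt Th x) x.
Proof.
move=> /mesh_cover[K KT Kx].
have hx : has (fun K => x \in simplex K) Th.
  by apply/hasP; exists K => //; rewrite inE.
split; first by rewrite /elt mem_nth// -has_find.
by have := nth_find 0 hx; rewrite inE.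
Qed.

(** Conformity separates interiors only, while [x] may lie on the boundary of [L]. Moving [x]
    slightly towards the barycenter of [L] enters the interior of [L] without leaving the open
    simplex of [K]. *)
Lemma isimplex_disjoint K L x : K \in Th -> L \in Th -> K != L ->
  isimplex K x -> ~ simplex L x.
Proof.
move=> KT LT KL Kx Lx.
have [_ _ /(_ K L KT LT KL)[II _]] := Hc.
pose z t := (1 - t) *: x + t *: barycenter L.
have cz : continuous z.
  move=> t; apply: cvgD.
    apply: cvgZr_tmp; apply: cvgB; [exact: cvg_cst|exact: cvg_id].
  by apply: cvgZr_tmp; exact: cvg_id.
have z0 : z 0 = x by rewrite /z subr0 scale1r scale0r addr0.
have nK : \forall t \near (0 : R), isimplex K (z t).
  apply: (cz 0 (isimplex K)); rewrite z0; apply: open_nbhs_nbhs; split => //.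
  exact: open_isimplex.
have /nbhs_ballP[e /= e0 He] := nK.
pose t := Num.min (e / 2) 1.
have t0 : 0 < t by rewrite lt_min divr_gt0//=.
have t1 : t <= 1 by rewrite ge_min lexx orbT.
have Kz : isimplex K (z t).
  apply: He; rewrite /ball/= sub0r normrN gtr0_norm//.
  by rewrite gt_min; apply/orP; left; lra.
have Lz : isimplex L (z t).
  move=> i; rewrite /z bary_conv.
  have h1 : 0 <= bary L x i by exact: ((simplexP x (meshU LT)).1 Lx i).
  have h2 := isimplex_barycenter (meshU LT) i.
  by rewrite ltr_wpDl ?mulr_gt0// mulr_ge0// subr_ge0.
have : (interior (simplex K) `&` interior (simplex L)) (z t).
  split.
    apply: (@filterS _ (nbhs (z t)) _ (isimplex K)); first by move=> y;
      exact: isimplex_sub (meshU KT).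
    by apply: open_nbhs_nbhs; split => //; exact: open_isimplex.
  apply: (@filterS _ (nbhs (z t)) _ (isimplex L)); first by move=> y;
    exact: isimplex_sub (meshU LT).
  by apply: open_nbhs_nbhs; split => //; exact: open_isimplex.
by rewrite II.
Qed.

Lemma elt_isimplex K x : K \in Th -> isimplex K x -> elt Th x = K.
Proof.
move=> KT Kx; apply: contrapT => /eqP nK.
have [eT ex] := elt_mem (simplex_closure KT (isimplex_sub (meshU KT) Kx)).
by apply: (isimplex_disjoint KT eT _ Kx ex); rewrite eq_sym.
Qed.

(** Elements are only known to lie in [closure Om], but the open simplex is a neighbourhood of its
    barycenter, which adheres to [Om]. *)
Lemma isimplex_meets K : K \in Th -> (isimplex K `&` Om) !=set0.
Proof.
move=> KT; have cK := isimplex_barycenter (meshU KT).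
have := simplex_closure KT (isimplex_sub (meshU KT) cK).
have nK : nbhs (barycenter K) (isimplex K).
  by apply: open_nbhs_nbhs; split => //; exact: open_isimplex.
move=> /(_ (isimplex K) nK)[x [Ox Kx]].
by exists x.
Qed.

(* A common point of two elements lies on their common face, hence has the same
   barycentric decomposition over the shared vertices. *)
Lemma aff_compat K L f x : K \in Th -> L \in Th -> simplex K x -> simplex L x ->
  aff K f x = aff L f x.
Proof.
move=> KT LT Kx Lx; have [->//|KL] := eqVneq K L.
have [_ _ /(_ K L KT LT KL)[_ KLE]] := Hc.
have : (simplex K `&` simplex L) x by split.
rewrite KLE => -[w [w0 wJ w1 xE]].
have KE : forall i, w 0 i = bary K x i.
  by apply: bary_uniq (meshU KT) w1 _; rewrite xE mulmx_sum_row.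
have /choice[sg sgP] : forall i, exists j, w 0 i != 0 -> vtx K i = vtx L j.
  move=> i; have [iJ|/wJ ->] := boolP (i \in [pred i | [exists j, vtx K i == vtx L j]]).
    by move: iJ; rewrite inE => /existsP[j /eqP]; exists j.
  by exists ord0; rewrite eqxx.
pose w' j := \sum_(i | sg i == j) w 0 i.
have sumw' (V : lmodType R) (h : 'I_d.+1 -> V) : \sum_j w' j *: h j = \sum_i w 0 i *: h (sg i).
  rewrite [RHS](partition_big sg predT)//=; apply: eq_bigr => j _.
  by rewrite scaler_suml; apply: eq_bigr => i /eqP ->.
have swap (V : lmodType R) (h : 'rV[R]_d -> V) :
    \sum_i w 0 i *: h (vtx L (sg i)) = \sum_i w 0 i *: h (vtx K i).
  apply: eq_bigr => i _; have [->|/sgP ->//] := eqVneq (w 0 i) 0.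
  by rewrite !scale0r.
have LE : forall j, w' j = bary L x j.
  apply: bary_uniq (meshU LT) _ _.
    by rewrite -w1 [RHS](partition_big sg predT).
  by rewrite sumw' (swap _ id) xE mulmx_sum_row.
rewrite !affE; transitivity (\sum_i w 0 i *: (f (vtx K i) : R^o)).
  by apply: eq_bigr => i _; rewrite KE.
rewrite -(swap R^o f) -(sumw' R^o (fun j => f (vtx L j))).
by apply: eq_bigr => i _; rewrite LE.
Qed.

Lemma pih_aff f K x : K \in Th -> simplex K x -> pih Th f x = aff K f x.
Proof.
move=> KT Kx; have [eT ex] := elt_mem (simplex_closure KT Kx).
exact: aff_compat.
Qed.

Lemma pih_vtx f K i : K \in Th -> pih Th f (vtx K i) = f (vtx K i).
Proof.
move=> KT; have uK := meshU KT; rewrite (pih_aff _ KT); last exact: simplex_vtx.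
rewrite affE (bigD1 i)//= bary_vtx// eqxx mul1r big1 ?addr0// => j /negbTE ji.
by rewrite bary_vtx// ji mul0r.
Qed.

(** Pasting over the finite closed cover by the elements: on each one the interpolant is affine, by
    [aff_compat] whichever element [elt] has chosen. *)
Lemma pih_continuous f : {within closure Om, continuous (pih Th f)}.
Proof.
suff H (s : seq 'M[R]_(d.+1, d)) : {subset s <= Th} ->
    {within \bigcup_(K in [set K | K \in s]) simplex K, continuous (pih Th f)}.
  by case: (Hc) => _ -> _; exact: H.
elim: s => [|K s IHs] sub.
  rewrite (_ : \bigcup_(K in _) _ = set0); first exact: continuous_subspace0.
  by apply/seteqP; split => // x [K].
have KT : K \in Th by apply: sub; rewrite mem_head.
have sT : {subset s <= Th} by move=> L Ls; apply: sub; rewrite inE Ls orbT.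
rewrite (_ : \bigcup_(L in _) _ = simplex K `|` \bigcup_(L in [set L | L \in s]) simplex L).
  apply: withinU_continuous; last exact: IHs.
  - exact: closed_simplex (meshU KT).
  - rewrite bigcup_seq big_seq; elim/big_rec : _ => [|L A /sT LT]; first exact: closed0.
    by apply: closedU; exact: closed_simplex (meshU LT).
  - apply: (@subspace_eq_continuous _ (simplex K) _ (aff K f)).
      by move=> x; rewrite inE => Kx; exact: (esym (pih_aff _ KT Kx)).
    exact/continuous_subspaceT/aff_continuous.
apply/seteqP; split => [x [L /=]|x [Kx|[L /= Ls Lx]]].
- by rewrite inE => /predU1P[->|Ls] Lx; [left|right; exists L].
- by exists K => //=; rewrite mem_head.
- by exists L => //=; rewrite inE Ls orbT.
Qed.

Lemma pih_Sh f : in_Sh Om Th (pih Th f).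
Proof.
split; first exact: pih_continuous.
move=> K KT; exists (f (vtx K ord0) - dot (vgrad K f) (vtx K ord0)), (vgrad K f) => x Kx.
by rewrite (pih_aff _ KT Kx) /aff dotBr addrAC addrA.
Qed.

Lemma Sh_pih chi x : in_Sh Om Th chi -> closure Om x -> chi x = pih Th chi x.
Proof.
move=> [_ aChi] cx; have [eT ex] := elt_mem cx; set K := elt Th x in eT ex.
have uK := meshU eT; have [a [g H]] := aChi _ eT.
rewrite (pih_aff _ eT ex) affE.
rewrite (eq_bigr (fun i => bary K x i * a + bary K x i * dot g (vtx K i))); last first.
  by move=> i _; rewrite H ?mulrDr//; exact: simplex_vtx.
rewrite big_split/= -mulr_suml bary_sum mul1r H//; congr (_ + _).
rewrite -[in LHS](bary_comb x uK) dotC.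
transitivity (\sum_i dot (bary K x i *: vtx K i) g).
  by elim/big_ind2 : _ => [|a1 b1 a2 b2 <- <-|//]; [rewrite dot0l|rewrite dotDl].
by apply: eq_bigr => i _; rewrite dotZl dotC.
Qed.

Definition nodeq f g := forall K i, K \in Th -> f (vtx K i) = g (vtx K i).

Lemma nodeq_pih f g x : nodeq f g -> closure Om x -> pih Th f x = pih Th g x.
Proof. by move=> fg /elt_mem[eT _]; apply: eq_aff => i; exact: fg. Qed.

Lemma nodeq_grad f g x : nodeq f g -> closure Om x -> grad Th f x = grad Th g x.
Proof. by move=> fg /elt_mem[eT _]; apply: eq_vgrad => i; exact: fg. Qed.

Lemma pih_nodeq f : nodeq (pih Th f) f.
Proof. by move=> K i KT; exact: pih_vtx. Qed.

Lemma bmf_continuous f : continuous f -> bmf Om f.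
Proof.
move=> cf; split.
  by apply: measurable_funTS; exact: continuous_measurable_borel.
have [M HM] := Om_bounded.
have cpt : compact (closure Om).
  apply: bounded_closed_compact; last exact: closed_closure.
  by exists M; split; [exact: num_real|move=> N MN x /HM h; exact: le_trans h (ltW MN)].
have : compact (f @` closure Om).
  by apply: continuous_compact => //; exact: continuous_subspaceT.
move=> /compact_bounded[B [_ HB]]; exists (B + 1) => x Ox.
apply: (HB (B + 1)); first by rewrite ltrDl.
by exists x => //; exact: subset_closure.
Qed.

(** [elt] takes the first element of the list that contains the point, so along the list the
    function is an indicator times the head piece plus the complement times the rest. *)
Lemma bmf_elt (P : 'M[R]_(d.+1, d) -> 'rV[R]_d -> R) :
  (forall K, continuous (P K)) -> bmf Om (fun x => P (elt Th x) x).
Proof.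
move=> cP; suff H (s : seq 'M[R]_(d.+1, d)) : {subset s <= Th} ->
    bmf Om (fun x => P (nth 0 s (find (fun K => x \in simplex K) s)) x) by exact: H.
(* On the empty list [nth] returns the zero matrix, so the base case is the piece [P 0], continuous
   like every [P K]. *)
elim: s => [|K s IHs] sub /=; first exact: bmf_continuous.
have KT : K \in Th by apply: sub; rewrite mem_head.
have {}IHs : bmf Om (fun x => P (nth 0 s (find (fun K => x \in simplex K) s)) x).
  by apply: IHs => L Ls; apply: sub; rewrite inE Ls orbT.
have b1 : bmf Om \1_(simplex K).
  split; last by exists 1 => x _; rewrite indicE; case: (_ \in _); rewrite ?normr1 ?normr0.
  apply: measurable_funTS; apply: measurable_indic.
  exact: closed_measurable_borel (closed_simplex (meshU KT)).
have := bmfD (bmfM b1 (bmf_continuous (cP K))) (bmfM (bmfD (bmf_cst Om 1) (bmfZ (-1) b1)) IHs).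
apply: eq_bmf => x _; rewrite indicE; case: ifPn => _ /=.
  by rewrite mul1r mulr1 subrr mul0r addr0.
by rewrite mul0r mulr0 addr0 mul1r add0r.
Qed.

Lemma bmf_pih f : bmf Om (pih Th f).
Proof. by apply: (bmf_elt (P := fun K => aff K f)) => K; exact: aff_continuous. Qed.

Lemma bmf_grad f i : bmf Om (fun x => grad Th f x 0 i).
Proof. by apply: (bmf_elt (P := fun K _ => vgrad K f 0 i)) => K; exact: cst_continuous. Qed.

Lemma bmf_dot_grad f g : bmf Om (fun x => dot (grad Th f x) (grad Th g x)).
Proof. by apply: bmf_sum => i; apply: bmfM; exact: bmf_grad. Qed.

Lemma bmf_Sh chi : in_Sh Om Th chi -> bmf Om chi.
Proof.
move=> hc; apply: eq_bmf (bmf_pih chi) => x Ox.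
by rewrite -Sh_pih//; exact: subset_closure.
Qed.

(* The interpolant of a function with vanishing elementwise gradient is continuous
   and takes finitely many values along segments of the convex set Om. *)
Lemma vgrad0_cst f : (forall K, K \in Th -> vgrad K f = 0) ->
  forall K L i j, K \in Th -> L \in Th -> f (vtx K i) = f (vtx L j).
Proof.
move=> g0.
have val K x : K \in Th -> simplex K x -> pih Th f x = f (vtx K ord0).
  by move=> KT Kx; rewrite (pih_aff _ KT Kx) /aff g0// dot0l addr0.
have val' K i : K \in Th -> f (vtx K i) = f (vtx K ord0).
  by move=> KT; rewrite -pih_vtx// (val K)//; exact: simplex_vtx (meshU KT).
have cOm y : Om y -> {for y, continuous (pih Th f)}.
  have := continuous_subspaceW (@subset_closure _ Om) (pih_continuous (f := f)).
  by rewrite (continuous_open_subspace _ Om_open) => h Oy; apply: h; rewrite inE.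
have main x y : Om x -> Om y -> pih Th f x <= pih Th f y.
  move=> Ox Oy; rewrite leNgt; apply/negP => lt.
  pose z (t : R) := (1 - t) *: x + t *: y.
  have cz : continuous z.
    move=> t; apply: cvgD.
      apply: cvgZr_tmp; apply: cvgB; [exact: cvg_cst|exact: cvg_id].
    by apply: cvgZr_tmp; exact: cvg_id.
  have z0 : z 0 = x by rewrite /z subr0 scale1r scale0r addr0.
  have z1 : z 1 = y by rewrite /z subrr scale1r scale0r add0r.
  have [v /andP[v1 v2] vs] := avoid_seq [seq f (vtx K ord0) | K <- Th] lt.
  have [||t t01 tv] := @IVT _ (fun t => pih Th f (z t)) 0 1 v ler01.
  - apply: continuous_in_subspaceT => t; rewrite inE/= in_itv/= => t01.
    apply: (@continuous_comp _ _ _ z); first exact: cz.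
    by apply: cOm; exact: Om_convex.
  - rewrite z0 z1 ge_min le_max; apply/andP; split; apply/orP; [right|left]; exact: ltW.
  - move/negP : vs; apply; rewrite -tv.
    have Oz : Om (z t) by apply: Om_convex => //; move: t01; rewrite in_itv.
    have [eT ez] := elt_mem (subset_closure Oz).
    by apply/mapP; exists (elt Th (z t)) => //; exact: val.
move=> K L i j KT LT; rewrite val'// (val' L)//.
have [x [Kx Ox]] := isimplex_meets KT; have [y [Ly Oy]] := isimplex_meets LT.
rewrite -(val K x)//; last exact: isimplex_sub (meshU KT) Kx.
rewrite -(val L y)//; last exact: isimplex_sub (meshU LT) Ly.
by apply/eqP; rewrite eq_le !main.
Qed.

End mesh.

(** * Nodal vectors, mass and stiffness matrices, and comparison of norms *)

Section nodal.
Context {R : realType} {d : nat} (Om : set 'rV[R]_d) (Th : mesh R d).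
Hypotheses (Hp : polyhedral_domain Om) (Hc : conforming Om Th).
Implicit Types (K L : 'M[R]_(d.+1, d)) (x y : 'rV[R]_d) (f g p : 'rV[R]_d -> R).

Let oOm : open Om := Om_open Hp.
Let Omfin := Om_fin Hp.
Let inc x : Om x -> closure Om x. Proof. exact: subset_closure. Qed.

Definition nodes : seq 'rV[R]_d := undup [seq vtx K i | K <- Th, i <- enum 'I_d.+1].
Definition nnode := size nodes.
Definition node (j : 'I_nnode) : 'rV[R]_d := nth 0 nodes j.
Definition nv f : 'rV[R]_nnode := \row_j f (node j).
(** Only vertex values matter to [pih] and [grad], so a Kronecker delta on points can replace the
    hat function, which is its interpolant. In the same way [ext] is merely some function with given
    nodal values. *)
Definition hat (j : 'I_nnode) : 'rV[R]_d -> R := fun y => (y == node j)%:R.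
Definition ext (u : 'rV[R]_nnode) : 'rV[R]_d -> R := fun y => \sum_j u 0 j * hat j y.

Lemma node_inj : injective node.
Proof.
move=> j k /eqP; rewrite nth_uniq ?ltn_ord ?undup_uniq// => /eqP jk.
exact: val_inj.
Qed.

Lemma node_vtx j : exists K i, K \in Th /\ node j = vtx K i.
Proof.
have : node j \in nodes by apply: mem_nth.
by rewrite mem_undup => /allpairsP[[K i] /= [KT _ ->]]; exists K, i.
Qed.

Lemma vtx_node K i : K \in Th -> exists j, vtx K i = node j.
Proof.
move=> KT; have h : vtx K i \in nodes.
  by rewrite mem_undup; apply/allpairsP; exists (K, i); rewrite mem_enum.
have hs : (index (vtx K i) nodes < nnode)%N by rewrite index_mem.
by exists (Ordinal hs); rewrite /node nth_index.
Qed.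

Lemma hat_node j k : hat j (node k) = (k == j)%:R.
Proof. by rewrite /hat (inj_eq node_inj). Qed.

Lemma nv_ext u : nv (ext u) = u.
Proof.
apply/rowP => k; rewrite mxE /ext (bigD1 k)//= hat_node eqxx mulr1 big1 ?addr0// => j jk.
by rewrite hat_node eq_sym (negbTE jk) mulr0.
Qed.

Lemma nodeqP f g : nodeq Th f g <-> nv f = nv g.
Proof.
split=> [fg|fg K i KT].
  by apply/rowP => j; rewrite !mxE; have [K [i [KT ->]]] := node_vtx j; exact: fg.
have [j ->] := vtx_node i KT.
by have /rowP/(_ j) := fg; rewrite !mxE.
Qed.

Lemma nodeq_ext f : nodeq Th f (ext (nv f)).
Proof. by apply/nodeqP; rewrite nv_ext. Qed.

Lemma nv_pih f : nv (pih Th f) = nv f.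
Proof. by apply/nodeqP; exact: pih_nodeq Hc f. Qed.

Lemma aff_sum (J : Type) (s : seq J) (c : J -> R) (F : J -> 'rV[R]_d -> R) K x :
  aff K (fun y => \sum_(j <- s) c j * F j y) x = \sum_(j <- s) c j * aff K (F j) x.
Proof.
rewrite affE; under eq_bigr do rewrite mulr_sumr; rewrite exchange_big/=.
apply: eq_bigr => j _; rewrite affE mulr_sumr; apply: eq_bigr => i _; ring.
Qed.

Lemma vgrad_sum (J : Type) (s : seq J) (c : J -> R) (F : J -> 'rV[R]_d -> R) K :
  vgrad K (fun y => \sum_(j <- s) c j * F j y) = \sum_(j <- s) c j *: vgrad K (F j).
Proof.
elim: s => [|j s IHs].
  by rewrite big_nil -(vgrad_cst K 0); apply: eq_vgrad => i; rewrite big_nil.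
rewrite big_cons -IHs -vgrad_lin; apply: eq_vgrad => i.
by rewrite big_cons.
Qed.

Lemma pih_hat f x : closure Om x -> pih Th f x = \sum_j nv f 0 j * pih Th (hat j) x.
Proof. by move=> cx; rewrite (nodeq_pih Hc (nodeq_ext f) cx); exact: aff_sum. Qed.

Lemma grad_hat f x : closure Om x -> grad Th f x = \sum_j nv f 0 j *: grad Th (hat j) x.
Proof. by move=> cx; rewrite (nodeq_grad Hc (nodeq_ext f) cx); exact: vgrad_sum. Qed.

Definition mass_w : 'rV[R]_nnode := \row_j intg Om (pih Th (hat j)).
Definition stiff : 'M[R]_nnode := \matrix_(j, k) gradip Om Th (hat j) (hat k).
(** Interpolating [g] makes the form depend on nodal values alone; for [g] in S^h it changes nothing
    on [Om]. *)
Definition tri p f g : R := intg Om (fun x => dot (grad Th f x) (grad Th p x) * pih Th g x).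
Definition trim p : 'M[R]_nnode := \matrix_(j, k) tri p (hat j) (hat k).

Lemma intg_pih f : intg Om (pih Th f) = dot mass_w (nv f).
Proof.
rewrite (eq_intg (fun x Ox => pih_hat f (inc Ox))) intg_sum//; last first.
  by move=> j; apply: bmfZ => //; exact: bmf_pih Hp Hc _.
apply: eq_bigr => j _; rewrite intgZ//; last exact: bmf_pih Hp Hc _.
by rewrite !mxE mulrC.
Qed.

Lemma lumpE f g : lump Om Th f g = dot (wd mass_w (nv f)) (nv g).
Proof.
rewrite /lump intg_pih dot_wdE; apply: eq_bigr => j _; by rewrite !mxE.
Qed.

Lemma dot_sum_l (n : nat) (J : Type) (s : seq J) (F : J -> 'rV[R]_n) (v : 'rV[R]_n) :
  dot (\sum_(j <- s) F j) v = \sum_(j <- s) dot (F j) v.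
Proof. by elim/big_ind2 : _ => [|a b c e <- <-|//]; [rewrite dot0l|rewrite dotDl]. Qed.

Lemma bilinearE (M : 'M[R]_nnode) (u v : 'rV[R]_nnode) :
  dot (u *m M) v = \sum_j \sum_k u 0 j * (v 0 k * M j k).
Proof.
rewrite /dot exchange_big/=; apply: eq_bigr => k _; rewrite mxE mulr_suml.
by apply: eq_bigr => j _; ring.
Qed.

Lemma gradipE f g : gradip Om Th f g = dot (nv f *m stiff) (nv g).
Proof.
rewrite bilinearE /gradip.
transitivity (intg Om (fun x => \sum_j \sum_k nv f 0 j *
    (nv g 0 k * dot (grad Th (hat j) x) (grad Th (hat k) x)))).
  apply: eq_intg => x Ox; rewrite (grad_hat f (inc Ox)) (grad_hat g (inc Ox)) dot_sum_l.
  apply: eq_bigr => j _; rewrite dotZl dotC dot_sum_l mulr_sumr.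
  by apply: eq_bigr => k _; rewrite dotZl dotC.
have b j k := bmf_dot_grad Hp Hc (hat j) (hat k).
rewrite intg_sum//; last by move=> j; apply: bmf_sum => // k; do 2!apply: bmfZ => //; exact: b.
apply: eq_bigr => j _; rewrite intg_sum//; last by move=> k; do 2!apply: bmfZ => //; exact: b.
apply: eq_bigr => k _; have bb := bmfZ (nv g 0 k) (b j k).
by rewrite (intgZ oOm Omfin _ bb) (intgZ oOm Omfin _ (b j k)) [stiff j k]mxE.
Qed.

Lemma bmf_tri p f g : bmf Om (fun x => dot (grad Th f x) (grad Th p x) * pih Th g x).
Proof. by apply: bmfM => //; [exact: bmf_dot_grad Hp Hc _ _|exact: bmf_pih Hp Hc _]. Qed.

Lemma triE p f g : tri p f g = dot (nv f *m trim p) (nv g).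
Proof.
rewrite bilinearE /tri.
transitivity (intg Om (fun x => \sum_j \sum_k nv f 0 j * (nv g 0 k *
    (dot (grad Th (hat j) x) (grad Th p x) * pih Th (hat k) x)))).
  apply: eq_intg => x Ox; rewrite (grad_hat f (inc Ox)) (pih_hat g (inc Ox)) dot_sum_l mulr_suml.
  apply: eq_bigr => j _; rewrite dotZl mulr_sumr; apply: eq_bigr => k _; ring.
have b j k := bmf_tri p (hat j) (hat k).
rewrite intg_sum//; last by move=> j; apply: bmf_sum => // k; do 2!apply: bmfZ => //; exact: b.
apply: eq_bigr => j _; rewrite intg_sum//; last by move=> k; do 2!apply: bmfZ => //; exact: b.
apply: eq_bigr => k _; have bb := bmfZ (nv g 0 k) (b j k).
by rewrite (intgZ oOm Omfin _ bb) (intgZ oOm Omfin _ (b j k)) [trim p j k]mxE.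
Qed.

(** The interpolated hat function is nonnegative, and positive on the open simplex of any element
    with that vertex, so its integral cannot vanish. *)
Lemma mass_w_gt0 j : 0 < mass_w 0 j.
Proof.
have [K [i [KT ji]]] := node_vtx j; have uK := meshU Hc KT.
have p0 x : Om x -> 0 <= pih Th (hat j) x.
  move=> Ox; have [eT ex] := elt_mem Hc (inc Ox).
  rewrite [pih _ _ _](affE (elt Th x)) sumr_ge0// => k _.
  by rewrite mulr_ge0// ?((simplexP _ (meshU Hc eT)).1 ex)// ler0n.
rewrite mxE lt_neqAle intg_ge0 ?andbT//; apply/eqP => /esym.
move=> /(intg_eq0 oOm Omfin (bmf_pih Hp Hc _) p0 (@open_isimplex R d K) (isimplex_meets Hc KT)).
move=> [x [Kx Ox]]; rewrite (pih_aff Hc _ KT); last exact: isimplex_sub.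
rewrite affE (bigD1 i)//= {1}/hat ji eqxx mulr1; set S := \sum_(k < _ | _) _ => h.
have S0 : 0 <= S by apply: sumr_ge0 => k _; rewrite mulr_ge0 ?ler0n// ltW// Kx.
by have := ltr_pwDl (Kx i) S0; rewrite h ltxx.
Qed.

Lemma stiff_sym : stiff^T = stiff.
Proof.
apply/matrixP => j k; rewrite !mxE; apply: eq_intg => x _; exact: dotC.
Qed.

Lemma stiff_ge0 (u : 'rV[R]_nnode) : 0 <= dot (u *m stiff) u.
Proof.
by rewrite -(nv_ext u) -gradipE; apply: intg_ge0 => // x _; exact: dot_ge0.
Qed.

Lemma gradip_eq0 f : gradip Om Th f f = 0 -> forall K, K \in Th -> vgrad K f = 0.
Proof.
move=> f0 K KT.
have := intg_eq0 oOm Omfin (bmf_dot_grad Hp Hc f f) (fun x _ => dot_ge0 _)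
  (@open_isimplex R d K) (isimplex_meets Hc KT) f0.
by move=> [x [Kx _]]; rewrite /grad (elt_isimplex Hc KT Kx); exact: dot_eq0.
Qed.

Lemma stiff_ker (u : 'rV[R]_nnode) : dot (u *m stiff) u = 0 -> exists c, u = const_mx c.
Proof.
rewrite -(nv_ext u) -gradipE => /gradip_eq0 /(vgrad0_cst Hp Hc) H.
case: (posnP nnode) => [n0|n0].
  by exists 0; apply/rowP => j; have := ltn_ord j; rewrite {2}n0.
have [K0 [i0 [KT0 _]]] := node_vtx (Ordinal n0).
exists (ext u (vtx K0 i0)); apply/rowP => j; rewrite !mxE.
by have [K [i [KT ->]]] := node_vtx j; exact: H.
Qed.

Lemma nv_cst c : nv (fun=> c) = const_mx c.
Proof. by apply/rowP => j; rewrite !mxE. Qed.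

Lemma stiff_one : (const_mx 1 : 'rV_nnode) *m stiff = 0.
Proof.
apply: dot_nondeg => v; rewrite -(nv_ext v) -nv_cst -gradipE.
rewrite -(intg0 oOm); apply: eq_intg => x _.
by rewrite /grad vgrad_cst dot0l.
Qed.

Lemma nnode_gt0 : (0 < nnode)%N.
Proof.
have [x Ox] := Om_neq0 Hp; have [eT _] := elt_mem Hc (inc Ox).
by have [[j jn] _] := vtx_node ord0 eT; exact: leq_ltn_trans jn.
Qed.

Lemma gradnormE f : gradnorm Om Th f ^+ 2 = gradip Om Th f f.
Proof.
by rewrite /gradnorm /l2vnorm sqr_sqrtr//; apply: intg_ge0 => // x _; exact: dot_ge0.
Qed.

Lemma l2normE f : l2norm Om f ^+ 2 = intg Om (fun x => f x ^+ 2).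
Proof. by rewrite /l2norm sqr_sqrtr//; apply: intg_ge0 => // x _; exact: sqr_ge0. Qed.

Lemma eq_l2norm f g : (forall x, Om x -> f x = g x) -> l2norm Om f = l2norm Om g.
Proof. by move=> fg; congr Num.sqrt; apply: eq_intg => x Ox; rewrite fg. Qed.

Lemma l2norm_Sh f : in_Sh Om Th f -> l2norm Om f = l2norm Om (pih Th f).
Proof. by move=> hf; apply: eq_l2norm => x Ox; exact: (Sh_pih Hc) (inc Ox). Qed.

(** Jensen's inequality on each element: the difference of the integrands is the variance of the
    nodal values under the barycentric weights. *)
Lemma l2norm_pih_le f : l2norm Om (pih Th f) ^+ 2 <= dot (wd mass_w (nv f)) (nv f).
Proof.
rewrite l2normE -lumpE; apply: le_intg => //.
- by apply: bmfX => //; exact: bmf_pih Hp Hc _.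
- exact: bmf_pih Hp Hc _.
- move=> x Ox; have [eT ex] := elt_mem Hc (inc Ox); set K := elt Th x in eT ex.
  have b0 i : 0 <= bary K x i by exact: ((simplexP _ (meshU Hc eT)).1 ex).
  rewrite [pih _ f x](affE K) [leRHS](affE K); set m := \sum_i _.
  have : 0 <= \sum_i bary K x i * (f (vtx K i) - m) ^+ 2.
    by apply: sumr_ge0 => i _; rewrite mulr_ge0// sqr_ge0.
  rewrite (eq_bigr (fun i => bary K x i * (f (vtx K i) * f (vtx K i)) +
    (- (2 * m) * (bary K x i * f (vtx K i)) + m ^+ 2 * bary K x i))); last by move=> i _; ring.
  by rewrite !big_split/= -!mulr_sumr bary_sum -/m; lra.
Qed.

Lemma l2norm_Sh_le f : in_Sh Om Th f -> l2norm Om f ^+ 2 <= dot (wd mass_w (nv f)) (nv f).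
Proof. by move=> /l2norm_Sh ->; exact: l2norm_pih_le. Qed.

Lemma tri_le p f g (L2 : R) : (forall K, K \in Th -> dot (vgrad K p) (vgrad K p) <= L2) ->
  tri p f g ^+ 2 <= L2 * gradip Om Th f f * l2norm Om (pih Th g) ^+ 2.
Proof.
move=> hL; have bfp := bmf_dot_grad Hp Hc f p; have bff := bmf_dot_grad Hp Hc f f.
rewrite (le_trans (intg_cauchy_schwarz oOm Omfin bfp (bmf_pih Hp Hc g)))// l2normE.
apply: ler_wpM2r; first by apply: intg_ge0 => x _; exact: sqr_ge0.
rewrite -(intgZ oOm Omfin _ bff).
apply: (le_intg oOm Omfin (bmfX 2 bfp) (bmfZ _ bff)) => x Ox.
 rewrite (le_trans (cauchy_schwarz_dot _ _))// mulrC ler_wpM2r ?dot_ge0//.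
by apply: hL; have [] := elt_mem Hc (inc Ox).
Qed.

Lemma trim_le p (L2 : R) : (forall K, K \in Th -> dot (vgrad K p) (vgrad K p) <= L2) ->
  forall u v : 'rV[R]_nnode, dot (u *m trim p) v ^+ 2 <=
    L2 * dot (u *m stiff) u * dot (wd mass_w v) v.
Proof.
move=> hL u v; rewrite -(nv_ext u) -(nv_ext v) -triE -gradipE.
have [x Ox] := Om_neq0 Hp; have [eT _] := elt_mem Hc (inc Ox).
have L0 : 0 <= L2 by rewrite (le_trans _ (hL _ eT))// dot_ge0.
rewrite (le_trans (tri_le _ _ hL))// ler_wpM2l ?l2norm_pih_le// mulr_ge0//.
by apply: intg_ge0 => // y _; exact: dot_ge0.
Qed.

Lemma enorm_ge0 (v : 'rV[R]_d) : 0 <= enorm v. Proof. exact: sqrtr_ge0. Qed.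

Lemma enorm2 (v : 'rV[R]_d) : enorm v ^+ 2 = dot v v.
Proof. by rewrite sqr_sqrtr// dot_ge0. Qed.

Lemma bmf_enorm_grad f : bmf Om (fun x => enorm (grad Th f x)).
Proof. by apply: bmf_sqrt => //; exact: bmf_dot_grad Hp Hc _ _. Qed.

(** The gradient is constant on the open simplex, which meets [Om] in an open set, so the essential
    supremum sees every element. *)
Lemma vgrad_le_lpnormy p K : K \in Th ->
  dot (vgrad K p) (vgrad K p) <= lpnorm Om +oo%E (fun x => enorm (grad Th p x)) ^+ 2.
Proof.
move=> KT; rewrite -enorm2 ler_pXn2r// ?nnegrE ?enorm_ge0 ?lpnorm_ge0//.
apply: (lpnormy_ge oOm (bmf_enorm_grad p) (@open_isimplex R d K) (isimplex_meets Hc KT)).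
by move=> x Kx Ox; rewrite ger0_norm ?enorm_ge0// /grad (elt_isimplex Hc KT Kx).
Qed.

Lemma lpnorm2_grad f : lpnorm Om 2%:E (fun x => enorm (grad Th f x)) = gradnorm Om Th f.
Proof.
rewrite lpnorm2//; last exact: bmf_enorm_grad.
by congr Num.sqrt; apply: eq_intg => x _; rewrite enorm2.
Qed.

Lemma lpnorm4_exp g : bmf Om g -> lpnorm Om 4%:E g ^+ 4 = intg Om (fun x => (g x ^+ 2) ^+ 2).
Proof.
move=> bg; rewrite lpnorm_exp//; apply: eq_intg => x _.
by rewrite -exprM -normrX ger0_norm// exprn_even_ge0.
Qed.

(* Two applications of Cauchy-Schwarz give Hoelder's inequality with exponents 4, 4, 2. *)
Lemma intg_dot_grad_le f p h : bmf Om h ->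
  `|intg Om (fun x => dot (grad Th f x) (grad Th p x) * h x)| <=
    lpnorm Om 4%:E (fun x => enorm (grad Th f x)) *
    lpnorm Om 4%:E (fun x => enorm (grad Th p x)) * l2norm Om h.
Proof.
move=> bh; have bF := bmf_enorm_grad f; have bG := bmf_enorm_grad p.
have bfp := bmf_dot_grad Hp Hc f p.
set a := lpnorm _ _ _; set b := lpnorm _ _ _.
have ab0 : 0 <= a * b by apply: mulr_ge0; exact: lpnorm_ge0.
apply: normr_le_sqr; first exact: mulr_ge0 ab0 (sqrtr_ge0 _).
apply: (le_trans (intg_cauchy_schwarz oOm Omfin bfp bh)).
rewrite (exprMn 2 (a * b)) (l2normE h).
apply: ler_wpM2r; first by apply: intg_ge0 => x _; exact: sqr_ge0.
apply: (le_trans (ler_norm _)); apply: normr_le_sqr; first exact: sqr_ge0.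
have -> : ((a * b) ^+ 2) ^+ 2 = a ^+ 4 * b ^+ 4 by ring.
rewrite (lpnorm4_exp bF) (lpnorm4_exp bG).
apply: le_trans (intg_cauchy_schwarz oOm Omfin (bmfX 2 bF) (bmfX 2 bG)).
apply: lerXn2r; rewrite ?nnegrE.
- by apply: intg_ge0 => x _; exact: sqr_ge0.
- by apply: intg_ge0 => x _; apply: mulr_ge0; exact: sqr_ge0.
apply: (le_intg oOm Omfin (bmfX 2 bfp) (bmfM (bmfX 2 bF) (bmfX 2 bG))) => x _.
by rewrite !enorm2; exact: cauchy_schwarz_dot.
Qed.

Lemma gradip_le f g : `|gradip Om Th f g| <= gradnorm Om Th f * gradnorm Om Th g.
Proof.
apply: normr_le_sqr; first by apply: mulr_ge0; exact: sqrtr_ge0.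
have -> : (gradnorm Om Th f * gradnorm Om Th g) ^+ 2 = gradip Om Th f f * gradip Om Th g g.
  by rewrite exprMn; congr (_ * _); exact: gradnormE.
rewrite (gradipE f g) (gradipE f f) (gradipE g g).
exact: (psd_cauchy_schwarz stiff_sym stiff_ge0).
Qed.

Lemma mass_mass : mass mass_w = intg Om (fun=> 1).
Proof.
rewrite /mass -nv_cst -intg_pih; apply: eq_intg => x Ox.
by rewrite /pih vgrad_cst dot0l addr0.
Qed.

Lemma meanE f : in_Sh Om Th f -> mean Om f = dot mass_w (nv f) / mass mass_w.
Proof.
move=> hf; rewrite mass_mass -intg_pih /mean mulrC; congr (_ / _).
  by apply: eq_intg => x Ox; exact: (Sh_pih Hc) (inc Ox).
by rewrite /intg Rintegral_cst ?mul1r//; exact: open_measurable_borel.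
Qed.

End nodal.

(** * Acute partitionings *)

Lemma sum_uniq_full (V : nmodType) (T : finType) (s : seq T) (F : T -> V) :
  uniq s -> size s = #|T| -> \sum_k F k = \sum_(k <- s) F k.
Proof.
move=> us ss; apply: perm_big; rewrite perm_sym.
apply: uniq_perm => //; first exact: index_enum_uniq.
have [||_ h] := uniq_min_size us (s2 := index_enum T).
- by move=> k _; exact: mem_index_enum.
- by rewrite ss -sum1_card big_const_seq iter_addn addn0 mul1n count_predT.
- exact: h.
Qed.

Lemma notin_seq (T : finType) (s : seq T) : (size s < #|T|)%N -> exists a, a \notin s.
Proof.
move=> ss; apply: contrapT => /forallNP H; move: ss; rewrite ltnNge => /negP; apply.
rewrite cardE; apply: uniq_leq_size (enum_uniq _) _ => a _.
by apply: contrapT => /negP /H.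
Qed.

Section gradients.
Context {R : realType} {d : nat}.
Variable K : 'M[R]_(d.+1, d).
Hypothesis uK : edges K \in unitmx.

Definition gbary (i : 'I_d.+1) : 'rV[R]_d := vgrad K (fun y => bary K y i).

Lemma aff_vtx f a : aff K f (vtx K a) = f (vtx K a).
Proof.
rewrite affE (bigD1 a)//= bary_vtx// eqxx mul1r big1 ?addr0// => j /negbTE ji.
by rewrite bary_vtx// ji mul0r.
Qed.

Lemma dot_vgrad_edge f a b : dot (vgrad K f) (vtx K a - vtx K b) = f (vtx K a) - f (vtx K b).
Proof. by rewrite dot_vgradB !aff_vtx. Qed.

Lemma dot_gbary_edge i a b : dot (gbary i) (vtx K a - vtx K b) = (i == a)%:R - (i == b)%:R.
Proof. by rewrite dot_vgrad_edge !bary_vtx. Qed.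

Lemma vgradE f : vgrad K f = \sum_i f (vtx K i) *: gbary i.
Proof.
have gen (s : seq 'I_d.+1) :
    vgrad K (fun y => \sum_(i <- s) f (vtx K i) * bary K y i) = \sum_(i <- s) f (vtx K i) *:
      gbary i.
  elim: s => [|j s IHs].
    by rewrite big_nil -(vgrad_cst K 0); apply: eq_vgrad => i; rewrite big_nil.
  by rewrite big_cons -IHs -vgrad_lin; apply: eq_vgrad => i; rewrite big_cons.
rewrite -gen; apply: eq_vgrad => i; rewrite (bigD1 i)//= bary_vtx// eqxx mulr1.
by rewrite big1 ?addr0// => j /negbTE ji; rewrite bary_vtx// ji mulr0.
Qed.

Lemma gbary_sum : \sum_i gbary i = 0.
Proof. by rewrite -[RHS](vgrad_cst K 1) vgradE; apply: eq_bigr => i _; rewrite scale1r. Qed.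

(** The edges from [a] and the gradients of the other barycentric coordinates are dual bases; the
    term [i = a] is zero. *)
Lemma gbary_expand (u : 'rV[R]_d) a : u = \sum_i dot (gbary i) u *: (vtx K i - vtx K a).
Proof.
have bE i : dot (gbary i) u = bary K (vtx K a + u) i - bary K (vtx K a) i.
  have -> : u = vtx K a + u - vtx K a by rewrite addrC addKr.
  rewrite dot_vgradB !affE; have E y : \sum_k bary K y k * bary K (vtx K k) i = bary K y i.
    rewrite (bigD1 i)//= bary_vtx// eqxx mulr1 big1 ?addr0// => j /negbTE ji.
    by rewrite bary_vtx// eq_sym ji mulr0.
  by rewrite !E [vtx K a + u - _]addrC addKr.
rewrite (eq_bigr (fun i => bary K (vtx K a + u) i *: vtx K i - bary K (vtx K a) i *: vtx K i -
  (bary K (vtx K a + u) i - bary K (vtx K a) i) *: vtx K a)); last first.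
  by move=> i _; rewrite bE scalerBr !scalerBl.
rewrite sumrB sumrB !bary_comb// -scaler_suml sumrB !bary_sum subrr scale0r subr0.
by rewrite addrC addKr.
Qed.

(** Expand the gradient g_i over the edges from [a] and pair it with [y]: the vertices other than i
    and j contribute multiples of [e], orthogonal to [y], and what remains is 0 = |g_i|^2 (x . y) +
    (g_i . g_j) |y|^2. In dimension 2 one takes [e = 0]; in dimension 3 [e] is the edge opposite to
    ij. *)
Lemma dot_gbary_le0 i j a e (x y : 'rV[R]_d) c c' : i != j -> i != a -> j != a ->
  x = vtx K i - vtx K a - c *: e -> y = vtx K j - vtx K a - c' *: e ->
  dot e x = 0 -> dot e y = 0 -> dot (gbary i) e = 0 -> dot (gbary j) e = 0 ->
  (forall k, k \notin [:: i; j; a] -> exists t, vtx K k - vtx K a = t *: e) ->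
  0 <= dot x y -> dot (gbary i) (gbary j) <= 0.
Proof.
move=> ij ia ja xE yE ex ey gie gje H xy.
have giy : dot (gbary i) y = 0.
  by rewrite yE dotBr dotZr gie mulr0 dot_gbary_edge (negbTE ij) (negbTE ia) !subr0.
have gjy : dot (gbary j) y = 1.
  by rewrite yE dotBr dotZr gje mulr0 dot_gbary_edge eqxx (negbTE ja) !subr0.
have yy : 0 < dot y y.
  rewrite lt_neqAle dot_ge0 andbT eq_sym; apply/eqP => /dot_eq0 y0.
  by move/eqP: gjy; rewrite y0 dot0r eq_sym oner_eq0.
have : dot (gbary i) y = dot (gbary i) (gbary i) * dot x y + dot (gbary i) (gbary j) * dot y y.
  rewrite [X in dot X y = _](gbary_expand (gbary i) a).
  rewrite (bigD1 i)//= (bigD1 j) 1?eq_sym//= !dotDl.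
  (* The remaining edges are multiples of [e], hence so is their combination; choice picks the
     factors. *)
  have -> : \sum_(k < d.+1 | (k != i) && (k != j)) dot (gbary k) (gbary i) *: (vtx K k - vtx K
    a) =
      (\sum_(k < d.+1 | (k != i) && (k != j)) dot (gbary k) (gbary i) *
        (if pselect (exists t,
          vtx K k - vtx K a = t *: e) is left h then projT1 (cid h) else 0)) *: e.
    rewrite scaler_suml; apply: eq_bigr => k /andP[ki kj]; rewrite -scalerA; congr (_ *: _).
    case: pselect => [h|h]; first exact: (projT2 (cid h)).
    have [->|ka] := eqVneq k a; first by rewrite subrr scale0r.
    by exfalso; apply: h; apply: H; rewrite !inE !negb_or ki kj ka.
  rewrite !dotZl ey mulr0 addr0 (dotC (gbary j)); congr (_ * _ + _ * _).
    by rewrite xE [in RHS]dotBl dotZl ey mulr0 subr0.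
  by rewrite [X in _ = dot X y]yE [in RHS]dotBl dotZl ey mulr0 subr0.
rewrite giy => /esym/eqP; rewrite addrC addr_eq0 => /eqP h.
by rewrite -(pmulr_lle0 _ yy) h oppr_le0 mulr_ge0 ?dot_ge0.
Qed.

Lemma angle_dot_ge0 (u v : 'rV[R]_d) : angle u v <= pi / 2 -> 0 <= dot u v.
Proof.
rewrite /angle; set t := dot u v / _ => h.
have u0 : 0 <= enorm u by exact: sqrtr_ge0. have v0 : 0 <= enorm v by exact: sqrtr_ge0.
have [uv0|uvn] := eqVneq (enorm u * enorm v) 0.
  have := cauchy_schwarz_dot u v.
  have -> : dot u u * dot v v = (enorm u * enorm v) ^+ 2.
    by rewrite exprMn !sqr_sqrtr ?dot_ge0.
  rewrite uv0 expr0n/= => h0; have : dot u v ^+ 2 == 0 by rewrite eq_le h0 sqr_ge0.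
  by rewrite sqrf_eq0 => /eqP ->.
have uvp : 0 < enorm u * enorm v by rewrite lt_neqAle eq_sym uvn mulr_ge0.
have t1 : -1 <= t <= 1.
  rewrite -ler_norml -(@ler_pXn2r _ 2)// ?nnegrE// expr1n real_normK ?num_real//.
  rewrite expr_div_n ler_pdivrMr ?exprn_gt0// mul1r exprMn !sqr_sqrtr ?dot_ge0//.
  exact: cauchy_schwarz_dot.
have : 0 <= t.
  rewrite leNgt; apply/negP => t0; suff : pi / 2 < acos t by rewrite ltNge h.
  rewrite -ltr_cos.
  - by rewrite cos_pihalf acosK// in_itv.
  - by rewrite in_itv/= divr_ge0 ?pi_ge0//= ler_pdivrMr// ler_peMr ?pi_ge0// ler1n.
  - by rewrite in_itv/= acos_ge0//= acos_lepi.
by rewrite pmulr_lge0// invr_gt0.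
Qed.

(** The Gram matrix M of the barycentric gradients has zero row sums, so the product of gradients
    equals - 1/2 times the sum of (F_i - F_j)(G_i - G_j) M_ij, whose off-diagonal entries M_ij are
    nonpositive. *)
Lemma vgrad_monotone_ge0 (f g : 'rV[R]_d -> R) :
  (forall i j, i != j -> dot (gbary i) (gbary j) <= 0) ->
  (forall i j, 0 <= (f (vtx K i) - f (vtx K j)) * (g (vtx K i) - g (vtx K j))) ->
  0 <= dot (vgrad K f) (vgrad K g).
Proof.
move=> hM mono; pose M i j := dot (gbary i) (gbary j).
pose F i := f (vtx K i); pose G i := g (vtx K i).
have dsl (s : seq 'I_d.+1) (h : 'I_d.+1 -> 'rV[R]_d) v :
    dot (\sum_(k <- s) h k) v = \sum_(k <- s) dot (h k) v.
  by elim/big_ind2 : _ => [|a b c e <- <-|//]; [rewrite dot0l|rewrite dotDl].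
have E : dot (vgrad K f) (vgrad K g) = \sum_i \sum_j F i * G j * M i j.
  rewrite !vgradE dsl; apply: eq_bigr => i _; rewrite dotZl dotC dsl mulr_sumr.
  by apply: eq_bigr => j _; rewrite dotZl dotC /M /F /G mulrA.
have row i : \sum_j M i j = 0.
  by rewrite /M; under eq_bigr do rewrite dotC; rewrite -dsl gbary_sum dot0l.
have : 0 <= \sum_i \sum_j - ((F i - F j) * (G i - G j) * M i j).
  apply: sumr_ge0 => i _; apply: sumr_ge0 => j _.
  have [->|ij] := eqVneq i j; first by rewrite subrr !mul0r oppr0.
  by rewrite oppr_ge0 mulr_ge0_le0 ?mono// hM.
have -> : \sum_i \sum_j - ((F i - F j) * (G i - G j) * M i j) =
    \sum_i \sum_j (F i * G j * M i j) + \sum_i \sum_j (F j * G i * M i j)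
    - (\sum_i \sum_j F i * G i * M i j) - (\sum_i \sum_j F j * G j * M i j).
  rewrite -big_split -!sumrB; apply: eq_bigr => i _ /=.
  rewrite -big_split -!sumrB; apply: eq_bigr => j _ /=; ring.
have -> : \sum_i \sum_j F i * G i * M i j = 0.
  by rewrite big1// => i _; rewrite -mulr_sumr row mulr0.
have -> : \sum_i \sum_j F j * G j * M i j = 0.
  rewrite exchange_big big1// => j _; rewrite -mulr_sumr.
  by under eq_bigr do rewrite /M dotC; rewrite row mulr0.
have -> : \sum_i \sum_j F j * G i * M i j = \sum_i \sum_j F i * G j * M i j.
  rewrite exchange_big; apply: eq_bigr => i _; apply: eq_bigr => j _.
  by rewrite /M dotC.
rewrite E; lra.
Qed.

End gradients.

Lemma orth_dot {R : realType} {d : nat} (e u : 'rV[R]_d) : dot e e != 0 -> dot e (orth e u) = 0.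
Proof. by move=> e0; rewrite /orth dotBr dotZr divfK// dotC subrr. Qed.

(** In dimension 1 the two gradients are opposite. In dimension 2 the angle at the third vertex is
    used, in dimension 3 the dihedral angle at the edge joining the two remaining vertices. *)
Lemma acute_gbary {R : realType} {d : nat} (Th : mesh R d) K : (1 <= d <= 3)%N ->
  acute Th -> K \in Th -> edges K \in unitmx ->
  forall i j, i != j -> dot (gbary K i) (gbary K j) <= 0.
Proof.
move=> /andP[d1 d3] aT KT uK i j ij; have [h2 h3] := aT K KT.
have [dE|[dE|dE]] : d = 1%N \/ d = 2%N \/ d = 3%N by lia.
- have : \sum_k gbary K k = \sum_(k <- [:: i; j]) gbary K k.
    by apply: sum_uniq_full; [rewrite /= inE ij|rewrite card_ord /=; lia].
  rewrite gbary_sum// !big_cons big_nil addr0 => /esym/eqP; rewrite addr_eq0 => /eqP ->.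
  by rewrite dotNl oppr_le0 dot_ge0.
- have [a] : exists a, a \notin [:: i; j] by apply: notin_seq; rewrite card_ord /=; lia.
  rewrite !inE negb_or => /andP[ai aj].
  have := h2 (dE) a i j; rewrite /= !inE negb_or ai aj ij => /(_ isT)/angle_dot_ge0 xy.
  apply: (@dot_gbary_le0 _ _ _ uK i j a 0 _ _ 0 0) xy => //;
    rewrite ?dot0l ?dot0r ?scaler0 ?subr0// ?[_ == a]eq_sym//.
  move=> k kn; exfalso.
  have /card_uniqP us : uniq [:: k; i; j; a].
    by move: kn; rewrite /= !inE !negb_or ij [i == a]eq_sym [j == a]eq_sym ai aj => /and3P[->
      -> ->].
  by have := max_card (mem [:: k; i; j; a]); rewrite us card_ord /= dE.
- have [a] : exists a, a \notin [:: i; j] by apply: notin_seq; rewrite card_ord /=; lia.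
  rewrite !inE negb_or => /andP[ai aj].
  have [b] : exists b, b \notin [:: a; i; j] by apply: notin_seq; rewrite card_ord /=; lia.
  rewrite !inE !negb_or => /and3P[ba bi bj].
  
  have uabij : uniq [:: a; b; i; j].
    by rewrite /= !inE !negb_or [a == b]eq_sym ba ai aj bi bj ij.
  pose e := vtx K b - vtx K a.
  have := h3 dE a b i j uabij; rewrite -/e => /angle_dot_ge0 xy.
  have gb : dot (gbary K b) e = 1 by rewrite dot_gbary_edge// eqxx (negbTE ba) subr0.
  have ge k : k != a -> k != b -> dot (gbary K k) e = 0.
    by move=> ka kb; rewrite dot_gbary_edge// (negbTE ka) (negbTE kb) subrr.
  have e0 : dot e e != 0.
    by apply/eqP => /dot_eq0 e0; move/eqP: gb; rewrite e0 dot0r eq_sym oner_eq0.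
  apply: (@dot_gbary_le0 _ _ _ uK i j a e _ _ _ _ ij _ _ erefl erefl _ _ _ _ _ xy);
    rewrite ?orth_dot// ?[_ == a]eq_sym// ?ge// ?[_ == a]eq_sym// ?[_ == b]eq_sym//.
  move=> k; rewrite !inE !negb_or => /and3P[ki kj ka].
  have [->|kb] := eqVneq k b; first by exists 1; rewrite scale1r.
  exfalso; have /card_uniqP us : uniq [:: k; a; b; i; j].
    by rewrite cons_uniq uabij andbT !inE !negb_or ka kb ki kj.
  by have := max_card (mem [:: k; a; b; i; j]); rewrite us card_ord /= dE.
Qed.

Section hmax.
Context {R : realType} {d : nat} (Om : set 'rV[R]_d) (Th : mesh R d).
Hypotheses (Hp : polyhedral_domain Om) (Hc : conforming Om Th) (d0 : (0 < d)%N).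

(** An edge is nonzero because it pairs to 1 with a barycentric gradient; boundedness of [Om] makes
    the supremum in [diam] a genuine upper bound. *)
Lemma hmax_gt0 : 0 < hmax Th.
Proof.
have [x Ox] := Om_neq0 Hp; have [eT _] := elt_mem Hc (subset_closure Ox).
set K := elt Th x in eT; have uK := meshU Hc eT.
pose j : 'I_d := Ordinal d0; pose v := vtx K (lift ord0 j) - vtx K ord0.
have v0 : 0 < enorm v.
  rewrite sqrtr_gt0 lt_neqAle dot_ge0 andbT eq_sym; apply/eqP => /dot_eq0 v0.
  have := dot_gbary_edge uK (lift ord0 j) (lift ord0 j) ord0.
  rewrite -/v v0 dot0r eqxx [lift ord0 j == ord0]eq_sym (negbTE (neq_lift _ _)) subr0 => /eqP.
  by rewrite eq_sym oner_eq0.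
have [M HM] := Om_bounded Hp.
have vd : enorm v <= diam K.
  apply: sup_upper_bound; last first.
    exists (vtx K (lift ord0 j), vtx K ord0) => //.
    by split; exact: simplex_vtx.
  split.
    exists (enorm v); exists (vtx K (lift ord0 j), vtx K ord0) => //.
    by split; exact: simplex_vtx.
  exists (Num.sqrt (d%:R * (M + M) ^+ 2)) => _ [[y z] [/= Ky Kz] <-].
  apply: ler_wsqrtr; apply: (le_trans (dot_norm_le _)); rewrite ler_wpM2l//.
  have yM := HM _ (simplex_closure Hc eT Ky); have zM := HM _ (simplex_closure Hc eT Kz).
  have yz : `|y - z| <= M + M by rewrite (le_trans (ler_normB _ _))// lerD.
  by rewrite ler_pXn2r ?nnegrE// (le_trans _ yz).
apply: (lt_le_trans v0); apply: (le_trans vd).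
by rewrite /hmax; exact: le_bigmax_seq.
Qed.

End hmax.

(** * One step of the scheme *)

Lemma convex_comb_lt {R : realFieldType} n (b t : 'I_n.+1 -> R) (M : R) :
  (forall i, 0 <= b i) -> \sum_i b i = 1 -> (forall i, t i < M) -> \sum_i b i * t i < M.
Proof.
move=> b0 b1 tM; rewrite -subr_gt0 -[X in X - _]mul1r -b1 mulr_suml -sumrB.
rewrite (eq_bigr (fun i => b i * (M - t i))); last by move=> i _; rewrite mulrBr.
have pos i : 0 <= b i * (M - t i) by rewrite mulr_ge0// subr_ge0 ltW.
rewrite lt_neqAle sumr_ge0 ?andbT//; apply/eqP => /esym/eqP.
rewrite psumr_eq0// => /allP H.
have : \sum_i b i = 0.
  apply: big1 => i _; have := H i (mem_index_enum i); rewrite /= mulf_eq0 => /orP[/eqP //|].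
  by rewrite subr_eq0 gt_eqF.
by rewrite b1 => /eqP; rewrite oner_eq0.
Qed.

Section step.
Context {R : realType} {d : nat} (Om : set 'rV[R]_d) (Th : mesh R d) (pot : potential R).
Hypotheses (Hp : polyhedral_domain Om) (Hc : conforming Om Th) (vp : valid_potential pot).
Variables (lam Dt : R).
Hypothesis Dt0 : 0 < Dt.
Implicit Types f g p phi mu : 'rV[R]_d -> R.

Let oOm : open Om := Om_open Hp.
Let Omfin := Om_fin Hp.
Let inc x : Om x -> closure Om x. Proof. exact: subset_closure. Qed.

Local Notation nv := (nv Th).
Local Notation w := (mass_w Om Th).
Local Notation A := (stiff Om Th).
Local Notation B := (trim Om Th).
Local Notation solution := (step_solution pot Om Th lam Dt).

Definition psi1 f := fun x => derive1 (Psi1 pot) (f x).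
Definition psi2 f := fun x => derive1 (Psi2 pot) (f x).

Definition nsolves p (phi mu : 'rV[R]_(nnode Th)) gam :=
  solves w A (B p) Dt lam (nv p) (wd w (nv (psi2 p))) gam phi mu.

Lemma node_closure (j : 'I_(nnode Th)) : closure Om (node j).
Proof.
have [K [i [KT ->]]] := node_vtx j.
exact: simplex_closure KT (simplex_vtx i (meshU Hc KT)).
Qed.

Lemma triE_Sh p f g : in_Sh Om Th g ->
  intg Om (fun x => dot (grad Th f x) (grad Th p x) * g x) = dot (nv f *m B p) (nv g).
Proof.
move=> hg; rewrite -triE//; apply: eq_intg => x Ox.
by rewrite (Sh_pih Hc hg (inc Ox)).
Qed.

(** Every nodal vector is that of a test function, the interpolant of its extension, so the
    variational identities become vector identities. *)
Lemma step_solution_solves p phi mu : solution p phi mu ->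
  (forall j : 'I_(nnode Th), admissible pot (phi (node j))) /\
  nsolves p (nv phi) (nv mu) (nv (psi1 phi)).
Proof.
move=> [hphi hmu adm eqs]; split.
  by move=> j; have [K [i [KT ->]]] := node_vtx j; exact: adm.
have test (v : 'rV[R]_(nnode Th)) : in_Sh Om Th (pih Th (ext v)) by exact: pih_Sh.
have nvt v : nv (pih Th (ext v)) = v by rewrite (nv_pih Hc) nv_ext.
split.
  apply: dot_nondeg => v; have [e1 _] := eqs _ _ (test v) (test v).
  move: e1; rewrite lumpE// gradipE// nvt.
  have -> : nv (fun x => (phi x - p x) / Dt) = Dt^-1 *: (nv phi - nv p).
    by apply/rowP => j; rewrite !mxE mulrC.
  rewrite wdZ dotZl dotDl dotZl => e1.
  have := congr1 (fun t => Dt * t) e1; rewrite mulrDr mulrA divff ?gt_eqF// mul1r mulr0.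
  exact.
apply/eqP; rewrite -subr_eq0; apply/eqP; apply: dot_nondeg => v.
have [_ e2] := eqs _ _ (test v) (test v).
move: e2; rewrite triE_Sh ?test// !lumpE// gradipE// !nvt.
have -> : nv (fun x => derive1 (Psi1 pot) (phi x) + derive1 (Psi2 pot) (p x)) =
    nv (psi1 phi) + nv (psi2 p) by apply/rowP => j; rewrite !mxE.
rewrite wdD dotBl !dotDl dotZl => ->; ring.
Qed.

Lemma solves_step_solution p (phi mu : 'rV[R]_(nnode Th)) :
  in_Sh Om Th p ->
  (forall j, admissible pot (phi 0 j)) ->
  nsolves p phi mu (\row_j derive1 (Psi1 pot) (phi 0 j)) ->
  solution p (pih Th (ext phi)) (pih Th (ext mu)).
Proof.
move=> hp adm [e1 e2].
have nvt v : nv (pih Th (ext v)) = v by rewrite (nv_pih Hc) nv_ext.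
have vtxE (v : 'rV[R]_(nnode Th)) K i : K \in Th -> exists j, pih Th (ext v) (vtx K i) = v 0 j.
  move=> KT; have [j ->] := vtx_node i KT; exists j.
  by have /rowP/(_ j) := nvt v; rewrite mxE.
split; [exact: pih_Sh|exact: pih_Sh| |].
  by move=> K i KT; have [j ->] := vtxE phi K i KT; exact: adm.
move=> chi xi hchi hxi; split.
  rewrite lumpE// gradipE// nvt.
  have -> : nv (fun x => (pih Th (ext phi) x - p x) / Dt) = Dt^-1 *: (phi - nv p).
    by rewrite -{2}(nvt phi); apply/rowP => j; rewrite !mxE mulrC.
  have /(congr1 (fun u => dot (Dt^-1 *: u) (nv chi))) := e1.
  by rewrite scalerDr scalerA mulVf ?gt_eqF// scale1r scaler0 dot0l dotDl wdZ.
rewrite triE_Sh// !lumpE// gradipE// !nvt e2.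
have -> : nv (fun x => derive1 (Psi1 pot) (pih Th (ext phi) x) + derive1 (Psi2 pot) (p x)) =
    (\row_j derive1 (Psi1 pot) (phi 0 j)) + nv (psi2 p).
  by rewrite -[in RHS](nvt phi); apply/rowP => j; rewrite !mxE.
by rewrite wdD !dotDl dotZl; ring.
Qed.

Section contraction.
Variables (p : 'rV[R]_d -> R) (F : R).
Hypotheses (hp : in_Sh Om Th p) (F0 : 0 < F)
  (hF : F * lpnorm Om +oo%E (fun x => enorm (grad Th p x)) ^+ 2 <= 1)
  (hDt : lam != 0 -> Dt < lam ^- 4 * F ^+ 2)
  (hpdom : forall x, closure Om x -> dom_Psi pot (p x)).

Lemma stepL20 : 0 <= F^-1. Proof. by rewrite invr_ge0 ltW. Qed.

Lemma step_small : lam ^+ 4 * F^-1 ^+ 2 * Dt < 1.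
Proof.
have [->|l0] := eqVneq lam 0; first by rewrite expr0n/= !mul0r.
have l4 : 0 < lam ^+ 4 by rewrite lt_neqAle eq_sym expf_neq0//= exprn_even_ge0.
have := hDt l0; rewrite -(ltr_pM2l l4) mulrA divff ?gt_eqF// mul1r => h.
rewrite mulrAC exprVn ltr_pdivrMr ?exprn_gt0// mul1r.
exact: h.
Qed.

Lemma stepAB u v : dot (u *m B p) v ^+ 2 <= F^-1 * dot (u *m A) u * dot (wd w v) v.
Proof.
apply: trim_le => // K KT; apply: (le_trans (vgrad_le_lpnormy Hp Hc p KT)).
by rewrite -(ler_pM2l F0) divff ?gt_eqF.
Qed.

Lemma step_unique phi mu phi' mu' : solution p phi mu -> solution p phi' mu' ->
  {in closure Om, phi' =1 phi} /\ {in closure Om, mu' =1 mu}.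
Proof.
move=> S S'; have [adm sol] := step_solution_solves S.
have [adm' sol'] := step_solution_solves S'.
have E : nv phi' = nv phi.
  apply: (solves_inj (mass_w_gt0 Hp Hc) (stiff_sym Om Th) (stiff_ge0 Hp Hc) Dt0 step_small
    stepAB sol' sol) => j.
  by rewrite !mxE; exact: derive1_Psi1_mono.
have E1 : nv (psi1 phi') = nv (psi1 phi).
  by apply/rowP => j; rewrite !mxE /psi1; have /rowP/(_ j) := E; rewrite !mxE => ->.
have Em : nv mu' = nv mu.
  move: sol'; rewrite /nsolves E E1 => sol'.
  exact: (solves_inj_mu (mass_w_gt0 Hp Hc) sol' sol).
have [h1 h2 _ _] := S; have [h1' h2' _ _] := S'.
split=> x; rewrite inE => cx.
  by rewrite (Sh_pih Hc h1 cx) (Sh_pih Hc h1' cx); apply: (nodeq_pih Hc) => //; apply/nodeqP.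
by rewrite (Sh_pih Hc h2 cx) (Sh_pih Hc h2' cx); apply: (nodeq_pih Hc) => //; apply/nodeqP.
Qed.

Lemma step_exists : (singular pot -> -1 < mean Om p < 1) ->
  exists phi mu, solution p phi mu.
Proof.
move=> hm.
suff [phi [mu [adm sol]]] : exists phi mu : 'rV[R]_(nnode Th),
    (forall j, admissible pot (phi 0 j)) /\
    nsolves p phi mu (\row_j derive1 (Psi1 pot) (phi 0 j)).
  by exists (pih Th (ext phi)), (pih Th (ext mu)); exact: solves_step_solution.
have W0 := mass_w_gt0 Hp Hc; have N0 := nnode_gt0 Hp Hc.
have As := stiff_sym Om Th; have A0 := stiff_ge0 Hp Hc.
have Ak := stiff_ker Hp Hc; have A1 := stiff_one Hp Hc.
have sm := step_small; have ab := stepAB.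
have [E|[theta [theta0 E]]] :
    pot = Regular \/ exists theta theta0, pot = Singular theta theta0.
- by case: (pot) => [|th th0]; [left|right; exists th, th0].
- have cube_mono s t : s <= t -> (s ^+ 3 <= t ^+ 3 :> R).
    move=> st; rewrite -subr_ge0.
    rewrite (_ : _ - _ = (t - s) * ((t + s) ^+ 2 + t ^+ 2 + s ^+ 2) / 2); last by field.
    by rewrite divr_ge0// mulr_ge0 ?subr_ge0// !addr_ge0// sqr_ge0.
  have [phi [mu sol]] := solves_exists N0 W0 As A0 Ak A1 Dt0 sm ab (nv p)
    (wd w (nv (psi2 p))) cube_mono loclip_cube.
  exists phi, mu; split; first by move=> j; rewrite E; exact: admissible_regular.
  suff -> : \row_j derive1 (Psi1 pot) (phi 0 j) = \row_j phi 0 j ^+ 3 by [].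
  by apply/rowP => j; rewrite !mxE E derive1_Psi1_regular.
have th : 0 < theta by move: vp; rewrite E => /andP[].
have {}hm : -1 < dot w (nv p) / mass w < 1.
  by rewrite -meanE//; apply: hm; rewrite E.
have [phi [mu [bd sol]]] := solves_exists_singular N0 W0 As A0 Ak A1 Dt0 sm ab
  (wd w (nv (psi2 p))) th hm.
exists phi, mu; split; first by move=> j; rewrite E; apply/admissible_singular.
suff -> : \row_j derive1 (Psi1 pot) (phi 0 j) = \row_j ell theta (phi 0 j) by [].
by apply/rowP => j; rewrite !mxE E derive1_Psi1_singular.
Qed.

Lemma l2norm_sub_le f g : in_Sh Om Th f -> in_Sh Om Th g ->
  l2norm Om (fun x => f x - g x) ^+ 2 <= dot (wd w (nv f - nv g)) (nv f - nv g).
Proof.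
move=> hf hg; have -> : nv f - nv g = nv (fun x => f x - g x) by apply/rowP => j; rewrite !mxE.
apply: le_trans (l2norm_pih_le Hp Hc _); rewrite le_eqVlt; apply/orP; left; apply/eqP.
congr (_ ^+ 2); apply: eq_l2norm => x Ox.
rewrite (Sh_pih Hc hf (inc Ox)) (Sh_pih Hc hg (inc Ox)).
rewrite [pih _ f x](affE (elt Th x)) [pih _ g x](affE (elt Th x)) [RHS](affE (elt Th x)).
by rewrite -sumrB; apply: eq_bigr => i _; rewrite mulrBr.
Qed.

(** [solves_stable] controls the increment in the lumped norm, which dominates the exact L^2 norm;
    [Psi_diff_le], summed over the nodes with the masses, turns the derivative terms into the energy
    difference. *)
Lemma step_stable phi mu : solution p phi mu -> stability_estimate pot Om Th lam Dt F p phi mu.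
Proof.
move=> S; have [adm sol] := step_solution_solves S; have [hphi _ _ _] := S.
have := solves_stable (mass_w_gt0 Hp Hc) (stiff_sym Om Th) (stiff_ge0 Hp Hc) Dt0 stepL20
  stepAB sol.
have gE f : gradnorm Om Th f ^+ 2 = dot (nv f *m A) (nv f).
  by rewrite gradnormE; exact: gradipE.
rewrite /stability_estimate.
move: (gE mu) (gE phi) (gE p); move: (gradnorm _ _ mu) (gradnorm _ _ phi) (gradnorm _ _ p).
move=> g1 g2 g3 -> -> ->; rewrite !lumpE//.
have := l2norm_sub_le hphi hp.
set E := l2norm _ _ ^+ 2; set E' := dot (wd w _) _ => EE.
have s0 : 0 <= (2 * Num.sqrt Dt)^-1 by rewrite invr_ge0 mulr_ge0// sqrtr_ge0.
have := ler_wpM2l s0 EE.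
have -> : nv (cst 1) = const_mx 1 by apply/rowP => j; rewrite !mxE.
have : dot (wd w (nv (fun x => Psi pot (phi x)))) (const_mx 1) -
    dot (wd w (nv (fun x => Psi pot (p x)))) (const_mx 1) <=
    dot (wd w (nv (psi1 phi))) (nv phi - nv p) + dot (wd w (nv (psi2 p))) (nv phi - nv p).
  rewrite !dot_wdE -sumrB -big_split/=; apply: ler_sum => j _.
  rewrite -mulrBr -mulrDr ler_pM2l ?(mass_w_gt0 Hp Hc)// !mxE !mulr1 -mulrDl.
  apply: Psi_diff_le => //; apply: hpdom; exact: node_closure.
lra.
Qed.

Lemma step_bounds phi mu : solution p phi mu -> singular pot ->
  forall x, closure Om x -> -1 < phi x < 1.
Proof.
move=> S sp x cx; have [hphi _ adm _] := S.
have {}adm K i : K \in Th -> -1 < phi (vtx K i) < 1.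
  move=> KT; have := adm K i KT.
  by move: vp sp; case: (pot) => // th th0 /andP[th1 _] _ /(admissible_singular _ _ th1).
have [eT ex] := elt_mem Hc cx; rewrite (Sh_pih Hc hphi cx) [pih _ _ _](affE (elt Th x)).
have b0 := (simplexP x (meshU Hc eT)).1 ex.
apply/andP; split; last first.
  apply: convex_comb_lt (bary_sum _ _) _ => // i.
  by have /andP[] := adm _ i eT.
rewrite -ltrN2 opprK -sumrN (eq_bigr (fun i => bary (elt Th x) x i * - phi (vtx (elt Th x) i))).
  apply: convex_comb_lt (bary_sum _ _) _ => // i.
  by have /andP[+ _] := adm _ i eT; rewrite ltrNl.
by move=> i _; rewrite mulrN.
Qed.

End contraction.

End step.

(** * Inverse inequalities and the discrete Laplacian *)

Section constants.
Context {R : realType} {d : nat} (Om : set 'rV[R]_d) (Th : mesh R d) (pot : potential R).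
Hypotheses (Hp : polyhedral_domain Om) (Hc : conforming Om Th) (d0 : (0 < d)%N).
Variables (Cp Cbar : R).
Hypotheses (Cp0 : 0 < Cp) (Cbar0 : 0 < Cbar) (inv : inverse_inequality Om Th Cbar).
Implicit Types f g p phi mu : 'rV[R]_d -> R.

Let oOm : open Om := Om_open Hp.
Let Omfin := Om_fin Hp.
Let inc x : Om x -> closure Om x. Proof. exact: subset_closure. Qed.
Local Notation h := (hmax Th).
Let h0 : 0 < h := hmax_gt0 Hp Hc d0.

Let c : R := Num.min (4 * Num.sqrt 4 / (3 * Num.sqrt 3 * Num.sqrt (Cp ^+ 2 + 1))) 1.

Let c_gt0 : 0 < c.
Proof.
rewrite lt_min ltr01 andbT divr_gt0// ?mulr_gt0// ?sqrtr_gt0//.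
by rewrite ltr_pwDr// sqr_ge0.
Qed.

Let c_le1 : c <= 1. Proof. by rewrite ge_min lexx orbT. Qed.

(** First of three instances of the inverse inequality: this one yields the singular form of [Fh],
    the passage from L^2 to the sup norm of gradients yields the regular form, and the L^2 one
    bounds the discrete Laplacian. *)
Lemma grad_lpnormy_le f : in_Sh Om Th f ->
  lpnorm Om +oo%E (fun x => enorm (grad Th f x)) <= Cbar * h^-1 * lpnorm Om +oo%E f.
Proof.
move=> hf; have := @inv 0%N 1%N +oo%E +oo%E isT (leey _) (lexx _) f hf.
rewrite /seminorm /= /inve/= !mulr0 !subr0 addr0 sub0r.
by rewrite powRN (powRr1 (ltW h0)).
Qed.

Lemma grad_lpnormy2_le f : in_Sh Om Th f ->
  lpnorm Om +oo%E (fun x => enorm (grad Th f x)) ^+ 2 <=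
    Cbar ^+ 2 * (h ^+ d)^-1 * gradnorm Om Th f ^+ 2.
Proof.
move=> hf; have := @inv 1%N 1%N +oo%E 2%:E isT _ (leey _) f hf.
rewrite lee_fin ler1n => /(_ isT).
rewrite /seminorm lpnorm2_grad// /inve/= pnatr_eq0/= subrr mulr0 add0r sub0r powRN => le.
have G0 : 0 <= gradnorm Om Th f by exact: sqrtr_ge0.
have e : (h `^ (d%:R * 2^-1)) ^+ 2 = h ^+ d.
  by rewrite -powR_mulrn ?powR_ge0// -powRrM -mulrA mulVf// mulr1 powR_mulrn// ltW.
rewrite -e -exprVn -!exprMn ler_pXn2r// ?nnegrE ?lpnorm_ge0//.
by rewrite mulr_ge0// mulr_ge0 ?(ltW Cbar0)// invr_ge0 powR_ge0.
Qed.

Lemma gradnorm_le f : in_Sh Om Th f ->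
  gradnorm Om Th f <= Cbar * h^-1 * l2norm Om f.
Proof.
move=> hf; have := @inv 0%N 1%N 2%:E 2%:E isT _ (lexx _) f hf.
rewrite lee_fin ler1n => /(_ isT).
rewrite /seminorm lpnorm2_grad// lpnorm2//; last exact: (bmf_Sh Hp Hc).
rewrite addrK sub0r.
by rewrite powRN (powRr1 (ltW h0)).
Qed.

Lemma Fh_gt0 N (C : nat -> R) : (0 < N)%N -> (forall k, (k < N)%N -> 0 < C k) ->
  0 < Fh pot Th C N Cp Cbar.
Proof.
move=> N0 C0; rewrite /Fh -/c mulr_gt0//; case: (singular pot).
  by rewrite divr_gt0// exprn_gt0.
have pos k : (k < N)%N -> 0 < hmax Th ^+ d / (Cbar ^+ 2 * C k ^+ 2).
  by move=> kN; rewrite divr_gt0 ?mulr_gt0// ?exprn_gt0// C0.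
rewrite big_nat; elim/big_ind : _ => [|x y x0 y0|k /andP[k1 kN]]; first exact: pos.
  by rewrite lt_min x0.
by apply: pos; lia.
Qed.

(** The origin of the two forms of [Fh]: each is at most the reciprocal of a bound on |grad p|^2,
    obtained from |p| <= 1 in the singular case and from the H^1 bound in the regular case. *)
Lemma Fh_grad_le N (C : nat -> R) n p : (1 <= n <= N)%N ->
  (forall k, (k < N)%N -> 0 < C k) -> in_Sh Om Th p ->
  h1norm Om Th p <= C n.-1 ->
  (singular pot -> forall x, closure Om x -> -1 <= p x <= 1) ->
  Fh pot Th C N Cp Cbar * lpnorm Om +oo%E (fun x => enorm (grad Th p x)) ^+ 2 <= 1.
Proof.
move=> /andP[n1 nN] C0 hp hC hs; rewrite /Fh -/c; case: ifPn => sp.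
  have p1 : lpnorm Om +oo%E p <= 1.
    apply: lpnormy_le => // x Ox; rewrite ler_norml; exact: hs (inc Ox).
  have k0 : 0 <= Cbar * h^-1 by rewrite divr_ge0 ?(ltW Cbar0) ?(ltW h0).
  have G1 : lpnorm Om +oo%E (fun x => enorm (grad Th p x)) <= Cbar * h^-1.
    by apply: (le_trans (grad_lpnormy_le hp)); rewrite ler_piMr.
  have G2 : lpnorm Om +oo%E (fun x => enorm (grad Th p x)) ^+ 2 <= (Cbar * h^-1) ^+ 2.
    by rewrite ler_pXn2r ?nnegrE ?lpnorm_ge0.
  have hC0 : 0 < h ^+ 2 / Cbar ^+ 2 by rewrite divr_gt0// exprn_gt0.
  apply: (le_trans (ler_wpM2l (mulr_ge0 (ltW c_gt0) (ltW hC0)) G2)).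
  have E (q a b : R) : a != 0 -> b != 0 -> q * (a ^+ 2 / b ^+ 2) * (b * a^-1) ^+ 2 = q.
    by move=> a0 b0; field; rewrite a0 b0.
  by rewrite E ?gt_eqF.
set M := \big[_/_]_(_ <= _ < _) _.
have Cn : 0 < C n.-1 by apply: C0; rewrite prednK.
have MM : M <= h ^+ d / (Cbar ^+ 2 * C n.-1 ^+ 2).
  by apply: (ge_bigmin_seq _ n predT (fun k => h ^+ d / (Cbar ^+ 2 * C k.-1 ^+ 2))) => //;
    rewrite mem_index_iota n1 ltnS nN.
have gC : gradnorm Om Th p ^+ 2 <= C n.-1 ^+ 2.
  rewrite ler_pXn2r// ?nnegrE ?sqrtr_ge0 ?(ltW Cn)//.
  apply: le_trans hC; rewrite /h1norm -[leLHS]ger0_norm ?sqrtr_ge0// -sqrtr_sqr.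
  by rewrite ler_wsqrtr// lerDr sqr_ge0.
have M0 : 0 < M.
  have pos k : (k < N)%N -> 0 < h ^+ d / (Cbar ^+ 2 * C k ^+ 2).
    by move=> kN; apply: divr_gt0; [exact: exprn_gt0|apply: mulr_gt0; apply: exprn_gt0 => //;
      exact: C0].
  rewrite /M big_nat; elim/big_ind : _ => [|x y x0 y0|k /andP[k1 kN]].
  - exact: pos (leq_trans n1 nN).
  - by rewrite lt_min x0.
  - by apply: pos; rewrite prednK.
have Q0 : 0 <= Cbar ^+ 2 * (h ^+ d)^-1.
  by rewrite mulr_ge0 ?sqr_ge0// invr_ge0 exprn_ge0// ltW.
apply: (le_trans (ler_wpM2l (mulr_ge0 (ltW c_gt0) (ltW M0)) (grad_lpnormy2_le hp))).
apply: (@le_trans _ _ (1 * (h ^+ d / (Cbar ^+ 2 * C n.-1 ^+ 2)) * (Cbar ^+ 2 * (h ^+ d)^-1 * C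
  n.-1 ^+ 2))).
  apply: ler_pM.
  - by rewrite mulr_ge0// ltW.
  - by rewrite mulr_ge0// sqr_ge0.
  - by apply: ler_pM => //; exact: ltW.
  - by rewrite ler_wpM2l.
have E (a b q : R) : a != 0 -> b != 0 -> q != 0 ->
    1 * (a / (b ^+ 2 * q ^+ 2)) * (b ^+ 2 * a^-1 * q ^+ 2) = 1.
  by move=> a0 b0 q0; field; rewrite a0 b0 q0.
by rewrite E ?gt_eqF// exprn_gt0.
Qed.

Local Notation nv := (nv Th).
Local Notation w := (mass_w Om Th).
Local Notation A := (stiff Om Th).

(** [dlap] is picked by [xget], so a witness is needed: solve the diagonal mass system for - A f.
    Its mean vanishes because [A] annihilates constants. *)
Lemma dlapP f : [/\ in_Sh Om Th (dlap Om Th f), intg Om (dlap Om Th f) = 0 &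
  forall chi, in_Sh Om Th chi -> - lump Om Th (dlap Om Th f) chi = gradip Om Th f chi].
Proof.
have W0 := mass_w_gt0 Hp Hc.
pose v : 'rV[R]_(nnode Th) := \row_j (- (nv f *m A) 0 j / w 0 j).
have wv : wd w v = - (nv f *m A).
  by apply/rowP => j; rewrite wdE [v 0 j]mxE divfK ?gt_eqF// !mxE.
have nvt : nv (pih Th (ext v)) = v by rewrite (nv_pih Hc) nv_ext.
rewrite /dlap; case: xgetP => [g -> //|/(_ (pih Th (ext v))) /= []].
split; first exact: pih_Sh.
  rewrite intg_pih// nv_ext -dot_wd_one wv dotNl dotA_one ?oppr0//.
  - exact: stiff_sym.
  - exact: stiff_one Hp Hc.
by move=> chi _; rewrite lumpE// gradipE// nvt wv dotNl opprK.
Qed.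

Lemma wd_dlap f : wd w (nv (dlap Om Th f)) = - (nv f *m A).
Proof.
have [_ _ H] := dlapP f; apply/eqP; rewrite -addr_eq0; apply/eqP; apply: dot_nondeg => v.
have := H _ (pih_Sh Hc (ext v)); rewrite lumpE// gradipE// (nv_pih Hc) nv_ext => h1.
by rewrite dotDl -h1 addrN.
Qed.

Lemma l2norm_le1 f : (forall x, closure Om x -> -1 <= f x <= 1) -> in_Sh Om Th f ->
  l2norm Om f ^+ 2 <= intg Om (fun=> 1).
Proof.
move=> f1 hf; rewrite l2normE//; apply: le_intg => //.
- by apply: bmfX; exact: (bmf_Sh Hp Hc).
- exact: bmf_cst.
- by move=> x /inc /f1; rewrite -ler_norml => h1; rewrite -real_normK ?num_real// exprn_ile1.
Qed.

(** Testing the Laplacian L of f with itself gives |L|^2 <= |grad f| |grad L|, and the inverse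
    inequality applies to both factors. *)
Lemma dlap_inverse f : in_Sh Om Th f ->
  l2norm Om (dlap Om Th f) <= Cbar ^+ 2 / h ^+ 2 * l2norm Om f.
Proof.
move=> hf; have [hL _ HL] := dlapP f; set L := dlap Om Th f in hL HL *.
have a0 : 0 <= l2norm Om L by exact: sqrtr_ge0.
have f0 : 0 <= l2norm Om f by exact: sqrtr_ge0.
have k0 : 0 <= Cbar ^+ 2 / h ^+ 2 by rewrite divr_ge0// sqr_ge0.
have [->|an0] := eqVneq (l2norm Om L) 0; first exact: mulr_ge0.
have ap : 0 < l2norm Om L by rewrite lt_neqAle eq_sym an0.
rewrite -(ler_pM2r ap) -expr2; apply: (le_trans (l2norm_Sh_le Hp Hc hL)).
have -> : dot (wd w (nv L)) (nv L) = - gradip Om Th f L.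
  by rewrite -HL// opprK lumpE.
apply: (le_trans (ler_norm _)); rewrite normrN.
apply: (le_trans (gradip_le Hp Hc f L)).
have -> : Cbar ^+ 2 / h ^+ 2 * l2norm Om f * l2norm Om L =
    (Cbar * h^-1 * l2norm Om f) * (Cbar * h^-1 * l2norm Om L).
  by field; rewrite gt_eqF.
by apply: ler_pM; rewrite ?sqrtr_ge0 ?gradnorm_le.
Qed.

End constants.

(** Young's inequality x^(3/2) y^(1/2) <= 3/4 x^2 + 1/4 y^2; x and y will be the norms of the new
    and old discrete Laplacians. *)
Lemma sqrt_mul_le {R : realType} (C x y : R) : 0 <= x -> 0 <= y ->
  C * Num.sqrt x * (C * Num.sqrt y) * x <= C ^+ 2 * (3 / 4 * x ^+ 2 + 4^-1 * y ^+ 2).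
Proof.
move=> x0 y0.
have -> : C * Num.sqrt x * (C * Num.sqrt y) * x = C ^+ 2 * (x * (Num.sqrt x * Num.sqrt y))
  by ring.
apply: ler_wpM2l; first exact: sqr_ge0.
have xy : Num.sqrt x * Num.sqrt y <= (x + y) / 2.
  have := sqr_ge0 (Num.sqrt x - Num.sqrt y).
  by rewrite sqrrB !sqr_sqrtr//; lra.
apply: (le_trans (ler_wpM2l x0 xy)).
by have := sqr_ge0 (x - y); rewrite !expr2; nra.
Qed.

Lemma wd_sub_ge {R : realType} n (w x y : 'rV[R]_n) : (forall i, 0 < w 0 i) ->
  2^-1 * (dot (wd w x) x - dot (wd w y) y) <= dot (wd w (x - y)) x.
Proof.
move=> w0; have := dot_wd_ge0 w0 (x - y).
by rewrite !wdB !dotDZ (dot_wdC _ y x); lra.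
Qed.

(** Of the coefficient 1 of [D], (1 - q)/2 pays for the explicit potential and 3q/4 for the lambda
    term. The rest is (1 - q)/2 + q/4: the first part is kept, the second pairs with - q/4 [b2] to
    telescope. *)
Lemma laplacian_step_arith {R : realType} (Dt q a2 b2 D G P t K T U : R) :
  0 < Dt -> 0 <= 1 - q -> 0 <= q -> 0 <= G -> a2 <= D ->
  - P <= (1 - q) / 2 * D + K -> t <= q * (3 / 4 * a2 + 4^-1 * b2) ->
  T = Dt * (- D - G - P + t) -> U <= T ->
  U + Dt * ((1 - q) / 2) * a2 + Dt * (q / 4) * (a2 - b2) <= Dt * K.
Proof.
move=> Dt0 oq q0 G0 aD HP Ht HT HU.
have hD : (1 - q) / 2 * a2 <= (1 - q) / 2 * D by apply: ler_wpM2l => //; lra.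
have hD2 : q * a2 <= q * D by exact: ler_wpM2l.
have main : - D - G - P + t <= K - (1 - q) / 2 * a2 - q / 4 * (a2 - b2) by lra.
by have := ler_wpM2l (ltW Dt0) main; rewrite -HT; lra.
Qed.

(** * One step of the estimate of the discrete Laplacian *)

Section laplacian_estimate.
Context {R : realType} {d : nat} (Om : set 'rV[R]_d) (Th : mesh R d).
Hypotheses (Hp : polyhedral_domain Om) (Hc : conforming Om Th) (d13 : (1 <= d <= 3)%N)
  (aT : acute Th).
Variables (theta theta0 lam Dt Cg : R).
Local Notation pot := (Singular theta theta0).
Hypotheses (vp : valid_potential pot) (Dt0 : 0 < Dt) (Cg0 : 0 < Cg)
  (GN : gagliardo_nirenberg Om Th Cg) (q1 : `|lam| * Cg ^+ 2 < 1).
Implicit Types f g p phi mu : 'rV[R]_d -> R.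

Let oOm : open Om := Om_open Hp.
Let Omfin := Om_fin Hp.
Let inc x : Om x -> closure Om x. Proof. exact: subset_closure. Qed.

Local Notation nv := (nv Th).
Local Notation w := (mass_w Om Th).
Local Notation A := (stiff Om Th).
Local Notation B := (trim Om Th).
Local Notation a f := (l2norm Om (dlap Om Th f)).
Local Notation q := (`|lam| * Cg ^+ 2).
Local Notation m1 := (intg Om (fun=> 1)).

Let a_ge0 f : 0 <= a f. Proof. exact: sqrtr_ge0. Qed.

(** Psi_1' is monotone, so nodal differences of [phi] and of Psi_1'(phi) have the same sign; on an
    acute element this gives a pointwise nonnegative product of gradients. *)
Lemma gradip_psi1_ge0 phi : (forall K i, K \in Th -> admissible pot (phi (vtx K i))) ->
  0 <= gradip Om Th phi (psi1 pot phi).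
Proof.
move=> adm; apply: intg_ge0 => // x Ox; have [eT _] := elt_mem Hc (inc Ox).
apply: (vgrad_monotone_ge0 (meshU Hc eT)) => i j.
  exact: acute_gbary d13 aT eT (meshU Hc eT) _ _.
rewrite mulrC; exact: (derive1_Psi1_mono vp (adm _ i eT) (adm _ j eT)).
Qed.

Lemma nodal_le_measure p : (forall x, closure Om x -> -1 <= p x <= 1) ->
  dot (wd w (nv p)) (nv p) <= m1.
Proof.
move=> p1; rewrite -(mass_mass Hp Hc) /mass dot_wdE; apply: ler_sum => j _.
rewrite ler_wpM2l ?(ltW (mass_w_gt0 Hp Hc j))// [nv p 0 j]mxE mxE -expr2.
have := p1 _ (node_closure Hc (j := j)); rewrite -ler_norml => h.
by rewrite -real_normK ?num_real// exprn_ile1.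
Qed.

Lemma lpnorm4_grad_le f : in_Sh Om Th f -> (forall x, closure Om x -> -1 <= f x <= 1) ->
  lpnorm Om 4%:E (fun x => enorm (grad Th f x)) <= Cg * Num.sqrt (a f).
Proof.
move=> hf f1; apply: (le_trans (GN hf)); rewrite ler_piMr ?mulr_ge0 ?sqrtr_ge0 ?(ltW Cg0)//.
rewrite -sqrtr1 ler_wsqrtr//; apply: lpnormy_le => // x /inc /f1.
by rewrite ler_norml.
Qed.

Lemma laplacian_step p phi mu : in_Sh Om Th p ->
  (forall x, closure Om x -> -1 <= p x <= 1) ->
  step_solution pot Om Th lam Dt p phi mu ->
  2^-1 * (dot (wd w (nv phi)) (nv phi) - dot (wd w (nv p)) (nv p)) +
  Dt * ((1 - q) / 2) * a phi ^+ 2 + Dt * (q / 4) * (a phi ^+ 2 - a p ^+ 2) <=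
  Dt * (theta0 ^+ 2 * m1 / (2 * (1 - q))).
Proof.
move=> hp p1 S; have [hphi _ adm0 _] := S.
have [_ [e1 e2]] := step_solution_solves Hp Hc Dt0 S.
have phi1 x : closure Om x -> -1 <= phi x <= 1.
  by move=> cx; have /andP[/ltW -> /ltW ->] := step_bounds Hc vp S isT cx.
set L := nv (dlap Om Th phi); have wL : wd w L = - (nv phi *m A) by exact: wd_dlap.
have As := stiff_sym Om Th; have A0 := stiff_ge0 Hp Hc.
pose D := dot (wd w L) L; pose P := dot (wd w (nv p)) L.
pose t := dot (nv phi *m B p) L; pose G := dot (nv phi *m A) (nv (psi1 pot phi)).
have oq : 0 < 1 - q by rewrite subr_gt0.
have G0 : 0 <= G by rewrite /G -gradipE//; exact: gradip_psi1_ge0.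
have e1' : wd w (nv phi - nv p) = - (Dt *: (nv mu *m A)).
  by apply/eqP; rewrite -addr_eq0 e1.
(* The first equation is tested with phi; symmetry of [A] turns the mu term into a lumped product of
   mu with the Laplacian, which the second equation evaluates. *)
have HT : dot (wd w (nv phi - nv p)) (nv phi) = Dt * (- D - G - theta0 * P + lam * t).
  rewrite e1' dotNl dotZl (dot_sym As) -mulrN -dotNl -wL dot_wdC e2 !dotDl dotZl.
  rewrite -[nv phi *m A]opprK -wL dotNl -/D -/t.
  have -> : dot (wd w (nv (psi1 pot phi))) L = - G by rewrite dot_wdC wL dotNl.
  have -> : dot (wd w (nv (psi2 pot p))) L = - (theta0 * P).
    rewrite (_ : nv (psi2 pot p) = - theta0 *: nv p) ?wdZ ?dotZl ?mulNr//.
    by apply/rowP => j; rewrite !mxE /psi2 derive1_Psi2 mulNr.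
  by [].
have D0 : 0 <= D by exact: dot_wd_ge0 (mass_w_gt0 Hp Hc) _.
have [hL _ _] := dlapP Hp Hc phi.
have aD : a phi ^+ 2 <= D by exact: l2norm_Sh_le Hp Hc _ hL.
pose u := dot (wd w (nv p)) (nv p).
have u0 : 0 <= u by exact: dot_wd_ge0 (mass_w_gt0 Hp Hc) _.
have um : u <= m1 by exact: nodal_le_measure.
have PP : P ^+ 2 <= u * D.
  apply: (@psd_cauchy_schwarz _ _ (diag_mx w)); first exact: tr_diag_mx.
  by move=> x; exact: dot_wd_ge0 (mass_w_gt0 Hp Hc) _.
have HP : - (theta0 * P) <= (1 - q) / 2 * D + theta0 ^+ 2 * m1 / (2 * (1 - q)).
  apply: (le_trans (ler_norm _)); rewrite normrN; apply: amgm_le.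
  - by rewrite mulr_ge0// divr_ge0// ltW.
  - by rewrite divr_ge0 ?(mulr_ge0 (sqr_ge0 _) (le_trans u0 um))// mulr_ge0// ltW.
  - rewrite exprMn (_ : 4 * _ * _ = theta0 ^+ 2 * (m1 * D)); last by field; rewrite gt_eqF.
    by rewrite ler_wpM2l ?sqr_ge0// (le_trans PP)// ler_wpM2r.
have Ht : lam * t <= q * (3 / 4 * a phi ^+ 2 + 4^-1 * a p ^+ 2).
  apply: (le_trans (ler_norm _)); rewrite normrM -mulrA; apply: ler_wpM2l => //.
  rewrite /t -triE_Sh// ; apply: (le_trans (intg_dot_grad_le Hp Hc _ _ (bmf_Sh Hp Hc hL))).
  have h1 := lpnorm4_grad_le hphi phi1; have h2 := lpnorm4_grad_le hp p1.
  apply: (@le_trans _ _ (Cg * Num.sqrt (a phi) * (Cg * Num.sqrt (a p)) * a phi)).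
    apply: ler_wpM2r; first exact: a_ge0.
    by apply: ler_pM; [exact: lpnorm_ge0|exact: lpnorm_ge0|exact: h1|exact: h2].
  exact: sqrt_mul_le (a_ge0 phi) (a_ge0 p).
have HU := wd_sub_ge (nv phi) (nv p) (mass_w_gt0 Hp Hc).
exact: (laplacian_step_arith Dt0 (ltW oq) (mulr_ge0 (normr_ge0 lam) (sqr_ge0 Cg)) G0 aD HP Ht
  HT HU).
Qed.

End laplacian_estimate.

(** * Summation over the time steps and the theorem *)

Unset Implicit Arguments. Set Strict Implicit. Set Printing Implicit Defensive.

(** In the singular case [Fh] is at most h^2 / Cbar^2, exactly the reciprocal of the constant of
    [dlap_inverse]. *)
Lemma Fh_dlap_le {R : realType} {d : nat} {Om : set 'rV[R]_d} {Th : mesh R d}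
    {pot : potential R} {Cp Cbar : R} (N : nat) (C : nat -> R) f :
  polyhedral_domain Om -> conforming Om Th -> (0 < d)%N -> 0 < Cbar ->
  inverse_inequality Om Th Cbar -> singular pot -> in_Sh Om Th f ->
  Fh pot Th C N Cp Cbar * l2norm Om (dlap Om Th f) <= l2norm Om f.
Proof.
move=> Hp Hc d0 Cbar0 inv sp hf.
have h0 := hmax_gt0 Hp Hc d0.
have k0 : 0 < hmax Th ^+ 2 / Cbar ^+ 2 by apply: divr_gt0; exact: exprn_gt0.
have a0 : 0 <= l2norm Om (dlap Om Th f) by exact: sqrtr_ge0.
have F1 : Fh pot Th C N Cp Cbar <= hmax Th ^+ 2 / Cbar ^+ 2.
  rewrite /Fh sp ger_pMl//; by rewrite ge_min lexx orbT.
apply: (le_trans (ler_wpM2r a0 F1)).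
apply: (le_trans (ler_wpM2l (ltW k0) (dlap_inverse Hp Hc d0 inv hf))).
have E (x y z : R) : x != 0 -> y != 0 -> x ^+ 2 / y ^+ 2 * (y ^+ 2 / x ^+ 2 * z) = z.
  by move=> x0 y0; field; rewrite x0 y0.
by rewrite E ?gt_eqF.
Qed.

Lemma telescope_bound {R : realFieldType} (u a : nat -> R) (Dt kap r K : R) N :
  (forall n, (1 <= n <= N)%N ->
    2^-1 * (u n - u n.-1) + Dt * kap * a n + Dt * r * (a n - a n.-1) <= Dt * K) ->
  2^-1 * (u N - u 0%N) + Dt * kap * (\sum_(1 <= n < N.+1) a n) + Dt * r * (a N - a 0%N) <=
    N%:R * (Dt * K).
Proof.
elim: N => [_|N IHN H].
  by rewrite big_geq// !subrr !mulr0 !addr0 mul0r.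
have h1 := H N.+1 (leqnn _).
have h2 : 2^-1 * (u N - u 0%N) + Dt * kap * (\sum_(1 <= n < N.+1) a n) +
    Dt * r * (a N - a 0%N) <= N%:R * (Dt * K).
  by apply: IHN => n /andP[n1 nN]; apply: H; rewrite n1 leqW.
rewrite big_nat_recr//= -[N.+1%:R]natr1 mulrDl mul1r mulrDr.
move: h1 h2 => /=; lra.
Qed.

Lemma final_arith {R : realFieldType} (uN u0 S aN a0 Dt kap r K T m1 l M : R) :
  0 < kap -> 0 <= uN -> 0 <= r -> 0 <= Dt -> 0 <= aN -> u0 <= m1 -> M <= m1 ->
  r * (Dt * a0) <= r * (l * m1) ->
  2^-1 * (uN - u0) + Dt * kap * S + Dt * r * (aN - a0) <= T * K ->
  M + Dt * S <= m1 + kap^-1 * (T * K + m1 / 2 + r * (l * m1)).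
Proof.
move=> kap0 uN0 r0 Dt0 aN0 um Mm ha H; apply: lerD => //.
rewrite -(ler_pM2l kap0) [leRHS]mulrA divff ?gt_eqF// mul1r.
have := mulr_ge0 (mulr_ge0 Dt0 r0) aN0; lra.
Qed.

Theorem theorem4p6 (R : realType) (d : nat) (Om : set 'rV[R]_d)
    (I : Type) (Th : I -> mesh R d) (pot : potential R)
    (T lam Cp Cbar : R) (phi0 : 'rV[R]_d -> R) :
  (1 <= d <= 3)%N -> polyhedral_domain Om ->
  (forall i, conforming Om (Th i)) ->
  shape_regular Th -> quasi_uniform Th ->
  (forall i, acute (Th i)) ->
  valid_potential pot -> initial_condition pot Om phi0 ->
  0 < T ->
  0 < Cp -> poincare_wirtinger Om Cp ->
  0 < Cbar -> (forall i, inverse_inequality Om (Th i) Cbar) ->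
  (forall (i : I) (N : nat) (C : nat -> R),
     (0 < N)%N -> (forall k, (k < N)%N -> 0 < C k) ->
     let Dt := T / N%:R in
     let F := Fh pot (Th i) C N Cp Cbar in
     (lam != 0 -> Dt < lam ^- 4 * F ^+ 2) ->
     forall (n : nat) (prev : 'rV[R]_d -> R), (1 <= n <= N)%N ->
     step_data pot Om (Th i) phi0 C n prev ->
     exists phi mu : 'rV[R]_d -> R,
       [/\ step_solution pot Om (Th i) lam Dt prev phi mu,
           forall phi' mu', step_solution pot Om (Th i) lam Dt prev phi' mu' ->
             {in closure Om, phi' =1 phi} /\ {in closure Om, mu' =1 mu},
           stability_estimate pot Om (Th i) lam Dt F prev phi mu &
           singular pot -> forall x, closure Om x -> -1 < phi x < 1]) /\
  (forall Cg : R, singular pot -> 0 < Cg ->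
     (forall i, gagliardo_nirenberg Om (Th i) Cg) ->
     (lam != 0 -> `|lam| < (Num.sqrt 2 * Cg ^+ 2)^-1) ->
     exists K : R, forall (i : I) (N : nat) (C : nat -> R),
       (0 < N)%N -> (forall k, (k < N)%N -> 0 < C k) ->
       let Dt := T / N%:R in
       (lam != 0 -> Dt < lam ^- 4 * Fh pot (Th i) C N Cp Cbar ^+ 2) ->
       forall phi mu : nat -> 'rV[R]_d -> R,
       trajectory pot Om (Th i) lam Dt phi0 C N phi mu ->
       \big[Num.max/0]_(1 <= n < N.+1) l2norm Om (phi n) ^+ 2 +
       Dt * \sum_(1 <= n < N.+1) l2norm Om (dlap Om (Th i) (phi n)) ^+ 2 <= K).
Proof.
move=> d13 Hp Hc _ _ aT vp _ T0 Cp0 _ Cbar0 inv.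
have d0 : (0 < d)%N by case/andP: d13.
have oOm := Om_open Hp; have Omfin := Om_fin Hp.
split.
  move=> i N C N0 C0 Dt F hDt n prev hn [hp _ hH hs].
  have Dt0 : 0 < Dt by rewrite divr_gt0// ltr0n.
  have F0 : 0 < F by exact: (Fh_gt0 pot Hp (Hc i) d0 Cp0 Cbar0 N0 C0).
  have hs' : singular pot -> forall x, closure Om x -> -1 <= prev x <= 1.
    by move=> /hs[].
  have hF := Fh_grad_le Hp (Hc i) d0 Cp Cbar0 (inv i) hn C0 hp hH hs'.
  have hdom x : closure Om x -> dom_Psi pot (prev x).
    by rewrite /dom_Psi; case: ifPn => // sp cx; exact: hs'.
  have hm : singular pot -> -1 < mean Om prev < 1 by move=> /hs[].
  have [phi [mu S]] := step_exists Hp (Hc i) vp Dt0 hp F0 hF hDt hm.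
  exists phi, mu; split => //.
  - by move=> phi' mu' S'; exact: (step_unique Hp (Hc i) vp Dt0 F0 hF hDt S S').
  - exact: (step_stable Hp (Hc i) vp Dt0 hp F0 hF hdom S).
  - by move=> sp; exact: (step_bounds (Hc i) vp S sp).
move=> Cg sp Cg0 GN hlam.
have [theta [theta0 E]] : exists theta theta0, pot = Singular theta theta0.
  by move: sp; case: (pot) => // th th0 _; exists th, th0.
subst pot.
pose q := `|lam| * Cg ^+ 2.
have q0 : 0 <= q by rewrite mulr_ge0// sqr_ge0.
(* As sqrt 2 >= 1, the smallness condition gives |lam| Cg^2 < 1, which leaves part of the squared
   Laplacian after absorption. *)
have q1 : q < 1.
  have [l0|/hlam h] := eqVneq lam 0; first by rewrite /q l0 normr0 mul0r.
  have C2 : 0 < Cg ^+ 2 by exact: exprn_gt0.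
  have s2 : 1 <= Num.sqrt 2 :> R by rewrite -[leLHS]sqrtr1 ler_wsqrtr// ler1n.
  have s0 : 0 < Num.sqrt 2 :> R by exact: lt_le_trans s2.
  move: h; rewrite -(ltr_pM2r C2) invfM -mulrA mulVf ?gt_eqF// mulr1 => /lt_le_trans; apply.
  by rewrite invf_le1.
pose kap := (1 - q) / 2.
have kap0 : 0 < kap by rewrite divr_gt0// subr_gt0.
pose m1 := intg Om (fun=> 1).
pose K1 := theta0 ^+ 2 * m1 / (2 * (1 - q)).
(* The first [m1] bounds the supremum, since |phi_n| <= 1. In the bracket, [T * K1] sums the
   right-hand sides over N steps, [m1 / 2] is the initial lumped norm, and the last term bounds the
   initial Laplacian left by telescoping. *)
exists (m1 + kap^-1 * (T * K1 + m1 / 2 + q / 4 * (lam ^- 4 * m1))).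
move=> i N C N0 C0 Dt hDt phi mu traj.
have Dt0 : 0 < Dt by rewrite divr_gt0// ltr0n.
(* For n = 0 the bound is part of the data of the first step, afterwards it comes from
   [step_bounds]. *)
have bnd n : (n <= N)%N ->
    in_Sh Om (Th i) (phi n) /\ forall x, closure Om x -> -1 <= phi n x <= 1.
  case: n => [_|n nN].
    have [[h _ _ /(_ isT)[h1 _]] _] := traj 1%N N0.
    by split.
  have [_ S] := traj n.+1 nN; have [h _ _ _] := S; split => // x cx.
  by have /andP[/ltW -> /ltW ->] := step_bounds (Hc i) vp S isT cx.
pose a n := l2norm Om (dlap Om (Th i) (phi n)) ^+ 2.
pose u n := dot (wd (mass_w Om (Th i)) (nv (Th i) (phi n))) (nv (Th i) (phi n)).
have steps n : (1 <= n <= N)%N ->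
    2^-1 * (u n - u n.-1) + Dt * kap * a n + Dt * (q / 4) * (a n - a n.-1) <= Dt * K1.
  move=> hn; have [_ S] := traj n hn.
  have [hp p1] : in_Sh Om (Th i) (phi n.-1) /\ forall x, closure Om x -> -1 <= phi n.-1 x <= 1.
    by apply: bnd; case/andP: hn => n1 nN; exact: leq_trans (leq_pred n) nN.
  have := laplacian_step Hp (Hc i) d13 (aT i) vp Dt0 Cg0 (GN i) q1 hp p1 S.
  by rewrite -/(u n) -/(u n.-1) -/q.
have := telescope_bound u a Dt kap (q / 4) K1 N steps.
have -> : N%:R * (Dt * K1) = T * K1.
  by rewrite mulrA /Dt [N%:R * _]mulrC divfK// pnatr_eq0 -lt0n.
have [hp0 p01] := bnd 0%N (leq0n N).
have l2m n : (n <= N)%N -> l2norm Om (phi n) ^+ 2 <= m1.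
  by move=> /bnd[h h1]; exact: (l2norm_le1 Hp (Hc i)).
apply: (@final_arith _ _ _ _ _ _ Dt kap (q / 4)) => //.
- exact: (dot_wd_ge0 (mass_w_gt0 Hp (Hc i))).
- by rewrite divr_ge0.
- exact: ltW.
- exact: sqr_ge0.
- exact: (nodal_le_measure Hp (Hc i)).
- rewrite big_nat; elim/big_ind : _ => [|x y hx hy|n /andP[_ nN]].
  + exact: le_trans (sqr_ge0 _) (l2m 0%N (leq0n N)).
  + by rewrite ge_max hx.
  + exact: l2m.
(* For [lam = 0] the weight [q] vanishes. Otherwise Dt |Delta_h phi^0|^2 <= lam^-4 (F |Delta_h
   phi^0|)^2 <= lam^-4 |phi^0|^2 <= lam^-4 m1. *)
- have [l0|ln0] := eqVneq lam 0; first by rewrite /q l0 normr0 !mul0r.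
  apply: ler_wpM2l; first by rewrite divr_ge0.
  have l4 : 0 <= lam ^- 4 by rewrite invr_ge0 exprn_even_ge0.
  have FL := @Fh_dlap_le _ _ _ _ _ Cp _ N C _ Hp (Hc i) d0 Cbar0 (inv i) sp hp0.
  have F0 := Fh_gt0 (Singular theta theta0) Hp (Hc i) d0 Cp0 Cbar0 N0 C0.
  apply: (le_trans (ler_wpM2r (sqr_ge0 _) (ltW (hDt ln0)))).
  rewrite -mulrA -exprMn; apply: ler_wpM2l => //.
  apply: le_trans (l2m 0%N (leq0n N)).
  rewrite ler_pXn2r ?nnegrE//; first exact: mulr_ge0 (ltW F0) (sqrtr_ge0 _).
  exact: sqrtr_ge0.
Qed.
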